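(* Let $\mathcal{G}$ be an ideal of graphs, let $D$ be the diamond graph, and let $\mathcal{D}$ be the class of graphs with no topological minor isomorphic to $D$. Then $\kappa_{\mathcal{D}}$ is bounded on $\mathcal{G}$ if and only if $\operatorname{FAN}(D,S) \not\subseteq \mathcal{G}$ for every $S \subseteq V(D)$ such that $|S| \leq 1$ or $S$ consists of the pair of degree-$2$ vertices of $D$.
   Context: All graphs are finite and simple. The diamond $D$ is the graph obtained from $K_4$ by removing one edge. $H$ is a topological minor of $G$ if $G$ has a subgraph isomorphic to a subdivision of $H$ (edges replaced by internally disjoint paths of length at least $1$). An ideal is a class of graphs closed under isomorphisms and taking topological minors. For a class $\mathcal{C}$ of graphs and a graph $G$, $\kappa_{\mathcal{C}}(G)$ ($\mathcal{C}$-vertex-brittleness) is the minimum $\ell$ such that there is a partition $(E_1,\dots,E_n)$ of $E(G)$ for which the subgraph of $G$ induced by the edges in $E_i$ (consisting of those edges and their ends) belongs to $\mathcal{C}$ for each $i$, and the number of vertices incident with edges in distinct $E_i$'s is $\ell$. A graph parameter $f$ is bounded on a class $\mathcal{G}$ if there is a constant $M$ with $|f(G)|\le M$ for all $G\in\mathcal{G}$. For a graph $G$, $S\subsetneq V(G)$ and a positive integer $k$, $\operatorname{Fan}(G,S,k)$ is the graph obtained from $k$ vertex-disjoint copies of $G$ by identifying all the copies of $v$ for each $v\in S$ and identifying all the copies of $e$ for each $e\in E(G[S])$. $\operatorname{FAN}(G,S)$ is the ideal of all graphs isomorphic to a topological minor of $\operatorname{Fan}(G,S,k)$ for some positive integer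 $k$. *)

(* Defs.v *)
From mathcomp Require Import all_boot.
From mathcomp Require classical_sets.

Set Implicit Arguments.
Unset Strict Implicit.
Unset Printing Implicit Defensive.

Record sgraph := SGraph {
  vertex :> finType;
  adj : rel vertex;
  adj_sym : symmetric adj;
  adj_irrefl : irreflexive adj }.

Arguments adj {G} : rename.
Notation "x -- y" := (adj x y) (at level 30, no associativity).

Definition edges (G : sgraph) : {set {set G}} :=
  [set [set u.1; u.2] | u in [set u : G * G | u.1 -- u.2]].

Definition deg (G : sgraph) (v : G) : nat := #|[set u | v -- u]|.

Definition isomorphic (G H : sgraph) : Prop :=
  exists f : G -> H, bijective f /\ {mono f : x y / x -- y}.

(* [K] is isomorphic to a (not necessarily induced) subgraph of [G]. *)
Definition isubgraph (K G : sgraph) : Prop :=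
  exists f : K -> G, injective f /\ {homo f : x y / x -- y}.

(* [f] places the branch vertices and, for an edge [x -- y] of [H], the list
   [P x y] holds the internal vertices, in order from [f x] to [f y], of the
   path that replaces this edge ([P x y] is irrelevant when [x], [y] are not
   adjacent). The last two conditions say that [K] has no vertices and no edges
   other than those of these paths and the branch vertices. *)
Record subdivision_via (H K : sgraph) (f : H -> K) (P : H -> H -> seq K) :
    Prop := SubdivisionVia {
  branch_inj : injective f;
  path_rev : forall x y, x -- y -> P y x = rev (P x y);
  path_uniq : forall x y, x -- y -> uniq (P x y);
  path_avoid : forall x y z, x -- y -> f z \notin P x y;
  path_disj : forall x y x' y' v, x -- y -> x' -- y' ->
    v \in P x y -> v \in P x' y' -> [set x; y] = [set x'; y'];
  subdiv_vertex : forall v : K,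
    (exists x, v = f x) \/ (exists x y, x -- y /\ v \in P x y);
  subdiv_edge : forall u v : K, u -- v <->
    exists x y, x -- y /\ infix [:: u; v] (f x :: rcons (P x y) (f y)) }.

(* [K] is, up to isomorphism, a subdivision of [H]. *)
Definition subdivision (H K : sgraph) : Prop :=
  exists f P, @subdivision_via H K f P.

Definition top_minor (H G : sgraph) : Prop :=
  exists K, subdivision H K /\ isubgraph K G.

Definition graph_class := sgraph -> Prop.

Definition subclass (C C' : graph_class) : Prop := forall G, C G -> C' G.

Definition ideal (C : graph_class) : Prop :=
  (forall G H, isomorphic G H -> C G -> C H) /\
  (forall G H, top_minor H G -> C G -> C H).

Definition top_minor_free (H : sgraph) : graph_class :=
  fun G => ~ top_minor H G.

Section EdgeInduced.
Variables (G : sgraph) (E : {set {set G}}).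

Definition einduced_vertex : finType := {v : G | v \in cover E}.

Definition einduced_adj : rel einduced_vertex :=
  fun u v => (val u -- val v) && ([set val u; val v] \in E).

Lemma einduced_sym : symmetric einduced_adj.
Proof. by move=> u v; rewrite /einduced_adj adj_sym setUC. Qed.

Lemma einduced_irrefl : irreflexive einduced_adj.
Proof. by move=> u; rewrite /einduced_adj adj_irrefl. Qed.

Definition einduced : sgraph := SGraph einduced_sym einduced_irrefl.

End EdgeInduced.

Definition shared_vertices (G : sgraph) (P : {set {set {set G}}}) : {set G} :=
  [set v | [exists A in P, exists B in P,
             [&& A != B, v \in cover A & v \in cover B]]].

Definition brittle_with (C : graph_class) (G : sgraph) (l : nat) : Prop :=
  exists P : {set {set {set G}}},
    [/\ partition P (edges G),
        forall A, A \in P -> C (einduced A)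
      & #|shared_vertices P| = l].

(* The least [l] such that [brittle_with C G l]. Such an [l] exists as soon as
   [C] contains the one-edge graphs (split [G] into single edges); when there
   is none, the value is the dummy 0. *)
Definition kappa (C : graph_class) (G : sgraph) : nat :=
  classical_sets.xget 0
    (fun l => brittle_with C G l /\ forall m, brittle_with C G m -> l <= m).

Definition bounded_on (f : sgraph -> nat) (C : graph_class) : Prop :=
  exists M, forall G, C G -> f G <= M.

Section Fan.
Variables (G : sgraph) (S : {set G}) (k : nat).

(* One vertex for each element of [S] (its [k] copies being identified), and
   [k] copies of each of the other vertices. *)
Definition fan_vertex : finType :=
  ({v : G | v \in S} + {v : G | v \notin S} * 'I_k)%type.

Definition fan_adj : rel fan_vertex := fun a b =>
  match a, b with
  | inl u, inl v => val u -- val v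
  | inl u, inr (v, _) => val u -- val v
  | inr (u, _), inl v => val u -- val v
  | inr (u, i), inr (v, j) => (i == j) && (val u -- val v)
  end.

Lemma fan_sym : symmetric fan_adj.
Proof.
by move=> [u|[u i]] [v|[v j]] /=; rewrite adj_sym // [i == j]eq_sym.
Qed.

Lemma fan_irrefl : irreflexive fan_adj.
Proof. by move=> [u|[u i]] /=; rewrite adj_irrefl ?andbF. Qed.

Definition Fan : sgraph := SGraph fan_sym fan_irrefl.

End Fan.

Definition FAN (G : sgraph) (S : {set G}) : graph_class :=
  fun H => exists2 k, 0 < k & top_minor H (Fan S k).

(* K_4 on the vertices 0, 1, 2, 3 without the edge joining 0 and 1. *)
Definition diamond_adj : rel 'I_4 := fun x y =>
  (x != y) && ([set x; y] != [set inord 0; inord 1]).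

Lemma diamond_sym : symmetric diamond_adj.
Proof. by move=> x y; rewrite /diamond_adj eq_sym setUC. Qed.

Lemma diamond_irrefl : irreflexive diamond_adj.
Proof. by move=> x; rewrite /diamond_adj eqxx. Qed.

Definition diamond : sgraph := SGraph diamond_sym diamond_irrefl.

(* Main.v *)
Require Import Defs.
From mathcomp Require Import all_boot zify boolp.
From mathcomp Require classical_sets.

Set Implicit Arguments.
Unset Strict Implicit.
Unset Printing Implicit Defensive.

(* A diamond topological minor is the same as a theta: two vertices joined by
   three internally disjoint paths. If Fan(D, S, k) is in the class, then in an
   edge partition with fewer than k shared vertices some copy of D - S has no
   shared vertex; as D - S is connected and S is independent, that copy of D
   lies in a single part.
   Conversely, suppose that G contains none of the fans of order k. Thetas have
   the Erdos-Posa property, so boundedly many vertices X meet all thetas. The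
   graph G - X is theta-free, hence has tree-width at most 2, so disjoint
   connected subgraphs of it can be packed or else hit by few vertices. A
   connected H in G - X that forms a theta together with X forms one with a
   single vertex of X, or contains two adjacent disjoint connected sets both of
   which are adjacent to the same two vertices of X. Many disjoint such H give
   a fan, so boundedly many vertices Y hit all of them. For the same reason only
   few components of G - X - Y form a theta with X and Y. The parts are the sets
   of edges meeting one component, except that the edges inside X and Y, and
   those joining a bad component to Y, are parts by themselves; there are at
   most two of the latter for each bad component and vertex of Y, since G - X is
   theta-free. *)

(** * Connected sets and minor models of the three-edge dipole *)

(** The Erdos-Posa step removes a path spanning a theta rather than the theta itself. If the rest
    has few disjoint thetas, then, up to boundedly many vertices, what remains is that path and a
    theta-free set [F], and the linear order of the path takes over: intervals of a line can be
    packed or hit, and many disjoint links across one cut point contain, by Erdos-Szekeres, a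
    monotone ladder, which is cut into thetas. The connected parts of [F] that see three vertices of
    the path have to be dealt with beforehand. Thetas are kept as minor models, pairs of connected
    sets with three edges between them, because these adapt easily to the elimination of a vertex
    and to the absorption of a vertex into a side; explicit paths appear only to extract a spanning
    path and to build fans. The vertices of [Y] can themselves serve in new thetas, and hitting
    those would only create further such vertices. Instead a bad component is cut off from [Y],
    after which only [X] is left to it, and with [X] it forms no theta of the dangerous kinds. *)

Section Connected.
Variables (T : finType) (e : rel T).

(** Connectedness as an induction principle: a set that contains a point of [A] and is closed under
    the edges inside [A] contains [A]. Later proofs consist in naming the right [U]. *)
Definition conn (A : {set T}) : bool :=
  (A != set0) &&
  [forall U : {set T}, [exists x in A, x \in U] &&
     [forall x in A :&: U, forall y in A, e x y ==> (y \in U)] ==>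
     (A \subset U)].

Lemma connP (A : {set T}) :
  reflect (A != set0 /\ forall (U : {set T}) x, x \in A -> x \in U ->
             (forall y z, y \in A -> y \in U -> z \in A -> e y z -> z \in U) ->
             A \subset U)
          (conn A).
Proof.
apply: (iffP andP) => -[A0 cA]; split=> //.
  move=> U x xA xU cU; have /implyP := forallP cA U; apply.
  apply/andP; split; first by apply/existsP; exists x; rewrite xA.
  apply/forall_inP => y /setIP[yA yU]; apply/forall_inP => z zA.
  by apply/implyP; apply: cU.
apply/forallP => U; apply/implyP => /andP[/existsP[x /andP[xA xU]] cU].
apply: (cA U x) => // y z yA yU zA; move: cU => /forall_inP/(_ y).
by rewrite inE yA yU => /(_ isT)/forall_inP/(_ z zA)/implyP.
Qed.

Lemma conn_neq0 (A : {set T}) : conn A -> A != set0.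
Proof. by case/andP. Qed.

Lemma conn_ex (A : {set T}) : conn A -> exists x, x \in A.
Proof. by move/conn_neq0/set0Pn. Qed.

Lemma conn_closed (A U : {set T}) x : conn A -> x \in A -> x \in U ->
  (forall y z, y \in A -> y \in U -> z \in A -> e y z -> z \in U) ->
  A \subset U.
Proof. by case/connP => _; apply. Qed.

Lemma conn_cross (A U : {set T}) x y : conn A -> x \in A -> x \in U ->
  y \in A -> y \notin U ->
  exists a b, [/\ a \in A, a \in U, b \in A, b \notin U & e a b].
Proof.
move=> cA xA xU yA yU.
have [/existsP[[a b] /and5P[aA aU bA bU ab]]|no] :=
  boolP [exists u : T * T, [&& u.1 \in A, u.1 \in U, u.2 \in A, u.2 \notin U
           & e u.1 u.2]].
  by exists a, b; split.
case/negP: yU; apply: subsetP yA; apply: conn_closed cA xA xU _ => a b aA aU bA ab.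
by apply: contraNT no => bU; apply/existsP; exists (a, b); apply/and5P; split.
Qed.

Lemma conn1 x : conn [set x].
Proof.
apply/connP; split; first by apply/set0Pn; exists x; rewrite inE.
by move=> U y; rewrite inE => /eqP-> xU _; rewrite sub1set.
Qed.

Hypothesis e_sym : symmetric e.

(** By symmetry the complement of a closed set is closed, so a closed set missing the root would
    have all of [A] in its complement. *)
Lemma conn_root (A : {set T}) x : x \in A ->
  (forall U : {set T}, x \in U ->
     (forall y z, y \in A -> y \in U -> z \in A -> e y z -> z \in U) ->
     A \subset U) -> conn A.
Proof.
move=> xA cA; apply/connP; split; first by apply/set0Pn; exists x.
move=> U y yA yU cU; have [xU|xU] := boolP (x \in U); first exact: cA cU.
have /subsetP/(_ y yA) : A \subset ~: U.
  apply: cA; first by rewrite inE.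
  move=> a b aA; rewrite !inE => aU bA ab; apply: contra aU => bU.
  by apply: cU bU aA _ => //; rewrite e_sym.
by rewrite inE yU.
Qed.

Lemma conn_linkU (A B : {set T}) x y : conn A -> conn B -> x \in A -> y \in B ->
  e x y -> conn (A :|: B).
Proof.
move=> cA cB xA yB xy; apply: (@conn_root _ x); first by rewrite inE xA.
move=> U xU cU.
have AU : A \subset U.
  by apply: conn_closed cA xA xU _ => a b aA aU bA; apply: cU; rewrite ?inE ?aA ?bA.
have yU : y \in U by apply: cU xy; rewrite ?inE ?xA ?yB ?orbT.
have BU : B \subset U.
  apply: conn_closed cB yB yU _ => a b aA aU bA; apply: cU => //;
  by rewrite ?inE ?aA ?bA ?orbT.
by rewrite subUset AU.
Qed.

Lemma conn_meetU (A B : {set T}) x : conn A -> conn B -> x \in A -> x \in B ->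
  conn (A :|: B).
Proof.
move=> cA cB xA xB; apply: (@conn_root _ x); first by rewrite inE xA.
move=> U xU cU; rewrite subUset; apply/andP; split.
  by apply: conn_closed cA xA xU _ => a b aA aU bA; apply: cU; rewrite ?inE ?aA ?bA.
by apply: conn_closed cB xB xU _ => a b aA aU bA; apply: cU; rewrite ?inE ?aA ?bA ?orbT.
Qed.

Lemma conn_add (A : {set T}) x y : conn A -> x \in A -> e x y -> conn (y |: A).
Proof.
move=> cA xA xy; apply: (conn_linkU (conn1 y) cA _ xA); first by rewrite inE.
by rewrite e_sym.
Qed.

Lemma conn_star (I : finType) (P : pred I) (F : I -> {set T}) x :
  (exists i, P i) -> (forall i, P i -> conn (F i)) ->
  (forall i, P i -> x \in F i) -> conn (\bigcup_(i | P i) F i).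
Proof.
move=> [i0 Pi0] cF xF; apply: (@conn_root _ x).
  by apply/bigcupP; exists i0; rewrite ?xF.
move=> U xU cU; apply/bigcupsP => i Pi.
apply: conn_closed (cF i Pi) (xF i Pi) xU _ => a b aF aU bF; apply: cU => //;
by apply/bigcupP; exists i.
Qed.

(** Empty when [x] lies outside [A]. *)
Definition component (A : {set T}) x : {set T} :=
  \bigcup_(U : {set T} | [&& conn U, U \subset A & x \in U]) U.

Lemma comp_conn (A : {set T}) x : x \in A -> conn (component A x).
Proof.
move=> xA; apply: (conn_star (x := x)) => [|U /and3P[] //|U /and3P[] //].
by exists [set x]; rewrite conn1 sub1set xA inE eqxx.
Qed.

Lemma comp_sub (A : {set T}) x : component A x \subset A.
Proof. by apply/bigcupsP => U /and3P[]. Qed.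

Lemma comp_in (A : {set T}) x : x \in A -> x \in component A x.
Proof.
move=> xA; apply/bigcupP; exists [set x]; last by rewrite inE.
by rewrite conn1 sub1set xA inE eqxx.
Qed.

Lemma comp_max (A U : {set T}) x : conn U -> U \subset A -> x \in U ->
  U \subset component A x.
Proof. by move=> cU UA xU; apply: bigcup_sup; apply/and3P. Qed.

Lemma comp_max2 (A U : {set T}) x y : conn U -> U \subset A ->
  y \in U -> y \in component A x -> U \subset component A x.
Proof.
move=> cU UA yU /bigcupP[V /and3P[cV VA xV] yV].
apply: subset_trans (subsetUr V U) _.
by apply: comp_max; rewrite ?subUset ?VA ?UA ?(conn_meetU cV cU yV yU) ?inE ?xV.
Qed.

Lemma comp_closed (A : {set T}) x y z : y \in component A x -> z \in A -> e y z ->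
  z \in component A x.
Proof.
move=> yC zA yz; have yA := subsetP (comp_sub A x) y yC.
apply: (subsetP (@comp_max2 A [set y; z] x y _ _ _ yC)); rewrite ?inE ?eqxx ?orbT //.
  by apply: conn_linkU (conn1 y) (conn1 z) _ _ yz; rewrite inE.
by apply/subsetP => t; rewrite !inE => /orP[]/eqP->.
Qed.

Lemma comp_eq (A : {set T}) x y : y \in component A x -> component A y = component A x.
Proof.
move=> yC; have yA := subsetP (comp_sub A x) y yC.
have xA : x \in A.
  by case/bigcupP: (yC) => U /and3P[_ /subsetP UA /UA].
have xC := comp_in xA; apply/eqP; rewrite eqEsubset; apply/andP; split.
  by apply: comp_max2 (comp_conn yA) (comp_sub A y) (comp_in yA) yC.
by apply: comp_max (comp_conn xA) (comp_sub A x) yC.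
Qed.

Lemma comp_disj (A : {set T}) x y : component A x != component A y ->
  [disjoint component A x & component A y].
Proof.
apply: contraR => /pred0Pn[z /andP[/= zx zy]].
by rewrite -(comp_eq zx) (comp_eq zy).
Qed.

Lemma conn_path x s : path e x s -> conn [set y in x :: s].
Proof.
elim: s x => [x _|y s IH x /= /andP[xy ys]].
  by have := conn1 x; congr (conn _); apply/setP => z; rewrite !inE.
have := conn_linkU (conn1 x) (IH y ys) (x := x) (y := y); rewrite !inE !eqxx.
move=> /(_ isT isT xy); congr (conn _); apply/setP => z; rewrite !inE; by case: (z == x).
Qed.

Lemma conn_pathE (A : {set T}) x y : conn A -> x \in A -> y \in A ->
  exists s, [/\ path e x s, uniq (x :: s), last x s = y & {subset x :: s <= A}].
Proof.
move=> cA xA yA.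
pose r := [rel a b | e a b && (b \in A)].
have /subsetP/(_ y yA) : A \subset [set z | connect r x z].
  apply: conn_closed cA xA _ _; first by rewrite inE.
  move=> a b aA; rewrite !inE => xa bA ab; apply: connect_trans xa (connect1 _).
  by rewrite /= ab.
rewrite inE => /connectP[s0 s0r ->]; case: (shortenP s0r) => s sr us _.
exists s; split=> //.
  by apply: sub_path sr => a b /andP[].
elim: s x xA sr {s0 s0r us} => [x xA _ z|b s IH x xA /= /andP[/andP[_ bA] sr] z].
  by rewrite inE => /eqP->.
by rewrite inE => /orP[/eqP->//|]; apply: IH.
Qed.

End Connected.

Lemma conn_sub (T : finType) (e e' : rel T) (A : {set T}) :
  {in A &, subrel e e'} -> conn e A -> conn e' A.
Proof.
move=> ee' cA; apply/connP; split; first exact: conn_neq0 cA.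
move=> U x xA xU cU; apply: conn_closed cA xA xU _ => y z yA yU zA yz.
by apply: (cU y z) => //; apply: ee'.
Qed.

Lemma disjoint_setUl (T : finType) (A B C : {set T}) :
  [disjoint A :|: B & C] = [disjoint A & C] && [disjoint B & C].
Proof. by rewrite -!setI_eq0 setIUl setU_eq0. Qed.

Lemma disjoint_setUr (T : finType) (A B C : {set T}) :
  [disjoint C & A :|: B] = [disjoint C & A] && [disjoint C & B].
Proof. by rewrite -!setI_eq0 setIUr setU_eq0. Qed.

Lemma card_gt2_subset3 (T : finType) (A : {set T}) : 2 < #|A| ->
  exists a b c, [/\ a \in A, b \in A & c \in A] /\ [/\ a != b, a != c & b != c].
Proof.
move=> A3; have /set0Pn[a aA] : A != set0 by rewrite -card_gt0; lia.
have /set0Pn[b] : A :\ a != set0.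
  by rewrite -card_gt0; move: (cardsD1 a A); rewrite aA; lia.
rewrite !inE => /andP[ba bA].
have /set0Pn[c] : A :\ a :\ b != set0.
  rewrite -card_gt0; move: (cardsD1 a A) (cardsD1 b (A :\ a)); rewrite !inE ba bA aA.
  lia.
rewrite !inE => /and3P[cb ca cA]; exists a, b, c; split; first by split.
by rewrite ![a == _]eq_sym ba ca eq_sym cb.
Qed.

Lemma card_gt2 (T : finType) (A : {set T}) a b c : a \in A -> b \in A -> c \in A ->
  [/\ a != b, a != c & b != c] -> 2 < #|A|.
Proof.
move=> aA bA cA [ab ac bc]; have cab : c \notin [set a; b].
  by rewrite !inE negb_or ![c == _]eq_sym ac bc.
have <- : #|c |: [set a; b]| = 3 by rewrite cardsU1 cab cards2 ab.
apply: subset_leq_card; apply/subsetP => z; rewrite !inE.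
by case/or3P=> /eqP->.
Qed.

Section Theta.
Variables (T : finType) (e : rel T).

Definition between (A B : {set T}) : {set T * T} :=
  [set u | [&& u.1 \in A, u.2 \in B & e u.1 u.2]].

(* A minor model of the three-edge dipole; since the latter is subcubic, this
   amounts to a subdivided diamond inside [S]. *)
Definition theta_model (A B : {set T}) : bool :=
  [&& conn e A, conn e B, [disjoint A & B] & 2 < #|between A B|].

Definition theta (S : {set T}) : bool :=
  [exists A : {set T}, exists B : {set T},
    (A :|: B \subset S) && theta_model A B].

Lemma thetaP (S : {set T}) :
  reflect (exists A B, A :|: B \subset S /\ theta_model A B) (theta S).
Proof.
apply: (iffP existsP) => [[A /existsP[B /andP[]]]|[A [B [AB m]]]].
  by exists A, B.
by exists A; apply/existsP; exists B; rewrite AB.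
Qed.

Lemma theta_mono (S S' : {set T}) : S \subset S' -> theta S -> theta S'.
Proof.
move=> SS' /thetaP[A [B [AB m]]]; apply/thetaP; exists A, B; split=> //.
exact: subset_trans SS'.
Qed.

Lemma theta_neq0 (S : {set T}) : theta S -> S != set0.
Proof.
move=> /thetaP[A [B [/subsetP AB /andP[/conn_ex[x xA] _]]]].
by apply/set0Pn; exists x; apply: AB; rewrite inE xA.
Qed.

Lemma between3 (A B : {set T}) (a1 b1 a2 b2 a3 b3 : T) :
  [/\ a1 \in A, a2 \in A & a3 \in A] -> [/\ b1 \in B, b2 \in B & b3 \in B] ->
  [/\ e a1 b1, e a2 b2 & e a3 b3] ->
  [/\ (a1, b1) != (a2, b2), (a1, b1) != (a3, b3) & (a2, b2) != (a3, b3)] ->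
  2 < #|between A B|.
Proof.
move=> [a1A a2A a3A] [b1B b2B b3B] [e1 e2 e3].
by apply: card_gt2; rewrite inE; apply/and3P.
Qed.

Hypothesis e_sym : symmetric e.

Lemma between_sym (A B : {set T}) : #|between A B| = #|between B A|.
Proof.
have sw : injective (fun u : T * T => (u.2, u.1)) by move=> [a b] [c d] [-> ->].
rewrite -(card_imset _ sw); congr #|pred_of_set _|.
apply/setP => -[a b]; rewrite !inE /=; apply/imsetP/and3P.
  by case=> -[c d]; rewrite !inE /= => /and3P[cA dB cd] [-> ->]; rewrite e_sym.
by case=> aB bA ab; exists (b, a); rewrite // !inE /= bA aB e_sym.
Qed.

Lemma theta_model_sym (A B : {set T}) : theta_model A B = theta_model B A.
Proof.
by rewrite /theta_model disjoint_sym between_sym andbCA.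
Qed.

Lemma theta_star x (B : {set T}) (y1 y2 y3 : T) : conn e B -> x \notin B ->
  [/\ y1 \in B, y2 \in B & y3 \in B] -> [/\ e x y1, e x y2 & e x y3] ->
  [/\ y1 != y2, y1 != y3 & y2 != y3] -> theta_model [set x] B.
Proof.
move=> cB xB yB xy [n1 n2 n3]; rewrite /theta_model conn1 cB disjoints1 xB /=.
by apply: (between3 (b1 := y1) (b2 := y2) (b3 := y3) _ yB xy); split;
  rewrite ?inE ?xpair_eqE ?eqxx.
Qed.

(* The first vertex of a longest path has all its neighbours on the path. *)
Lemma theta_free_small_degree (S : {set T}) : S != set0 -> ~~ theta S ->
  exists2 v, v \in S & #|[set u in S :\ v | e v u]| <= 2.
Proof.
move=> /set0Pn[v0 v0S] nth.
have [/exists_inP[v vS vd]|no] := boolP [exists v in S, #|[set u in S :\ v | e v u]| <= 2].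
  by exists v.
suff /(_ #|T|)[x [s [+ us _ _]]] : forall n, exists x s,
    [/\ size s = n, uniq (x :: s), path e x s & {subset x :: s <= S}].
  by move=> ss; have := max_card [in x :: s]; rewrite (card_uniqP us) /= ss ltnn.
elim=> [|n [x [s [ss us ps sS]]]].
  by exists v0, [::]; split=> // z; rewrite inE => /eqP->.
have xS : x \in S by rewrite sS ?mem_head.
have x3 : 2 < #|[set u in S :\ x | e x u]|.
  by rewrite ltnNge; move: no; rewrite negb_exists_in => /forall_inP/(_ x xS).
have [sub|/subsetPn[y]] := boolP ([set u in S :\ x | e x u] \subset [set u in s]).
  have [a [b [c [[ax bx cx] [ab ac bc]]]]] := card_gt2_subset3 x3.
  case: s {ss} us ps sS sub => [|y s] us ps sS sub.
    by move: (subsetP sub _ ax); rewrite inE.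
  case/negP: nth; apply/thetaP; exists [set x], [set u in y :: s]; split.
    apply/subsetP => z; rewrite in_setU in_set1 in_set => /orP[/eqP->//|zs].
    by apply: sS; rewrite in_cons zs orbT.
  apply: (@theta_star _ _ a b c) => //.
  - by apply: conn_path e_sym _ _ _; case/andP: ps.
  - by rewrite in_set; case/andP: us.
  - by split; apply: (subsetP sub).
  - by split; [move: ax|move: bx|move: cx]; rewrite !inE => /andP[].
rewrite !inE => /andP[/andP[yx yS] xy] ys; exists y, (x :: s); split=> //=.
- by rewrite ss.
- by rewrite inE negb_or yx ys.
- by rewrite e_sym xy.
- by move=> z; rewrite inE => /orP[/eqP->//|]; apply: sS.
Qed.

End Theta.

(** * Theta-free graphs have tree-width at most two *)

Section Elimination.
Variables (T : finType) (e : rel T) (v : T).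
Hypothesis e_sym : symmetric e.

Definition elim_rel : rel T :=
  fun x y => e x y || [&& x != y, e v x & e v y].

Lemma elim_rel_sym : symmetric elim_rel.
Proof.
by move=> x y; rewrite /elim_rel e_sym eq_sym; case: (e v x); case: (e v y).
Qed.

(** [v] joins the side of its neighbour [n], where walks through [v] replace the new edges. As [v]
    has at most one neighbour besides [n], no new edge lies inside [B], and new edges between the
    sides become edges at [v]. *)
Lemma theta_elim_half (S A B : {set T}) n :
  v \in S -> #|[set u in S :\ v | e v u]| <= 2 ->
  A :|: B \subset S :\ v -> theta_model elim_rel A B ->
  n \in A -> e v n -> theta e S.
Proof.
move=> vS N2 ABS /and4P[cA cB dAB eAB] nA vn.
have AS x : x \in A -> (x != v) && (x \in S).
  by move=> xA; have := subsetP ABS x; rewrite !inE xA; apply.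
have BS x : x \in B -> (x != v) && (x \in S).
  by move=> xB; have := subsetP ABS x; rewrite !inE xB orbT; apply.
have key x1 x2 y : x1 \in A -> x2 \in A -> y \in B -> e v x1 -> e v x2 -> e v y -> x1 = x2.
  move=> x1A x2A yB vx1 vx2 vy; apply/eqP; apply: contraTT N2 => x12.
  rewrite -ltnNge; apply: (@card_gt2 _ _ x1 x2 y); rewrite ?inE ?vx1 ?vx2 ?vy ?andbT.
  - exact: AS.
  - exact: AS.
  - exact: BS.
  by split=> //; apply: contraTneq yB => <-; rewrite (disjointFr dAB).
apply/thetaP; exists (v |: A), B; split.
  rewrite -setUA subUset sub1set vS; apply: subset_trans ABS _.
  exact: subsetDl.
have cBe : conn e B.
  apply: conn_sub cB => x y xB yB /orP[//|/and3P[xy vx vy]].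
  move: N2; rewrite leqNgt => /negP[].
  apply: (@card_gt2 _ _ n x y); rewrite ?inE ?vn ?vx ?vy ?andbT.
  - exact: AS.
  - exact: BS.
  - exact: BS.
  by split=> //; [move: xB|move: yB]; apply: contraTneq => <-; rewrite (disjointFr dAB).
rewrite /theta_model cBe; apply/and4P; split=> //.
- apply: (conn_root e_sym (x := v)); first by rewrite !inE eqxx.
  move=> U vU cU; rewrite subUset sub1set vU.
  have nU : n \in U by apply: (cU v) => //; rewrite !inE ?eqxx ?nA ?orbT.
  apply: conn_closed cA nA nU _ => a b aA aU bA /orP[ab|/and3P[_ _ vb]].
    by apply: (cU a) => //; rewrite !inE ?aA ?bA ?orbT.
  by apply: (cU v) => //; rewrite !inE ?eqxx ?bA ?orbT.
- rewrite disjoint_sym disjoints_subset; apply/subsetP => x xB.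
  by rewrite !inE negb_or (disjointFl dAB xB) andbT; case/andP: (BS x xB).
- apply: leq_trans eAB _.
  (* A new edge between the sides needs a neighbour of [v] on each side, and then there is only one
     in [A]; hence replacing such an edge by [(v, u.2)] is injective. *)
  pose g (u : T * T) := if e u.1 u.2 then u else (v, u.2).
  rewrite -(card_in_imset (f := g)).
    apply: subset_leq_card; apply/subsetP => _ /imsetP[[x y] /[!inE]/= /and3P[xA yB xy] ->].
    rewrite /g /=; case: ifP => exy /=; first by rewrite xA yB exy orbT.
    by move: xy; rewrite /elim_rel exy eqxx yB /= => /and3P[].
  move=> [x y] [x' y']; rewrite !inE /= /g /=.
  move=> /and3P[xA yB xy] /and3P[x'A y'B x'y'].
  have [xnv _] := andP (AS x xA); have [x'nv _] := andP (AS x' x'A).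
  case: ifP => exy; case: ifP => ex'y' //.
  + by case=> xv; rewrite xv eqxx in xnv.
  + by case=> xv; rewrite -xv eqxx in x'nv.
  case=> yy; rewrite -yy in x'y' ex'y' *.
  move: xy x'y'; rewrite /elim_rel exy ex'y' /= => /and3P[_ vx vy] /and3P[_ vx' _].
  by rewrite (key x x' y).
Qed.

Lemma theta_elim (S : {set T}) : v \in S ->
  #|[set u in S :\ v | e v u]| <= 2 -> ~~ theta e S ->
  ~~ theta elim_rel (S :\ v).
Proof.
move=> vS N2; apply: contra => /thetaP[A [B [ABS m]]].
have [/exists_inP[n nA vn]|nA] := boolP [exists n in A, e v n].
  exact: theta_elim_half ABS m nA vn.
have [/exists_inP[n nB vn]|nB] := boolP [exists n in B, e v n].
  rewrite setUC in ABS; rewrite (theta_model_sym elim_rel_sym) in m.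
  exact: theta_elim_half ABS m nB vn.
rewrite !negb_exists_in in nA nB.
have old (C : {set T}) x y : [forall z in C, ~~ e v z] -> x \in C -> elim_rel x y -> e x y.
  by move=> /forall_inP C0 xC; rewrite /elim_rel (negPf (C0 x xC)) andbF orbF.
apply/thetaP; exists A, B; split; first exact: subset_trans ABS (subsetDl _ _).
case/and4P: m => cA cB dAB eAB; apply/and4P; split=> //.
- apply: conn_sub cA => x y xA yA. exact: old nA xA.
- by apply: conn_sub cB => x y xB _; exact: old nB xB.
apply: leq_trans eAB _; apply: subset_leq_card; apply/subsetP => -[x y].
by rewrite !inE /= => /and3P[xA -> xy]; rewrite xA (old _ _ _ nA xA xy).
Qed.

Lemma conn_nbr (H : {set T}) : conn e H -> v \in H -> H != [set v] ->
  exists n, [/\ n \in H, n != v & e v n].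
Proof.
move=> cH vH Hv; have /subsetPn[w wH] : ~~ (H \subset [set v]).
  by apply: contra Hv => Hv; rewrite eqEsubset Hv sub1set.
move=> wv; have [|a [b [_ + bH + ab]]] := conn_cross cH vH (U := [set v]) _ wH wv.
  by rewrite inE.
by rewrite !inE => /eqP av bv; exists b; split=> //; rewrite -av.
Qed.

Lemma conn_elim (H : {set T}) : conn e H -> H != [set v] ->
  conn elim_rel (H :\ v).
Proof.
move=> cH Hv.
have H0 : H :\ v != set0.
  apply: contraNneq Hv => H0; have [w wH] := conn_ex cH.
  have Hw x : x \in H -> x = v.
    move=> xH; apply/eqP; apply: contraT => xv.
    by move: (in_set0 x); rewrite -H0 !inE xv xH.
  apply/eqP/setP => x; rewrite inE; apply/idP/eqP => [/Hw //|->].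
  by rewrite -(Hw w wH).
apply/connP; split=> // U x; rewrite !inE => /andP[xv xH] xU cU.
(* [v] enters the lifted set exactly when one of its neighbours in [H] is in [U], so that a walk
   through [v] is matched by one new edge. *)
pose U' := if [exists n in H :\ v, (n \in U) && e v n] then v |: U else U :\ v.
have U'E y : y != v -> (y \in U') = (y \in U).
  by move=> yv; rewrite /U'; case: ifP; rewrite !inE (negPf yv).
have /subsetP HU' : H \subset U'.
  apply: conn_closed cH xH _ _; first by rewrite U'E.
  move=> a b aH aU bH ab.
  have [av|av] := eqVneq a v; have [bv|bv] := eqVneq b v.
  - by rewrite bv -av.
  - move: aU; rewrite av /U'; case: ifP => [/exists_inP[n]|_]; last by rewrite !inE eqxx.
    rewrite !inE => /andP[nv nH] /andP[nU vn] _; rewrite orbC.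
    have [<-|nb] := eqVneq n b; first by rewrite nU.
    by rewrite (cU n b) // ?inE ?nv ?bv // /elim_rel nb vn -av ab orbT.
  - rewrite U'E // in aU; rewrite bv /U' ifT ?inE ?eqxx //.
    by apply/exists_inP; exists a; rewrite ?inE ?av // aU e_sym -bv.
  rewrite !U'E // in aU *; apply: (cU a) => //; rewrite ?inE ?av ?bv //.
  by rewrite /elim_rel ab.
by apply/subsetP => y; rewrite !inE => /andP[yv /HU']; rewrite U'E.
Qed.

End Elimination.

Definition touch (T : finType) (e : rel T) (A B : {set T}) : bool :=
  [exists x in A, exists y in B, (x == y) || e x y].

Lemma touchP (T : finType) (e : rel T) (A B : {set T}) :
  reflect (exists x y, [/\ x \in A, y \in B & (x == y) || e x y]) (touch e A B).
Proof.
apply: (iffP exists_inP) => [[x xA /exists_inP[y yB xy]]|[x [y [xA yB xy]]]].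
  by exists x, y.
by exists x => //; apply/exists_inP; exists y.
Qed.

(* Theta-free graphs have tree-width at most 2, and a vertex of degree at most
   2 is eliminated by joining its neighbours. The conclusion speaks of touching
   rather than meeting sets because only the former survives elimination. *)
Lemma theta_free_separator (T : finType) (e : rel T) (S : {set T})
    (HH : {set {set T}}) :
  symmetric e -> ~~ theta e S -> HH != set0 ->
  (forall H, H \in HH -> conn e H && (H \subset S)) ->
  exists2 H, H \in HH & exists Y : {set T},
    #|Y| <= 3 /\ forall H', H' \in HH -> touch e H H' -> ~~ [disjoint H' & Y].
Proof.
elim: {S}#|S| {-2}S (erefl #|S|) e HH => [|n IH] S Sn e HH e_sym nth
  /set0Pn[H0 H0H] cHH.
  have /andP[/conn_ex[x xH0] /subsetP/(_ x xH0)] := cHH _ H0H.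
  by rewrite (cards0_eq Sn) inE.
have [|v vS vN] := theta_free_small_degree e_sym _ nth.
  by rewrite -card_gt0 Sn.
(* The source of the constant 3: [v] and its at most two neighbours meet everything that touches
   [[set v]]. *)
have [vH|vH] := boolP ([set v] \in HH).
  exists [set v] => //; exists (v |: [set u in S :\ v | e v u]); split.
    by rewrite cardsU1 -[3]/(1 + 2) leq_add ?leq_b1.
  move=> H' H'H /touchP[x [y [/[!inE]/eqP-> yH' vy]]].
  apply/pred0Pn; exists y; rewrite /= yH' !inE.
  have [//|yv] := eqVneq y v; rewrite eq_sym (negPf yv) /= in vy.
  by rewrite vy andbT (subsetP _ y yH') //; case/andP: (cHH _ H'H).
have Hv H : H \in HH -> H != [set v] by apply: contraTneq => ->.
have [|||_ /imsetP[H HHH ->] [Y [Y3 hY]]] := IH (S :\ v) _ (elim_rel e v)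
    [set H :\ v | H in HH] (elim_rel_sym _ e_sym) (theta_elim e_sym vS vN nth).
- by move: (cardsD1 v S); rewrite vS Sn; lia.
- by apply/set0Pn; exists (H0 :\ v); apply: imset_f.
- move=> _ /imsetP[H HHH ->]; have /andP[cH HS] := cHH _ HHH.
  by rewrite conn_elim ?Hv //= setSD.
exists H => //; exists Y; split=> // H' H'H /touchP[x [y [xH yH' xy]]].
suff tH : touch (elim_rel e v) (H :\ v) (H' :\ v).
  have /pred0Pn[z /andP[/= + zY]] := hY _ (imset_f _ H'H) tH.
  by rewrite !inE => /andP[_ zH']; apply/pred0Pn; exists z; rewrite /= zH'.
have /andP[cH HS] := cHH _ HHH; have /andP[cH' H'S] := cHH _ H'H.
apply/touchP.
have [xv|xv] := eqVneq x v; have [yv|yv] := eqVneq y v.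
- rewrite xv in xH; rewrite yv in yH'.
  have [m [mH mv vm]] := conn_nbr cH xH (Hv _ HHH).
  have [m' [mH' mv' vm']] := conn_nbr cH' yH' (Hv _ H'H).
  exists m, m'; rewrite !inE mH mv mH' mv'; split=> //.
  by have [//|mm] := eqVneq m m'; rewrite /elim_rel mm vm vm' orbT.
- rewrite xv in xH; have [m [mH mv vm]] := conn_nbr cH xH (Hv _ HHH).
  exists m, y; rewrite !inE mH mv yv yH'; split=> //.
  have [//|my] := eqVneq m y; rewrite xv eq_sym (negPf yv) /= in xy.
  by rewrite /elim_rel my vm xy orbT.
- rewrite yv in yH'; have [m [mH mv vm]] := conn_nbr cH' yH' (Hv _ H'H).
  exists x, m; rewrite !inE mH mv xv xH; split=> //.
  have [//|mx] := eqVneq x m; rewrite yv (negPf xv) /= e_sym in xy.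
  by rewrite /elim_rel mx vm xy orbT.
exists x, y; rewrite !inE xv yv xH yH'; split=> //.
by rewrite /elim_rel; case/orP: xy => ->; rewrite ?orbT.
Qed.

(** Choose an object whose conflicts are all hit by one set [W] of size at most [c], put it in the
    packing, discard what [W] hits, and repeat: either this lasts [N] rounds or the collected sets
    hit everything. The choice must be possible in every subfamily for the process to restart. *)
Lemma greedy_packing (I : finType) (Y : finType) (confl : rel I)
    (hit : I -> {set Y} -> bool) (c : nat) (O : {set I}) :
  symmetric confl -> (forall o, o \in O -> confl o o) ->
  (forall o (W W' : {set Y}), W \subset W' -> hit o W -> hit o W') ->
  (forall O' : {set I}, O' \subset O -> O' != set0 ->
     exists2 o, o \in O' & exists2 W : {set Y}, #|W| <= c &
       forall o', o' \in O' -> confl o o' -> hit o' W) ->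
  forall N,
    (exists M : {set I}, [/\ M \subset O, #|M| = N &
       forall o o', o \in M -> o' \in M -> o != o' -> ~~ confl o o']) \/
    (exists2 W : {set Y}, #|W| <= N * c & forall o, o \in O -> hit o W).
Proof.
move=> csym crefl hmono step N; elim: N O crefl step => [|N IH] O crefl step.
  by left; exists set0; split; rewrite ?sub0set ?cards0 // => o; rewrite inE.
have [->|O0] := eqVneq O set0.
  by right; exists set0; rewrite ?cards0 // => o; rewrite inE.
have [o oO [W Wc hW]] := step O (subxx _) O0.
have [||[M [MO MN Mc]]|] := IH [set o' in O | ~~ hit o' W].
- by move=> z; rewrite inE => /andP[zO _]; apply: crefl.
- move=> O' O'O; apply: step; apply: subset_trans O'O _.
  by apply/subsetP => z; rewrite inE => /andP[].
- have MP z : z \in M -> [/\ z \in O, z != o & ~~ hit z W].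
    move/(subsetP MO); rewrite !inE => /andP[zO zW]; split=> //.
    by apply: contraNneq zW => ->; apply: hW; rewrite ?crefl.
  left; exists (o |: M); split.
  + rewrite subUset sub1set oO; apply/subsetP => z /MP[] //.
  + by rewrite cardsU1 MN; case: (boolP (o \in M)) => // /MP[_]; rewrite eqxx.
  have oM z : z \in M -> ~~ confl o z.
    by case/MP => zO _; apply: contra => /hW; apply.
  move=> a b; rewrite !inE => /orP[/eqP->|aM] /orP[/eqP->|bM] ab.
  + by rewrite eqxx in ab.
  + exact: oM.
  + by rewrite csym oM.
  exact: Mc.
move=> [W' W'c hW']; right; exists (W :|: W').
  by rewrite mulSn (leq_trans (leq_card_setU _ _)) // leq_add.
move=> z zO; have [zW|zW] := boolP (hit z W); first by apply: hmono zW; exact: subsetUl.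
by apply: hmono (hW' z _); [exact: subsetUr|rewrite inE zO zW].
Qed.

(** * Packings *)

(** An object is a connected set inside [F] with at most [q] attached vertices, which may lie
    anywhere. A separator of size 3 blocks the conflicts between first components, and the attached
    set of the chosen object those between second components; hence [3 + q]. *)
Lemma packing_connected (T : finType) (e : rel T) (F : {set T})
    (O : {set {set T} * {set T}}) q :
  symmetric e -> ~~ theta e F ->
  (forall o, o \in O -> [&& conn e o.1, o.1 \subset F & #|o.2| <= q]) ->
  forall N,
    (exists M : {set {set T} * {set T}}, [/\ M \subset O, #|M| = N &
       forall o o', o \in M -> o' \in M -> o != o' ->
         [disjoint o.1 & o'.1] /\ [disjoint o.2 & o'.2]]) \/
    (exists2 W : {set T}, #|W| <= N * (3 + q) &
       forall o, o \in O -> ~~ [disjoint o.1 & W] || ~~ [disjoint o.2 & W]).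
Proof.
move=> e_sym nth hO N.
have := @greedy_packing ({set T} * {set T})%type T
  (fun o o' : {set T} * {set T} => ~~ [disjoint o.1 & o'.1] || ~~ [disjoint o.2 & o'.2])
  (fun (o : {set T} * {set T}) (W : {set T}) => ~~ [disjoint o.1 & W] || ~~ [disjoint o.2 & W]) (3 + q) O.
have mono (A W W' : {set T}) : W \subset W' -> ~~ [disjoint A & W] -> ~~ [disjoint A & W'].
  move=> /subsetP WW' /pred0Pn[x /andP[/= xA /WW' xW]].
  by apply/pred0Pn; exists x; rewrite /= xA.
move=> /(_ _ _ _ _ N)[||||[M [MO MN Mc]]|]; last by right.
- by move=> o o' /=; rewrite disjoint_sym [X in _ || ~~ X]disjoint_sym.
- move=> o /hO /and3P[/conn_ex[x xo] _ _]; apply/orP; left.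
  by apply/pred0Pn; exists x; rewrite /= xo.
- by move=> o W W' WW' /orP[/(mono _ _ _ WW')|/(mono _ _ _ WW')] ->; rewrite ?orbT.
- move=> O' /subsetP O'O /set0Pn[o0 o0O'].
  have [||_ /imsetP[o oO' ->] [Y [Y3 hY]]] :=
    @theta_free_separator _ e F [set o.1 | o in O'] e_sym nth.
  + by apply/set0Pn; exists o0.1; apply: imset_f.
  + by move=> _ /imsetP[o /O'O/hO /and3P[co oF _] ->]; rewrite co.
  have /and3P[co oF oq] := hO _ (O'O _ oO').
  exists o => //; exists (Y :|: o.2).
    by rewrite (leq_trans (leq_card_setU _ _)) // leq_add.
  move=> o' o'O' /orP[/pred0Pn[x /andP[/= xo xo']]|oo'].
    apply/orP; left; apply: mono (subsetUl _ _) _.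
    by apply: hY; [exact: imset_f|apply/touchP; exists x, x; rewrite eqxx].
  by apply/orP; right; apply: mono (subsetUr _ _) _; rewrite disjoint_sym.
left; exists M; split=> // o o' oM o'M oo'; have := Mc _ _ oM o'M oo'.
by rewrite negb_or !negbK => /andP[].
Qed.

Lemma pigeonhole (I J : finType) (M : {set I}) (K : {set J}) (R : I -> J -> bool) n :
  (forall x, x \in M -> exists2 j, j \in K & R x j) -> #|K| * n < #|M| ->
  exists2 j, j \in K & n < #|[set x in M | R x j]|.
Proof.
move=> cov big; apply/exists_inP; apply: contraLR big; rewrite negb_exists_in -leqNgt.
move=> /forall_inP small.
have /subset_leq_card/leq_trans : M \subset \bigcup_(j in K) [set x in M | R x j].
  apply/subsetP => x xM; have [j jK xj] := cov x xM.
  by apply/bigcupP; exists j => //; rewrite inE xM.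
apply; rewrite -sum_nat_const.
elim/big_ind2: _ => [|s A t B sA tB|j jK]; first by rewrite cards0.
  exact: leq_trans (leq_card_setU _ _) (leq_add _ _).
by rewrite leqNgt small.
Qed.

(** A bad interval with the least right end conflicts only with intervals that contain that right
    end. *)
Lemma interval_packing n (bad : nat -> nat -> bool) k :
  (exists M : {set 'I_n * 'I_n}, [/\ #|M| = k,
     forall o, o \in M -> (o.1 <= o.2) && bad o.1 o.2 &
     forall o o', o \in M -> o' \in M -> o != o' -> (o.2 < o'.1) || (o'.2 < o.1)]) \/
  (exists2 Z : {set 'I_n}, #|Z| <= k & forall i j : 'I_n, i <= j -> bad i j ->
     exists2 z, z \in Z & i <= z <= j).
Proof.
have := @greedy_packing ('I_n * 'I_n)%type 'I_n
  (fun o o' : 'I_n * 'I_n => (o.1 <= o'.2) && (o'.1 <= o.2))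
  (fun (o : 'I_n * 'I_n) (W : {set 'I_n}) => [exists z in W, o.1 <= z <= o.2]) 1
  [set o : 'I_n * 'I_n | (o.1 <= o.2) && bad o.1 o.2].
move=> /(_ _ _ _ _ k)[||||[M [/subsetP MO MN Mc]]|[Z Zk hZ]].
- by move=> o o'; rewrite andbC.
- by move=> o; rewrite inE => /andP[->].
- move=> o W W' /subsetP WW' /exists_inP[z zW zo]; apply/exists_inP; exists z => //.
  exact: WW'.
- move=> O' /subsetP O'O /set0Pn[o0 o0O'].
  case: (arg_minnP (fun o : 'I_n * 'I_n => o.2 : nat) o0O') => o oO' mino.
  exists o => //; exists [set o.2]; rewrite ?cards1 // => o' o'O' /andP[_ oo'].
  by apply/exists_inP; exists o.2; rewrite ?inE ?oo' ?mino.
- left; exists M; split=> // [o /MO|o o' oM o'M oo']; first by rewrite inE.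
  by have := Mc _ _ oM o'M oo'; rewrite negb_and -!ltnNge orbC.
right; rewrite muln1 in Zk; exists Z => //.
move=> i j ij bij; apply/exists_inP; apply: (hZ (i, j)).
by rewrite inE /= ij.
Qed.

(** Induction on [a], peeling off the minimal elements of the product order. Either there are more
    than [b] of them, and sorted by [p] they decrease in [q], or an increasing sequence found in the
    rest is prolonged below its first term, which is not minimal. *)
Lemma erdos_szekeres (I : finType) (p q : I -> nat) (A : {set I}) a b :
  {in A &, injective p} -> {in A &, injective q} -> a * b < #|A| ->
  (exists s, [/\ a < size s, {subset s <= A} &
     sorted (fun x y => (p x < p y) && (q x < q y)) s]) \/
  (exists s, [/\ b < size s, {subset s <= A} &
     sorted (fun x y => (p x < p y) && (q y < q x)) s]).
Proof.
elim: a A => [|a IH] A pI qI big.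
  have /card_gt0P[x xA] : 0 < #|A| by [].
  by left; exists [:: x]; split=> // y; rewrite inE => /eqP->.
pose Min := [set x in A | [forall y in A, ~~ ((p y < p x) && (q y < q x))]].
have MinA : Min \subset A by apply/subsetP => x; rewrite inE => /andP[].
have [bMin|Minb] := ltnP b #|Min|.
  right; pose s := sort (relpre p leq) (enum Min).
  have sM x : x \in s -> x \in Min by rewrite mem_sort mem_enum.
  exists s; rewrite size_sort -cardE; split=> // [x /sM/(subsetP MinA)//|].
  have us : uniq s by rewrite sort_uniq enum_uniq.
  have ss : sorted (relpre p leq) s by apply: sort_sorted => x y; apply: leq_total.
  case s0: s => [//|x0 s1]; rewrite -s0; apply/(sortedP x0) => i iS.
  have xM := sM _ (mem_nth x0 (ltnW iS)); have yM := sM _ (mem_nth x0 iS).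
  have xy : nth x0 s i != nth x0 s i.+1 by rewrite nth_uniq ?(ltnW iS) // neq_ltn ltnSn.
  have pxy : p (nth x0 s i) < p (nth x0 s i.+1).
    rewrite ltn_neqAle; move/(sortedP x0): ss => /(_ i iS) /= ->; rewrite andbT.
    by apply: contra xy => /eqP/pI->; rewrite ?(subsetP MinA).
  rewrite pxy /= ltn_neqAle; apply/andP; split.
    by apply: contra xy => /eqP/qI->; rewrite ?(subsetP MinA).
  move: yM; rewrite inE => /andP[_ /forall_inP/(_ _ (subsetP MinA _ xM))].
  by rewrite pxy /= -leqNgt.
have [||||] := IH (A :\: Min).
- by move=> x y /setDP[xA _] /setDP[yA _]; apply: pI.
- by move=> x y /setDP[xA _] /setDP[yA _]; apply: qI.
- have := cardsID Min A; have -> : A :&: Min = Min by apply/setIidPr.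
  by move: big; rewrite mulSn; lia.
- case=> -[|x s] [//sa sA ss].
  have /setDP[xA] := sA x (mem_head _ _).
  rewrite inE xA negb_forall_in => /exists_inP[y yA]; rewrite negbK => yx.
  left; exists (y :: x :: s); split=> //=; last by rewrite yx.
  by move=> z; rewrite inE => /orP[/eqP->//|/sA/setDP[]].
case=> s [sb sA ss]; right; exists s; split=> // x /sA /setDP[] //.
Qed.

Section Packing.
Variables (T : finType) (e : rel T).
Hypothesis e_sym : symmetric e.

Definition theta_packing (S : {set T}) (k : nat) : Prop :=
  exists M : {set {set T}}, [/\ k <= #|M|,
    forall U, U \in M -> theta e U && (U \subset S) &
    forall U V, U \in M -> V \in M -> U != V -> [disjoint U & V]].

Lemma theta_packingI (I : finType) (M : {set I}) (U : I -> {set T}) (S : {set T}) k :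
  k <= #|M| -> (forall i, i \in M -> theta e (U i) && (U i \subset S)) ->
  (forall i j, i \in M -> j \in M -> i != j -> [disjoint U i & U j]) ->
  theta_packing S k.
Proof.
move=> kM hU dU; exists [set U i | i in M]; split.
- rewrite card_in_imset // => i j iM jM Uij; apply/eqP; apply: contraT => ij.
  have := dU _ _ iM jM ij; rewrite Uij -setI_eq0 setIid.
  by have /andP[/theta_neq0/negPf->] := hU _ jM.
- by move=> _ /imsetP[i iM ->]; apply: hU.
move=> _ _ /imsetP[i iM ->] /imsetP[j jM ->] Uij; apply: dU => //.
by apply: contraNneq Uij => ->.
Qed.

Lemma theta_packing_mono (S S' : {set T}) k k' : S \subset S' -> k' <= k ->
  theta_packing S k -> theta_packing S' k'.
Proof.
move=> SS' kk' [M [kM hM dM]]; exists M; split=> //; first exact: leq_trans kM.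
by move=> U /hM /andP[-> /subset_trans->].
Qed.

Definition segment (P : seq T) (i j : nat) : {set T} :=
  [set x in P | i <= index x P <= j].

Lemma segment_conn (P : seq T) i j : sorted e P -> i <= j -> j < size P -> uniq P ->
  conn e (segment P i j).
Proof.
case P0: P => [|x0 P1]; first by rewrite ltn0.
rewrite -P0 => sP ij jP uP; apply: (conn_root e_sym (x := nth x0 P i)).
  by rewrite inE mem_nth ?index_uniq ?leqnn //; apply: leq_ltn_trans jP.
move=> U iU cU.
suff main d : i + d <= j -> nth x0 P (i + d) \in U.
  apply/subsetP => x; rewrite inE => /andP[xP /andP[ix xj]].
  by rewrite -(nth_index x0 xP) -(subnKC ix) main // subnKC.
elim: d => [|d IH] dj; first by rewrite addn0.
have dj' : i + d < j by rewrite -addnS.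
apply: (cU (nth x0 P (i + d))).
- rewrite inE mem_nth ?index_uniq ?leq_addr /=; lia.
- exact: IH (ltnW dj').
- rewrite inE mem_nth ?index_uniq ?leq_addr /=; lia.
by rewrite addnS; move/(sortedP x0): sP; apply; lia.
Qed.

(* Three consecutive rungs in a monotone subsequence of the rungs give a theta,
   and disjoint triples give disjoint thetas. *)
Lemma ladder (P : seq T) (z : nat) (I : finType) (M : {set I})
    (a b : I -> T) (C : I -> {set T}) k :
  sorted e P -> uniq P ->
  (forall x, x \in M -> index (a x) P < z < index (b x) P) ->
  (forall x, x \in M -> index (b x) P < size P) ->
  (forall x, x \in M -> conn e (a x |: C x) && [exists y in a x |: C x, e y (b x)]) ->
  (forall x, x \in M -> [disjoint C x & [set y in P]]) ->
  (forall x y, x \in M -> y \in M -> x != y ->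
     [/\ a x != a y, b x != b y & [disjoint C x & C y]]) ->
  (3 * k) * (3 * k) < #|M| ->
  theta_packing ([set x in P] :|: \bigcup_(x in M) C x) k.
Proof.
move=> sP uP abz bP cC CP dM big.
have aP x : x \in M -> index (a x) P < size P.
  by move=> xM; have := abz _ xM; have := bP _ xM; lia.
(* [3 * k] rungs in the order of their ends [a]; their ends [b] run either all forwards or all
   backwards. *)
have [f [fM fa fb]] : exists f : nat -> I, [/\ forall m, m < 3 * k -> f m \in M,
    forall m m', m < m' -> m' < 3 * k -> index (a (f m)) P < index (a (f m')) P &
    (forall m m', m < m' -> m' < 3 * k -> index (b (f m)) P < index (b (f m')) P) \/
    (forall m m', m < m' -> m' < 3 * k -> index (b (f m')) P < index (b (f m)) P)].
  have inj (g : I -> T) : (forall x, x \in M -> index (g x) P < size P) ->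
      (forall x y, x \in M -> y \in M -> x != y -> g x != g y) ->
      {in M &, injective (fun x => index (g x) P)}.
    move=> gP gI x y xM yM /= gxy; apply/eqP; apply: contraT => xy.
    have := gI _ _ xM yM xy; rewrite -(nth_index (g x) (s := P) (x := g x)) ?gxy.
      by rewrite nth_index ?eqxx // -index_mem gP.
    by rewrite -index_mem gP.
  have [||[[|x0 s] [//= ss sM so]]|[[|x0 s] [//= ss sM so]]] :=
    erdos_szekeres (inj a aP _) (inj b bP _) big.
  - by move=> x y xM yM xy; have [] := dM x y xM yM xy.
  - by move=> x y xM yM xy; have [] := dM x y xM yM xy.
  - have tr : transitive (fun x y => (index (a x) P < index (a y) P) &&
       (index (b x) P < index (b y) P)) by move=> u v w; lia.
    have mo m m' : m < m' -> m' < 3 * k ->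
        (index (a (nth x0 (x0 :: s) m)) P < index (a (nth x0 (x0 :: s) m')) P) && (index (b (nth x0 (x0 :: s) m)) P < index (b (nth x0 (x0 :: s) m')) P).
      move=> mm' m'k; apply: (sorted_ltn_nth tr x0 (s := x0 :: s) so) => //;
      rewrite inE /=; lia.
    exists (nth x0 (x0 :: s)); split.
    + by move=> m mk; apply: sM; apply: mem_nth; rewrite /=; lia.
    + move=> m m' mm' m'k; by case/andP: (mo _ _ mm' m'k).
    + left; move=> m m' mm' m'k; by case/andP: (mo _ _ mm' m'k).
  - have tr : transitive (fun x y => (index (a x) P < index (a y) P) &&
       (index (b y) P < index (b x) P)) by move=> u v w; lia.
    have mo m m' : m < m' -> m' < 3 * k ->
        (index (a (nth x0 (x0 :: s) m)) P < index (a (nth x0 (x0 :: s) m')) P) && (index (b (nth x0 (x0 :: s) m')) P < index (b (nth x0 (x0 :: s) m)) P).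
      move=> mm' m'k; apply: (sorted_ltn_nth tr x0 (s := x0 :: s) so) => //;
      rewrite inE /=; lia.
    exists (nth x0 (x0 :: s)); split.
    + by move=> m mk; apply: sM; apply: mem_nth; rewrite /=; lia.
    + move=> m m' mm' m'k; by case/andP: (mo _ _ mm' m'k).
    + right; move=> m m' mm' m'k; by case/andP: (mo _ _ mm' m'k).
pose pa m := index (a (f m)) P; pose pb m := index (b (f m)) P.
(* The [j]-th theta uses the rungs from [3 * j] to [3 * j + 2]. One side is the left stretch [L j]
   with these rungs, the other the right stretch [Rt j]; [minn] and [maxn] cover both directions of
   the ends [b]. *)
pose L j := segment P (pa (3 * j)) (pa (3 * j).+2).
pose lo j := minn (pb (3 * j)) (pb (3 * j).+2).
pose hi j := maxn (pb (3 * j)) (pb (3 * j).+2).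
pose Rt j := segment P (lo j) (hi j).
pose Ac j := L j :|: (a (f (3 * j)) |: C (f (3 * j)))
   :|: (a (f (3 * j).+1) |: C (f (3 * j).+1))
   :|: (a (f (3 * j).+2) |: C (f (3 * j).+2)).
have inP x : index x P < size P -> x \in P by rewrite index_mem.
have bnd m : m < 3 * k -> [/\ pa m < z, z < pb m, pa m < size P & pb m < size P].
  by move=> mk; have := abz _ (fM _ mk); have := bP _ (fM _ mk); rewrite /pa /pb; split; lia.
apply: (theta_packingI (M := [set: 'I_k]) (U := fun j : 'I_k => Ac j :|: Rt j)).
- by rewrite cardsT card_ord.
- move=> j _; have jk := ltn_ord j.
  have k0 : 3 * j < 3 * k by lia.
  have k1 : (3 * j).+1 < 3 * k by lia.
  have k2 : (3 * j).+2 < 3 * k by lia.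
  have [a0 b0 s0 t0] := bnd _ k0; have [a1 b1 s1 t1] := bnd _ k1.
  have [a2 b2 s2 t2] := bnd _ k2.
  have a01 : pa (3 * j) < pa (3 * j).+1 by apply: fa.
  have a12 : pa (3 * j).+1 < pa (3 * j).+2 by apply: fa.
  have b01 : lo j <= pb (3 * j).+1 <= hi j.
    by rewrite /lo /hi; case: fb => fb;
      have := fb _ _ (ltnSn (3 * j)) k1; have := fb _ _ (ltnSn (3 * j).+1) k2; rewrite /pb; lia.
  have aL0 : a (f (3 * j)) \in L j by rewrite inE inP //= -/(pa _); lia.
  have aL1 : a (f (3 * j).+1) \in L j by rewrite inE inP //= -/(pa _); lia.
  have aL2 : a (f (3 * j).+2) \in L j by rewrite inE inP //= -/(pa _); lia.
  have [c0 /exists_inP[y0 y0C e0]] := andP (cC _ (fM _ k0)).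
  have [c1 /exists_inP[y1 y1C e1]] := andP (cC _ (fM _ k1)).
  have [c2 /exists_inP[y2 y2C e2]] := andP (cC _ (fM _ k2)).
  apply/andP; split.
    apply/thetaP; exists (Ac j), (Rt j); split=> //; apply/and4P; split.
    + apply: (conn_meetU e_sym (x := a (f (3 * j).+2)) _ c2); [|apply/setUP; left; apply/setUP; left; exact: aL2|exact: setU11].
      apply: (conn_meetU e_sym (x := a (f (3 * j).+1)) _ c1); [|apply/setUP; left; exact: aL1|exact: setU11].
      apply: (conn_meetU e_sym (x := a (f (3 * j))) _ c0); [|exact: aL0|exact: setU11].
      by apply: (segment_conn sP _ s2 uP); apply: ltnW; apply: ltn_trans a12.
    + apply: (segment_conn sP _ _ uP); last by rewrite gtn_max t0 t2.
      exact: leq_trans (geq_minl _ _) (leq_maxl _ _).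
    + rewrite disjoint_sym disjoints_subset; apply/subsetP => x; rewrite !inE.
      move=> /andP[xP /andP[lx xh]].
      have zx : z < index x P by apply: leq_trans lx; rewrite leq_min b0 b2.
      have nC m : m < 3 * k -> x \in C (f m) = false.
        by move=> mk; apply: (disjointFl (CP _ (fM _ mk))); rewrite inE.
      have na m : m < 3 * k -> (x == a (f m)) = false.
        move=> mk; apply/eqP => xa; have [am _ _ _] := bnd _ mk.
        by move: zx; rewrite xa ltnNge ltnW.
      rewrite (nC _ k0) (nC _ k1) (nC _ k2) (na _ k0) (na _ k1) (na _ k2) xP /= !orbF.
      by rewrite negb_and -!ltnNge (ltn_trans a2 zx) orbT.
    + have nb m m' : m < 3 * k -> m' < 3 * k -> pb m != pb m' -> b (f m) != b (f m').
        by move=> _ _; apply: contra => /eqP; rewrite /pb => ->.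
      have bR m : m < 3 * k -> lo j <= pb m <= hi j -> b (f m) \in Rt j.
        by move=> mk ?; rewrite inE inP //=; have [] := bnd _ mk.
      have d01 : pb (3 * j) != pb (3 * j).+1.
        by case: fb => fb; have := fb _ _ (ltnSn (3 * j)) k1; rewrite neq_ltn => ->; rewrite ?orbT.
      have d12 : pb (3 * j).+1 != pb (3 * j).+2.
        by case: fb => fb; have := fb _ _ (ltnSn (3 * j).+1) k2; rewrite neq_ltn => ->; rewrite ?orbT.
      have d02 : pb (3 * j) != pb (3 * j).+2.
        by case: fb => fb; have := fb _ _ (ltnW (ltnSn (3 * j).+1)) k2; rewrite neq_ltn => ->; rewrite ?orbT.
      apply: (between3 (a1 := y0) (a2 := y1) (a3 := y2) (b1 := b (f (3 * j)))
        (b2 := b (f (3 * j).+1)) (b3 := b (f (3 * j).+2))).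
      * split; [apply/setUP; left; apply/setUP; left; apply/setUP; right; exact: y0C
               |apply/setUP; left; apply/setUP; right; exact: y1C
               |apply/setUP; right; exact: y2C].
      * split; [apply: bR k0 _|exact: bR k1 b01|apply: bR k2 _].
          by rewrite geq_minl leq_maxl.
        by rewrite geq_minr leq_maxr.
      * by [].
      by split; rewrite xpair_eqE negb_and nb ?orbT.
  have CS m : m < 3 * k -> a (f m) |: C (f m) \subset [set x in P] :|: \bigcup_(x in M) C x.
    move=> mk; rewrite subUset sub1set !inE inP ?(bnd _ mk) //=; last by have [] := bnd _ mk.
    by apply: subset_trans (bigcup_sup _ (fM _ mk)) (subsetUr _ _).
  have PS i i' : segment P i i' \subset [set x in P] :|: \bigcup_(x in M) C x.
    by apply/subsetP => x; rewrite !inE => /andP[->].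
  by rewrite /Ac subUset PS andbT subUset CS // andbT subUset CS // andbT subUset PS CS.
move=> j j' _ _ jj'.
wlog lt : j j' jj' / j < j'.
  move=> W; have := jj'; rewrite neq_ltn => /orP[|lt]; first exact: W.
  by rewrite disjoint_sym; apply: W => //; rewrite eq_sym.
have j'k := ltn_ord j'.
have inAc (i : 'I_k) x : x \in Ac i ->
    (x \in L i) \/ (exists m, [/\ 3 * i <= m <= (3 * i).+2 & x \in C (f m)]).
  have ik := ltn_ord i.
  have aL m : 3 * i <= m <= (3 * i).+2 -> a (f m) \in L i.
    move=> mi; have mk : m < 3 * k by lia.
    rewrite inE inP /=; last by have [] := bnd _ mk.
    apply/andP; split.
      have [->//|ne] := eqVneq m (3 * i); apply: ltnW; apply: fa; lia.
    have [->//|ne] := eqVneq m (3 * i).+2; apply: ltnW; apply: fa; lia.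
  rewrite !in_setU !in_set1.
  case/orP=> [/orP[/orP[xL|/orP[/eqP->|xC]]|/orP[/eqP->|xC]]|/orP[/eqP->|xC]].
  - by left.
  - by left; apply: aL; lia.
  - by right; exists (3 * i); split=> //; lia.
  - by left; apply: aL; lia.
  - by right; exists (3 * i).+1; split=> //; lia.
  - by left; apply: aL; lia.
  by right; exists (3 * i).+2; split=> //; lia.
have ipa m m' : m < m' -> m' < 3 * k -> pa m < pa m' by exact: fa.
have fI m m' : m < m' -> m' < 3 * k -> f m != f m'.
  by move=> mm' m'k; apply: contraTneq (ipa _ _ mm' m'k) => ff; rewrite /pa ff ltnn.
have notP m x : m < 3 * k -> x \in C (f m) -> x \notin P.
  by move=> mk xC; have := disjointFr (CP _ (fM _ mk)) xC; rewrite inE => ->.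
have sP2 i i' x : x \in segment P i i' -> [/\ x \in P, i <= index x P & index x P <= i'].
  by rewrite inE => /and3P[].
rewrite disjoints_subset; apply/subsetP => x xj; rewrite inE; apply/negP => xj'.
have b1 := bnd (3 * j).+2 ltac:(lia); have b2 := bnd (3 * j') ltac:(lia).
have b3 := bnd (3 * j) ltac:(lia); have b4 := bnd (3 * j').+2 ltac:(lia).
have ord := ipa (3 * j).+2 (3 * j') ltac:(lia) ltac:(lia).
(* Different triples occupy disjoint ranges on the right as well, in the same or in the reverse
   order. *)
have sep : (hi j < lo j') || (hi j' < lo j).
  by case: fb => fb; rewrite /hi /lo;
   have := fb (3 * j) (3 * j').+2 ltac:(lia) ltac:(lia);
   have := fb (3 * j) (3 * j') ltac:(lia) ltac:(lia);
   have := fb (3 * j).+2 (3 * j') ltac:(lia) ltac:(lia);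
   have := fb (3 * j).+2 (3 * j').+2 ltac:(lia) ltac:(lia); rewrite /pb; lia.
case/setUP: xj => [/inAc[/sP2[xP l1 h1]|[m [mj xC]]]|/sP2[xP l1 h1]];
case/setUP: xj' => [/inAc[/sP2[xP' l2 h2]|[m' [mj' xC']]]|/sP2[xP' l2 h2]].
- by lia.
- by case/negP: (notP m' x ltac:(lia) xC').
- by move: l2; rewrite /lo; case: b1 b2 b4 => ? ? ? ? [? ? ? ?] [? ? ? ?]; lia.
- by case/negP: (notP m x ltac:(lia) xC).
- have [_ _] := dM _ _ (fM m ltac:(lia)) (fM m' ltac:(lia)) (fI m m' ltac:(lia) ltac:(lia)).
  by move=> /disjointFr/(_ xC); rewrite xC'.
- by case/negP: (notP m x ltac:(lia) xC).
- by move: l1; rewrite /lo; case: b1 b3 b4 => ? ? ? ? [? ? ? ?] [? ? ? ?]; lia.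
- by case/negP: (notP m' x ltac:(lia) xC').
by lia.
Qed.

End Packing.

(** * Subdivided thetas *)

Section Tripods.
Variables (T : finType) (e : rel T).
Hypothesis e_sym : symmetric e.

Lemma sorted_rev_sym (s : seq T) : sorted e (rev s) = sorted e s.
Proof. by rewrite rev_sorted; apply: eq_sorted => x y; rewrite e_sym. Qed.

Lemma path_rev_sym c d (p : seq T) :
  path e c (rcons p d) = path e d (rcons (rev p) c).
Proof.
have := sorted_rev_sym (c :: rcons p d).
by rewrite rev_cons rev_rcons /= => ->.
Qed.

(** Follow a path from [a3] until it first meets a path from [a1] to [a2]; the meeting point is the
    centre. Any leg may be trivial. *)
Lemma tripod (A : {set T}) a1 a2 a3 : conn e A ->
  a1 \in A -> a2 \in A -> a3 \in A ->
  exists c q1 q2 q3, [/\ [/\ path e c q1, path e c q2 & path e c q3],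
    [/\ last c q1 = a1, last c q2 = a2 & last c q3 = a3],
    uniq (c :: q1 ++ q2 ++ q3) & {subset c :: q1 ++ q2 ++ q3 <= A}].
Proof.
move=> cA a1A a2A a3A.
have [s [ps us ls sA]] := conn_pathE cA a1A a2A.
have [t [pt ut lt tA]] := conn_pathE cA a3A a1A.
have hasu : has [in a1 :: s] (a3 :: t).
  by apply/hasP; exists a1; rewrite ?mem_head // -lt mem_last.
have [c [s1 [s2 [cs nhas tE]]]] : exists c s1 s2,
    [/\ c \in a1 :: s, ~~ has [in a1 :: s] s1 & a3 :: t = rcons s1 c ++ s2].
  by case: (split_find hasu) => c s1 s2 cs nhas; exists c, s1, s2.
have [l [r sE]] : exists l r, a1 :: s = l ++ c :: r.
  by case/splitPr: cs => l r; exists l, r.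
have sort_s : sorted e (l ++ c :: r) by rewrite -sE.
have sort_t : sorted e (rcons s1 c ++ s2) by rewrite -tE.
have rev_last (m m' : seq T) a : m ++ c :: m' = a :: behead (m ++ c :: m') -> last c (rev m) = a.
  by case: m => [[]|x m [->]] //; rewrite rev_cons last_rcons.
exists c, (rev l), r, (rev s1); split.
- split.
  + have := sorted_rev_sym (rcons l c); rewrite rev_rcons /= => ->.
    by move: sort_s; rewrite -cat_rcons => /cat_sorted2[].
  + by case/cat_sorted2: sort_s.
  have := sorted_rev_sym (rcons s1 c); rewrite rev_rcons /= => ->.
  by case/cat_sorted2: sort_t.
- split.
  + by apply: (rev_last l r); rewrite -sE.
  + by rewrite -ls; have := congr1 (last a1) sE; rewrite /= last_cat.
  by apply: (rev_last s1 s2); rewrite -cat_rcons -tE.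
- have ->: uniq (c :: rev l ++ r ++ rev s1) = uniq ((l ++ c :: r) ++ s1).
    apply: perm_uniq; apply/permP => f; rewrite /= !(count_cat, count_rev) /= ; clear; lia.
  rewrite cat_uniq -sE us.
  have := ut; rewrite tE cat_uniq rcons_uniq => /andP[/andP[_ ->] _].
  by rewrite andbT.
move=> x; rewrite inE !mem_cat !mem_rev => xin.
have [xs|/negPf xs] := boolP (x \in a1 :: s); first exact: sA.
apply: tA; rewrite tE mem_cat mem_rcons inE.
move: xs; rewrite sE mem_cat inE => /negbT; rewrite !negb_or => /and3P[/negPf xl /negPf xc /negPf xr].
by move: xin; rewrite xl xc xr /= => ->.
Qed.

(** The lists hold inner vertices only. A genuine theta has at most one empty list; the statements
    below require [p2] and [p3] to be nonempty, leaving [p1] as the path that may be an edge. *)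
Definition theta_paths c d (p1 p2 p3 : seq T) : Prop :=
  [/\ path e c (rcons p1 d), path e c (rcons p2 d), path e c (rcons p3 d)
    & uniq (c :: d :: p1 ++ p2 ++ p3)].

(** The middle paths allow two uses: all empty for three edges between the sides of a model, and two
    of them single outside vertices for a rooted pair. The last clause says that an empty path is
    the edge from [c] to [d] itself, which limits how many can be empty. *)
Lemma two_tripods (A B : {set T}) a1 a2 a3 b1 b2 b3 (m1 m2 m3 : seq T) :
  conn e A -> conn e B -> [disjoint A & B] ->
  [/\ a1 \in A, a2 \in A & a3 \in A] -> [/\ b1 \in B, b2 \in B & b3 \in B] ->
  path e a1 (rcons m1 b1) -> path e a2 (rcons m2 b2) -> path e a3 (rcons m3 b3) ->
  uniq (m1 ++ m2 ++ m3) ->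
  (forall x, x \in m1 ++ m2 ++ m3 -> x \notin A :|: B) ->
  exists c d p1 p2 p3, [/\ theta_paths c d p1 p2 p3,
    {subset c :: d :: p1 ++ p2 ++ p3 <= [predU A :|: B & m1 ++ m2 ++ m3]},
    (c \in A) && (d \in B),
    [/\ {subset m1 <= p1}, {subset m2 <= p2} & {subset m3 <= p3}] &
    [/\ p1 = [::] -> a1 = c /\ b1 = d, p2 = [::] -> a2 = c /\ b2 = d &
        p3 = [::] -> a3 = c /\ b3 = d]].
Proof.
move=> cA cB dAB [a1A a2A a3A] [b1B b2B b3B] pm1 pm2 pm3 um mAB.
have [c [q1 [q2 [q3 [[pq1 pq2 pq3] [l1 l2 l3] uq qA]]]]] := tripod cA a1A a2A a3A.
have [d [r1 [r2 [r3 [[pr1 pr2 pr3] [k1 k2 k3] ur rB]]]]] := tripod cB b1B b2B b3B.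
have pp a b q m r : path e c q -> last c q = a -> path e d r -> last d r = b ->
    path e a (rcons m b) -> path e c (rcons (q ++ m ++ rev r) d).
  move=> pq lq pr lr pm.
  rewrite !rcons_cat cat_path pq lq /= -rev_cons.
  have := sorted_rev_sym (d :: r); rewrite /= pr.
  by rewrite lastI lr rev_rcons /= => pb; rewrite -cat_rcons cat_path pm last_rcons.
have pe a b q m r : last c q = a -> last d r = b -> q ++ m ++ rev r = [::] -> a = c /\ b = d.
  case: q => //= ->; case: m => //=; case: r => [//= ->|x r] //.
  by rewrite rev_cons; case: (rev r).
exists c, d, (q1 ++ m1 ++ rev r1), (q2 ++ m2 ++ rev r2), (q3 ++ m3 ++ rev r3); split.
- split; [exact: pp pm1|exact: pp pm2|exact: pp pm3|].
  have ->: uniq (c :: d :: (q1 ++ m1 ++ rev r1) ++ (q2 ++ m2 ++ rev r2) ++ q3 ++ m3 ++ rev r3) =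
    uniq ((c :: q1 ++ q2 ++ q3) ++ (d :: r1 ++ r2 ++ r3) ++ (m1 ++ m2 ++ m3)).
    by apply: perm_uniq; apply/permP => f; rewrite /= !(count_cat, count_rev) /= !count_cat; clear; lia.
  rewrite cat_uniq uq cat_uniq ur um andbT has_cat negb_or andTb andTb.
  apply/andP; split; [apply/andP; split|].
  + by apply/hasPn => x /rB xB; apply/negP => /qA; rewrite (disjointFl dAB).
  + apply/hasPn => x /mAB; rewrite in_setU negb_or => /andP[xA xB].
    by apply: contra xA; apply: qA.
  apply/hasPn => x /mAB; rewrite in_setU negb_or => /andP[xA xB].
  by apply: contra xB; apply: rB.
- move=> x xin; rewrite inE /= in_setU.
  have [xA|xA] := boolP (x \in A) => //; have [xB|xB] := boolP (x \in B) => //=.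
  have xq : x \notin c :: q1 ++ q2 ++ q3 by apply: contra xA; apply: qA.
  have xr : x \notin d :: r1 ++ r2 ++ r3 by apply: contra xB; apply: rB.
  move: xq; rewrite !(inE, mem_cat) !negb_or => /and4P[/negPf xc /negPf xq1 /negPf xq2 /negPf xq3].
  move: xr; rewrite !(inE, mem_cat) !negb_or => /and4P[/negPf xd /negPf xr1 /negPf xr2 /negPf xr3].
  by move: xin; rewrite !(inE, mem_cat, mem_rev) xc xd xq1 xq2 xq3 xr1 xr2 xr3 /= !orbF.
- by rewrite qA ?mem_head // rB ?mem_head.
- by split=> x xm; rewrite !mem_cat xm ?orbT.
by split; [exact: pe|exact: pe|exact: pe].
Qed.

(** Two empty paths would come from the same edge between [A] and [B]; so at most one is empty, and
    it can be renamed [p1]. *)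
Lemma theta_model_paths (A B : {set T}) : theta_model e A B ->
  exists c d p1 p2 p3, [/\ theta_paths c d p1 p2 p3,
    {subset c :: d :: p1 ++ p2 ++ p3 <= A :|: B}, p2 <> [::] & p3 <> [::]].
Proof.
case/and4P=> cA cB dAB /card_gt2_subset3 [[a1 b1] [[a2 b2] [[a3 b3] []]]].
rewrite !inE /= => -[/and3P[a1A b1B e1] /and3P[a2A b2B e2] /and3P[a3A b3B e3]] [n12 n13 n23].
have [|||||//|//|c [d [p1 [p2 [p3 [tp sub _ _ [z1 z2 z3]]]]]]] :=
  @two_tripods A B a1 a2 a3 b1 b2 b3 [::] [::] [::] cA cB dAB.
- by [].
- by [].
- by rewrite /= e1.
- by rewrite /= e2.
- by rewrite /= e3.
have sub' : {subset c :: d :: p1 ++ p2 ++ p3 <= A :|: B}.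
  by move=> x /sub; rewrite inE /= orbF.
have [e2'|/eqP e2'] := eqVneq p2 [::].
  have [e1'|/eqP e1'] := eqVneq p1 [::].
    by case: (z1 e1') (z2 e2') n12 => -> -> [-> ->]; rewrite eqxx.
  have [e3'|/eqP e3'] := eqVneq p3 [::].
    by case: (z3 e3') (z2 e2') n23 => -> -> [-> ->]; rewrite eqxx.
  exists c, d, p2, p1, p3; split=> //.
    case: tp => h1 h2 h3 u; split=> //; move: u; rewrite e2'.
    by rewrite ?cats0.
  by move: sub'; rewrite e2' ?cats0.
have [e3'|/eqP e3'] := eqVneq p3 [::]; last by exists c, d, p1, p2, p3.
have [e1'|/eqP e1'] := eqVneq p1 [::].
  by case: (z1 e1') (z3 e3') n13 => -> -> [-> ->]; rewrite eqxx.
exists c, d, p3, p1, p2; split=> //.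
  case: tp => h1 h2 h3 u; split=> //; move: u; rewrite e3'.
  by rewrite ?cats0.
by move: sub'; rewrite e3' ?cats0.
Qed.

Lemma theta_paths_theta c d p1 p2 p3 : theta_paths c d p1 p2 p3 ->
  p2 <> [::] -> p3 <> [::] -> theta e [set x in c :: d :: p1 ++ p2 ++ p3].
Proof.
case: p2 => // y2 p2; case: p3 => // y3 p3 [h1 h2 h3 u] _ _.
pose B := [set x in d :: p1 ++ (y2 :: p2) ++ (y3 :: p3)].
have pc p : path e c (rcons p d) -> conn e [set x in d :: rev p].
  by rewrite path_rev_sym rcons_path => /andP[pp _]; apply: conn_path.
have cB : conn e B.
  have -> : B = [set x in d :: rev p1] :|: [set x in d :: rev (y2 :: p2)]
     :|: [set x in d :: rev (y3 :: p3)].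
    apply/setP => x; rewrite !in_setU !in_set !in_cons !mem_cat !mem_rev.
    by case: (x == d) => //=; rewrite orbA.
  have dd p : d \in [set x in d :: rev p] by rewrite in_set mem_head.
  apply: (conn_meetU e_sym (x := d)) (pc _ h3) _ (dd _); last by rewrite in_setU dd.
  exact: (conn_meetU e_sym) (pc _ h1) (pc _ h2) (dd _) (dd _).
apply/thetaP; exists [set c], B; split.
  by apply/subsetP => x; rewrite !in_setU in_set1 !in_set in_cons.
have [y1 [y1B cy1 y12 y13]] : exists y1,
    [/\ y1 \in d :: p1 ++ (y2 :: p2) ++ y3 :: p3, e c y1, y1 != y2 & y1 != y3].
  move: h1 u; clear; case: p1 => [|y1 p1] /= /andP[cy1 _] /andP[_ /andP[]];
  rewrite !(inE, mem_cat) !negb_or => + u.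
    by case/and3P=> dy2 _ /andP[dy3 _]; exists d; rewrite mem_head.
  move=> _; move: u => /andP[/and5P[_ y12 _ y13 _] _].
  by exists y1; rewrite !(inE, mem_cat) eqxx orbT.
have y23 : y2 != y3.
  move: u; rewrite !cons_uniq cat_uniq => /and5P[_ _ _ _] /=.
  by rewrite mem_cat !inE !negb_or => /andP[/and3P[]].
apply: (@theta_star _ _ c B y1 y2 y3) => //.
- by move: u => /andP[+ _]; rewrite in_set.
- by rewrite !in_set; split=> //; rewrite !(in_cons, mem_cat) eqxx ?orbT.
by split=> //; [case/andP: h2|case/andP: h3].
Qed.

(** A theta has a spanning path: along [p3] to [d], back through [p1] to [c], and out along [p2].
    This is the path that the Erdos-Posa induction removes. *)
Lemma theta_hamiltonian (S : {set T}) : theta e S ->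
  exists P : seq T, [/\ sorted e P, uniq P, {subset P <= S} & theta e [set x in P]].
Proof.
case/thetaP=> A [B [ABS /theta_model_paths[c [d [p1 [p2 [p3 [tp sub n2 n3]]]]]]]].
have [h1 h2 h3 u] := tp.
pose P := p3 ++ d :: rev p1 ++ c :: p2.
have PE : perm_eq P (c :: d :: p1 ++ p2 ++ p3).
  by apply/permP => f; rewrite /= !(count_cat, count_rev) /= !(count_cat, count_rev) /=; clear; lia.
exists P; split.
- have pd : path e d (rev p1 ++ c :: p2).
    rewrite -cat_rcons cat_path -path_rev_sym h1 last_rcons.
    by move: h2; rewrite rcons_path => /andP[].
  rewrite /P; case: (p3) h3 => [|x p] //= /andP[_]; rewrite -cat_rcons cat_path => ->.
  by rewrite last_rcons.
- by rewrite (perm_uniq PE).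
- by move=> x; rewrite (perm_mem PE) => /sub; apply: (subsetP ABS).
have -> : [set x in P] = [set x in c :: d :: p1 ++ p2 ++ p3].
  by apply/setP => x; rewrite !in_set (perm_mem PE).
exact: theta_paths_theta.
Qed.

End Tripods.

(** * Erdos-Posa property of thetas *)

Section CutVertex.
Variables (T : finType) (e : rel T).
Hypothesis e_sym : symmetric e.

Lemma theta_cut_vertex (S C D : {set T}) q :
  S \subset q |: (C :|: D) -> q \notin C -> q \notin D -> [disjoint C & D] ->
  (forall x y, x \in C -> y \in D -> ~~ e x y) -> theta e S ->
  theta e (S :&: (q |: C)) \/ theta e (S :&: (q |: D)).
Proof.
move=> SqCD qC qD dCD nCD /thetaP[A [B []]].
wlog qB : A B / q \notin B.
  move=> W ABS m; have [qB|qB] := boolP (q \in B); last exact: (W A B).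
  apply: (W B A); rewrite 1?setUC // 1?(theta_model_sym e_sym) //.
  by case/and4P: m => _ _ dAB _; rewrite (disjointFl dAB).
move=> ABS m; have [cA cB dAB eAB] := and4P m.
have AS x : x \in A -> x \in S by move=> xA; apply: (subsetP ABS); rewrite inE xA.
have BS x : x \in B -> x \in S by move=> xB; apply: (subsetP ABS); rewrite inE xB orbT.
have SE x : x \in S -> x != q -> (x \in C) || (x \in D).
  by move=> /(subsetP SqCD); rewrite !inE => /orP[->|].
have Bq x : x \in B -> x != q by apply: contraTneq => ->.
have [b0 b0B] := conn_ex cB.
wlog b0C : C D SqCD qC qD dCD nCD SE / b0 \in C.
  move=> W; have [b0C|b0D] := orP (SE _ (BS _ b0B) (Bq _ b0B)); first exact: (W C D).
  apply/or_comm; apply: (W D C) => //.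
  - by rewrite [D :|: C]setUC.
  - by rewrite disjoint_sym.
  - by move=> x y xD yC; rewrite e_sym nCD.
  - by move=> x xS /(SE x xS); rewrite orbC.
have notD x : x \in C -> x \in D = false by move=> xC; rewrite (disjointFr dCD).
have BC : B \subset C.
  apply: conn_closed cB b0B b0C _ => x y xB xC yB xy.
  have /orP[//|yD] := SE _ (BS _ yB) (Bq _ yB).
  by case/negP: (nCD _ _ xC yD).
left; pose A' := A :&: (q |: C).
have AC x y : x \in A -> y \in B -> e x y -> x \in A'.
  move=> xA yB xy; rewrite !inE xA /=; have [//|xq] := eqVneq x q.
  have /orP[//|xD] := SE _ (AS _ xA) xq.
  by case/negP: (nCD _ _ (subsetP BC _ yB) xD); rewrite e_sym.
apply/thetaP; exists A', B; split.
  apply/subsetP => x /setUP[/setIP[xA xqC]|xB]; first by rewrite inE AS.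
  by rewrite !inE BS // (subsetP BC) ?orbT.
apply/and4P; split=> //; first last.
- apply: leq_trans eAB _; apply: subset_leq_card; apply/subsetP => -[x y].
  move=> xyAB; move: xyAB; rewrite inE /= => /and3P[xA yB xy].
  by rewrite inE /= (AC _ _ xA yB xy) yB.
- by apply: disjointWl dAB; apply: subsetIl.
have /card_gt0P[[x0 y0]] : 0 < #|between e A B| by apply: leq_trans eAB.
rewrite inE /= => /and3P[x0A y0B x0y0]; have x0A' := AC _ _ x0A y0B x0y0.
apply/connP; split; first by apply/set0Pn; exists x0.
move=> U x xA' xU cU; have xA : x \in A by case/setIP: xA'.
have A'E y : y \in A -> y \in A' = (y == q) || (y \in C).
  by move=> yA; rewrite !inE yA.
(* Lifts a closed subset of the trimmed side to the full side: the dropped part comes along exactly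
   when [q] is reached. *)
pose U' := (U :&: A') :|: (if q \in U then A :&: D else set0).
have /subsetP AU' : A \subset U'.
  apply: conn_closed cA xA _ _; first by rewrite in_setU in_setI xU xA'.
  move=> y z yA yU' zA yz; have [zA'|zA'] := boolP (z \in A').
    case/setUP: yU' => [/setIP[yU yA']|].
      by rewrite in_setU in_setI (cU y z) // zA'.
    case: ifP => [qU /setIP[_ yD]|]; last by rewrite inE.
    have := zA'; rewrite A'E // => /orP[/eqP zq|zC].
      by rewrite in_setU in_setI zA' andbT zq qU.
    by case/negP: (nCD _ _ zC yD); rewrite e_sym.
  have [zq zC] : z != q /\ z \notin C by move: zA'; rewrite A'E // negb_or => /andP.
  have zD : z \in D by have := SE _ (AS _ zA) zq; rewrite (negPf zC).
  rewrite in_setU; apply/orP; right; case/setUP: yU' => [/setIP[yU]|].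
    rewrite A'E // => /orP[/eqP yq|yC]; last by case/negP: (nCD _ _ yC zD).
    by rewrite -yq yU inE zA.
  by case: ifP => _; rewrite !inE ?zA.
apply/subsetP => y yA'; have /setIP[yA yqC] := yA'.
have := AU' _ yA; rewrite in_setU in_setI yA' andbT => /orP[//|].
case: ifP => [qU|]; last by rewrite inE.
rewrite inE yA /= => yD; move: yqC; rewrite !inE => /orP[/eqP->//|yC].
by rewrite notD in yD.
Qed.

End CutVertex.

(** * Thetas in the union of a path and a theta-free set *)

Section PathPlusThetaFree.
Variables (T : finType) (e : rel T).
Hypothesis e_sym : symmetric e.

Definition sweep_set (P : seq T) (P0 : {set T}) (M : {set {set T} * {set T}})
    (i j : nat) : {set T} :=
  (segment P i j :&: P0) :|: \bigcup_(o in M | o.2 \subset segment P i j) o.1.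

(** Disjoint intervals capture disjoint sets, because an object has an attachment and so cannot be
    swept by both. Packing or hitting intervals therefore packs or hits the thetas that they
    capture. *)
Lemma segment_sweep (P : seq T) (P0 F : {set T}) (M : {set {set T} * {set T}}) k :
  [disjoint F & [set x in P]] ->
  (forall o, o \in M -> (o.1 \subset F) && (o.2 != set0)) ->
  (forall o o', o \in M -> o' \in M -> o != o' -> [disjoint o.1 & o'.1]) ->
  theta_packing e ([set x in P] :|: F) k \/
  exists2 Z : {set 'I_(size P)}, #|Z| <= k & forall i j : 'I_(size P), i <= j ->
    theta e (sweep_set P P0 M i j) -> exists2 z, z \in Z & i <= z <= j.
Proof.
move=> dFP hM dM.
have [[N [Nk hN dN]]|] := interval_packing (size P)
  (fun i j => theta e (sweep_set P P0 M i j)) k; last by right.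
left; apply: (theta_packingI (M := N) (U := fun o => sweep_set P P0 M o.1 o.2)).
- by rewrite Nk.
- move=> o /hN /andP[_ ->] /=; apply: setUSS.
    by apply/subsetP => x; rewrite !inE => /andP[/andP[]].
  by apply/bigcupsP => u /andP[/hM/andP[]].
have segP i j x : x \in segment P i j -> x \in [set x in P] by rewrite !inE => /andP[].
move=> o o' oN o'N oo'; rewrite disjoints_subset; apply/subsetP => x xo; rewrite inE.
have /orP := dN _ _ oN o'N oo'.
have seg y i j i' j' : (j < i') || (j' < i) -> y \in segment P i j -> y \in segment P i' j' = false.
  move=> h; rewrite !inE => /andP[-> /andP[h1 h2]] /=; apply/negbTE.
  by move: h h1 h2; clear; lia.
move=> /orP h; apply/negP; case/setUP: xo => [/setIP[xo _]|/bigcupP[u /andP[uM us] xu]];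
case/setUP => [/setIP[xo' _]|/bigcupP[u' /andP[uM' us'] xu']].
- by rewrite (seg _ _ _ _ _ h xo) in xo'.
- have /andP[/subsetP/(_ x xu') xF _] := hM _ uM'.
  by have := disjointFr dFP xF; rewrite (segP _ _ _ xo).
- have /andP[/subsetP/(_ x xu) xF _] := hM _ uM.
  by have := disjointFr dFP xF; rewrite (segP _ _ _ xo').
have [uu'|uu'] := eqVneq u u'; last by rewrite (disjointFr (dM _ _ uM uM' uu') xu) in xu'.
have /andP[_ /set0Pn[y yu]] := hM _ uM.
have := seg y _ _ _ _ h (subsetP us _ yu).
by rewrite (subsetP us' _ _) // -uu'.
Qed.

Variables (P : seq T) (F : {set T}) (k : nat).
Hypothesis (sP : sorted e P) (uP : uniq P) (dFP : [disjoint F & [set x in P]])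
  (nthF : ~~ theta e F).

Definition feet (P1 C : {set T}) : {set T} := [set p in P1 | [exists y in C, e p y]].

(** The least number of rungs that exceeds the Erdos-Szekeres product in [ladder]. *)
Definition ladder_bound : nat := ((3 * k) * (3 * k)).+1.

Lemma in_position x : x \in P -> exists i : 'I_(size P), i = index x P :> nat.
Proof. by rewrite -index_mem => xP; exists (Ordinal xP). Qed.

(** The stretch of [P] spanned by the feet of an object forms a theta with it. If these stretches do
    not pack, [k] positions hit them all, one position [z] is straddled by many objects, and these
    are the rungs of a ladder. *)
Lemma triple_packing (M : {set {set T} * {set T}}) :
  (forall o, o \in M -> [/\ conn e o.1, o.1 \subset F, o.2 \subset [set x in P],
     2 < #|o.2| & feet o.2 o.1 = o.2]) ->
  (forall o o', o \in M -> o' \in M -> o != o' ->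
     [disjoint o.1 & o'.1] /\ [disjoint o.2 & o'.2]) ->
  k * ladder_bound.+1 < #|M| -> theta_packing e ([set x in P] :|: F) k.
Proof.
move=> hM dM big.
have o2 o : o \in M -> exists p, p \in o.2.
  move=> /hM[_ _ _ h _]; have /card_gt0P[p po] : 0 < #|o.2| by apply: leq_trans h.
  by exists p.
have foot o p : o \in M -> p \in o.2 -> exists2 y, y \in o.1 & e p y.
  by move=> /hM[_ _ _ _ <-]; rewrite inE => /andP[_ /exists_inP].
have inP o p : o \in M -> p \in o.2 -> p \in P.
  by move=> /hM[_ _ /subsetP h _ _] /h; rewrite inE.
have [||//|[Z Zk hZ]] := @segment_sweep P [set x in P] F M k dFP.
- move=> o oM; have [_ -> _ _ _] := hM _ oM; have [p po] := o2 _ oM.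
  by apply/set0Pn; exists p.
- by move=> o o' oM o'M oo'; have [] := dM _ _ oM o'M oo'.
pose sees (o : {set T} * {set T}) (z : 'I_(size P)) :=
  [exists p in o.2, exists q in o.2, index p P <= z <= index q P].
have [o oM||z zZ zM] := @pigeonhole _ _ M Z sees ladder_bound.+1.
- have [co oF oP o3 fo] := hM _ oM; have [p0 p0o] := o2 _ oM.
  case: (arg_minnP (fun p => index p P) p0o) => p po minp.
  case: (arg_maxnP (fun p => index p P) p0o) => q qo maxq.
  have [i iE] := in_position (inP _ _ oM po); have [j jE] := in_position (inP _ _ oM qo).
  have fS : o.2 \subset segment P i j.
    by apply/subsetP => y yo; rewrite inE (inP _ _ oM yo) /= iE jE minp //; apply: maxq.
  have ij : i <= j by rewrite iE jE; apply: minp.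
  have [|z zZ /andP[iz zj]] := hZ i j ij; last first.
    exists z => //; apply/exists_inP; exists p => //; apply/exists_inP; exists q => //.
    by rewrite -iE -jE iz.
  have [p1 [p2 [p3 [[p1o p2o p3o] [n12 n13 n23]]]]] := card_gt2_subset3 o3.
  have [y1 y1o e1] := foot _ _ oM p1o; have [y2 y2o e2] := foot _ _ oM p2o.
  have [y3 y3o e3] := foot _ _ oM p3o.
  apply/thetaP; exists (segment P i j), o.1; split.
    apply: setUSS; first by rewrite subsetI subxx /=; apply/subsetP => x; rewrite !inE => /andP[].
    by apply: bigcup_sup; rewrite oM.
  apply/and4P; split=> //.
  + by apply: segment_conn => //; apply: ltn_ord.
  + rewrite disjoints_subset; apply/subsetP => x; rewrite !inE => /andP[xP _].
    by apply/negP => /(subsetP oF) xF; have := disjointFr dFP xF; rewrite inE xP.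
  apply: (between3 (a1 := p1) (a2 := p2) (a3 := p3) (b1 := y1) (b2 := y2) (b3 := y3)) => //.
    by split; apply: (subsetP fS).
  by split; rewrite xpair_eqE negb_and ?n12 ?n13 ?n23.
- by apply: leq_ltn_trans big; rewrite leq_mul2r Zk orbT.
have [x0 [x0P zE]] : exists x0, x0 \in P /\ index x0 P = z.
  pose x0 := tnth (in_tuple P) z; exists x0; split; first exact: mem_tnth.
  by rewrite /x0 (tnth_nth x0) index_uniq.
pose M1 := [set o in M | sees o z].
(* Attachments are disjoint, so at most one object stands on the vertex at position [z]; without it,
   each object has feet strictly on both sides of [z]. *)
pose M2 := [set o in M1 | x0 \notin o.2].
have M2M o : o \in M2 -> o \in M by rewrite !inE => /andP[/andP[]].
have cM2 : ladder_bound <= #|M2|.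
  have : #|M1 :\: M2| <= 1.
    apply/card_le1_eqP => o o'; rewrite !inE.
    move=> /andP[+ /andP[oM so]] /andP[+ /andP[o'M so']]; rewrite oM so o'M so' /= !negbK.
    move=> xo xo'; apply/eqP; apply: contraT => oo'.
    by have [_ /disjointFr/(_ xo')] := dM _ _ o'M oM oo'; rewrite xo.
  have := cardsID M2 M1; have -> : M1 :&: M2 = M2.
    by apply/setIidPr/subsetP => o; rewrite inE => /andP[].
  by move: zM; rewrite -/M1; clear; lia.
have [f hf] : exists f : {set T} * {set T} -> T * T, forall o, o \in M2 ->
    [/\ (f o).1 \in o.2, (f o).2 \in o.2, index (f o).1 P < z & z < index (f o).2 P].
  apply: (@fin_all_exists _ (fun=> (T * T)%type) (fun o u => o \in M2 ->
    [/\ u.1 \in o.2, u.2 \in o.2, index u.1 P < z & z < index u.2 P])) => o.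
  have [oM2|] := boolP (o \in M2); last by exists (x0, x0).
  have oM := M2M _ oM2.
  move: (oM2); rewrite !inE => /andP[/andP[_ /exists_inP[p po /exists_inP[q qo /andP[pz zq]]]] x0o].
  exists (p, q) => _ /=.
  have ne y : y \in o.2 -> index y P != z.
    move=> yo; apply: contra x0o => /eqP yz.
    by rewrite -(nth_index x0 x0P) zE -yz nth_index // (inP _ _ oM yo).
  by split=> //; rewrite ltn_neqAle ?pz ?zq ?andbT ?ne // eq_sym ne.
have dM2 : forall o o', o \in M2 -> o' \in M2 -> o != o' ->
    [/\ (f o).1 != (f o').1, (f o).2 != (f o').2 & [disjoint o.1 & o'.1]].
  move=> o o' oM o'M oo'; have [d1 d2] := dM _ _ (M2M _ oM) (M2M _ o'M) oo'.
  have [h1 h2 _ _] := hf _ oM; have [h1' h2' _ _] := hf _ o'M.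
  split=> //; first by apply: contraTneq h1' => <-; rewrite (disjointFr d2 h1).
  by apply: contraTneq h2' => <-; rewrite (disjointFr d2 h2).
apply: (theta_packing_mono _ (leqnn k) (@ladder _ e e_sym P z _ M2
  (fun o => (f o).1) (fun o => (f o).2) (fun o => o.1) k sP uP _ _ _ _ _ _)).
- apply: setUS; apply/bigcupsP => o oM.
  by have [_ ? _ _ _] := hM _ (M2M _ oM).
- by move=> o /hf[_ _ -> ->].
- by move=> o oM; rewrite index_mem; have [_ h _ _] := hf _ oM; apply: inP (M2M _ oM) h.
- move=> o oM; have [h1 h2 _ _] := hf _ oM; have oM' := M2M _ oM.
  have [y yo e1] := foot _ _ oM' h1; have [y' y'o e2] := foot _ _ oM' h2.
  have [co _ _ _ _] := hM _ oM'; apply/andP; split.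
    by apply: conn_add yo _ => //; rewrite e_sym.
  by apply/exists_inP; exists y'; rewrite ?inE ?y'o ?orbT // e_sym.
- by move=> o oM; have [_ oF _ _ _] := hM _ (M2M _ oM); apply: disjointWl dFP.
- exact: dM2.
- exact: cM2.
Qed.

(** Among this many objects, either [k] form a theta with their attachment or enough others have
    three feet for [triple_packing]. *)
Definition object_bound : nat := k + (k * ladder_bound.+1).+1.

(** Two obstructions are packed together: connected sets with one vertex of [P] completing a theta,
    and connected sets with three chosen feet. The factor 6 is [3 + q] with [q = 3]. *)
Lemma few_feet : theta_packing e ([set x in P] :|: F) k \/
  exists2 W : {set T}, #|W| <= object_bound * 6 &
    forall H, conn e H -> H \subset F -> [disjoint H & W] ->
      (forall q, q \in [set x in P] :\: W -> ~~ theta e (q |: H)) /\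
      #|feet ([set x in P] :\: W) H| <= 2.
Proof.
pose O := [set o : {set T} * {set T} | [&& conn e o.1, o.1 \subset F,
   o.2 \subset [set x in P] & (#|o.2| == 1) && theta e (o.2 :|: o.1) ||
     ((#|o.2| == 3) && (feet o.2 o.1 == o.2))]].
have [|[M [/subsetP MO MN dM]]|[W Wc hW]] := @packing_connected _ e F O 3 e_sym nthF _ object_bound.
- move=> o; rewrite inE => /and4P[-> -> _ /orP[/andP[/eqP-> _]|/andP[/eqP-> _]]] //.
- pose M1 := [set o in M | theta e (o.2 :|: o.1)].
  left; have [kM1|M1k] := leqP k #|M1|.
    apply: (theta_packingI (M := M1) (U := fun o => o.2 :|: o.1)) => //.
      move=> o; rewrite inE => /andP[/MO + ->] /=; rewrite inE => /and4P[_ oF oP _].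
      exact: setUSS.
    move=> o o'; rewrite !inE => /andP[oM _] /andP[o'M _] oo'.
    have [d1 d2] := dM _ _ oM o'M oo'.
    move: (MO _ oM) (MO _ o'M); rewrite !inE => /and4P[_ oF oP _] /and4P[_ oF' oP' _].
    rewrite disjoint_setUl !disjoint_setUr d1 d2 andbT /=; apply/andP; split.
      by rewrite disjoint_sym; apply: disjointWl oF' _; apply: disjointWr oP _.
    by apply: disjointWl oF _; apply: disjointWr oP' _.
  apply: (triple_packing (M := M :\: M1)).
  + move=> o; rewrite !inE => /andP[oM1 oM]; rewrite oM /= in oM1.
    move: (MO _ oM); rewrite inE (negPf oM1) andbF /= => /and4P[? ? ? /andP[/eqP-> /eqP?]].
    by split.
  + by move=> o o' /setDP[oM _] /setDP[o'M _]; apply: dM.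
  have := cardsID M1 M; have -> : M :&: M1 = M1.
    by apply/setIidPr/subsetP => o; rewrite inE => /andP[].
  by move: M1k; rewrite MN /object_bound; clear; lia.
right; exists W => // H cH HF dHW.
have hit (Q : {set T}) : Q \subset [set x in P] :\: W -> (H, Q) \in O -> False.
  move=> QP /hW /=; rewrite dHW /= => /pred0Pn[x /andP[/= /(subsetP QP)]].
  by rewrite inE => /andP[/negPf->].
split.
  move=> q qP; apply/negP => th; apply: (hit [set q]); rewrite ?sub1set //.
  rewrite inE cH HF sub1set cards1 eqxx th /= andbT.
  by move: qP; rewrite !inE => /andP[].
rewrite leqNgt; apply/negP => /card_gt2_subset3[p1 [p2 [p3 [[h1 h2 h3] [n12 n13 n23]]]]].
have sub : [set p1; p2; p3] \subset feet ([set x in P] :\: W) H.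
  by apply/subsetP => x; rewrite !in_setU !in_set1 => /orP[/orP[]|] /eqP->.
have subP : [set p1; p2; p3] \subset [set x in P] :\: W.
  by apply: subset_trans sub _; apply/subsetP => x; rewrite inE => /andP[].
apply: (hit _ subP); rewrite inE cH HF (subset_trans subP (subsetDl _ _)) /=.
apply/orP; right; apply/andP; split.
  by rewrite -setUA cardsU1 cards2 !inE negb_or n12 n13 n23.
apply/eqP/setP => x; rewrite inE; case: (boolP (x \in [set p1; p2; p3])) => //= xp.
by move: (subsetP sub _ xp); rewrite inE => /andP[].
Qed.

End PathPlusThetaFree.

Section ErdosPosa.
Variables (T : finType) (e : rel T).
Hypothesis e_sym : symmetric e.

(** A link across [z] is an edge or a component of [F1]. Links with disjoint ends use distinct
    components, since a common one would have three feet; so many such links are rungs of a ladder,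
    and otherwise the ends of few links hit all. *)
Lemma few_crossings (P : seq T) (F P1 F1 : {set T}) (z k : nat) :
  sorted e P -> uniq P -> [disjoint F & [set x in P]] ->
  P1 \subset [set x in P] -> F1 \subset F ->
  (forall H, conn e H -> H \subset F1 -> #|feet e P1 H| <= 2) ->
  theta_packing e ([set x in P] :|: F) k \/
  exists2 W : {set T}, #|W| <= ladder_bound k * 2 &
    forall p q, p \in P1 -> q \in P1 -> index p P < z < index q P ->
      e p q \/ (exists2 x, x \in F1 &
                  p \in feet e P1 (component e F1 x) /\ q \in feet e P1 (component e F1 x)) ->
      (p \in W) || (q \in W).
Proof.
move=> sP uP dFP P1P F1F feet2.
(* The empty set stands for a link that is a single edge. *)
pose isC (C : {set T}) p q := (C == set0) || [exists x in F1, C == component e F1 x] &&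
  (p \in feet e P1 C) && (q \in feet e P1 C).
pose O := [set o : {set T} * (T * T) | [&& o.2.1 \in P1, o.2.2 \in P1,
  index o.2.1 P < z < index o.2.2 P,
  conn e (o.2.1 |: o.1) && [exists y in o.2.1 |: o.1, e y o.2.2] & isC o.1 o.2.1 o.2.2]].
pose ends (o : {set T} * (T * T)) := [set o.2.1; o.2.2].
have := @greedy_packing ({set T} * (T * T))%type T
  (fun o o' => ~~ [disjoint ends o & ends o']) (fun o W => ~~ [disjoint ends o & W]) 2 O.
move=> /(_ _ _ _ _ (ladder_bound k))[||||[M [/subsetP MO MN dM]]|[W Wc hW]].
- by move=> o o'; rewrite disjoint_sym.
- by move=> o _; apply/pred0Pn; exists o.2.1; rewrite /= !inE eqxx.
- move=> o W W' /subsetP WW' /pred0Pn[x /andP[/= xo /WW' xW]].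
  by apply/pred0Pn; exists x; rewrite /= xo.
- move=> O' _ /set0Pn[o oO']; exists o => //; exists (ends o).
    by rewrite cards2; case: (_ == _).
  by move=> o' _; rewrite disjoint_sym.
- left; have F1P x : x \in F1 -> x \in P = false.
    by move=> /(subsetP F1F) xF; have := disjointFr dFP xF; rewrite inE.
  have CF o : o \in M -> o.1 \subset F1.
    move=> /MO; rewrite inE => /and5P[_ _ _ _ /orP[/eqP->|/andP[/andP[]]]].
      by rewrite sub0set.
    by move=> /exists_inP[x _ /eqP->] _ _; apply: comp_sub.
  apply: (theta_packing_mono _ (leqnn k) (@ladder _ e e_sym P z _ M
    (fun o => o.2.1) (fun o => o.2.2) (fun o => o.1) k sP uP _ _ _ _ _ _)).
  + apply: setUS; apply/bigcupsP => o oM; exact: subset_trans (CF _ oM) F1F.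
  + by move=> o /MO; rewrite inE => /and5P[].
  + move=> o /MO; rewrite inE => /and5P[_ /(subsetP P1P)].
    by rewrite inE -index_mem.
  + by move=> o /MO; rewrite inE => /and5P[].
  + move=> o oM; apply: disjointWl dFP; exact: subset_trans (CF _ oM) F1F.
  + move=> o o' oM o'M oo'; have := dM _ _ oM o'M oo'; rewrite negbK => dE.
    have e1 : o.2.1 \in ends o' = false by rewrite (disjointFr dE) // !inE eqxx.
    have e2 : o.2.2 \in ends o' = false by rewrite (disjointFr dE) // !inE eqxx orbT.
    move: (e1) (e2); rewrite !inE => /norP[n1 _] /norP[_ n2]; split=> //.
    move: (MO _ oM) (MO _ o'M); rewrite !inE.
    move=> /and5P[_ _ _ _ /orP[/eqP->|/andP[/andP[/exists_inP[x xF /eqP Cx] f1] f2]]].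
      by move=> _; rewrite -setI_eq0 set0I.
    move=> /and5P[_ _ /andP[z1 z2] _ /orP[/eqP->|/andP[/andP[/exists_inP[y yF /eqP Cy] g1] g2]]].
      by rewrite -setI_eq0 setI0.
    rewrite Cx Cy; apply: comp_disj => //; apply: contraT; rewrite negbK => /eqP Cxy.
    have := feet2 _ (comp_conn e_sym xF) (comp_sub _ _ _); rewrite leqNgt => /negP[].
    apply: (@card_gt2 _ _ o.2.1 o'.2.1 o'.2.2); rewrite -?Cx //; try by rewrite Cx Cxy -Cy.
    split=> //; first by move: e1; rewrite !inE => /norP[].
    by apply: contraTneq z1 => ->; rewrite -leqNgt ltnW.
  by rewrite MN.
right; exists W => // p q pP qP pzq h.
have [C hC] : exists C, (C, (p, q)) \in O.
  case: h => [pq|[x xF [px qx]]].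
    exists set0; rewrite inE /= pP qP pzq setU0 conn1 /isC eqxx /= andbT.
    by apply/exists_inP; exists p => //; rewrite inE.
  exists (component e F1 x); rewrite inE /= pP qP pzq /isC px qx !andbT /=.
  move: px qx; rewrite !inE => /andP[_ /exists_inP[y yC py]] /andP[_ /exists_inP[y' y'C qy]].
  apply/andP; split; last by apply/orP; right; apply/exists_inP; exists x.
  rewrite (conn_add e_sym (comp_conn e_sym xF) yC) 1?e_sym //=.
  by apply/exists_inP; exists y'; rewrite ?inE ?y'C ?orbT // e_sym.
have /pred0Pn[x /andP[/=]] := hW _ hC.
by rewrite !inE => /orP[]/eqP-> ->; rewrite ?orbT.
Qed.

(** Three contributions: the hitting set of [few_feet], at most [k] cut vertices of the path, and
    the hitting set of [few_crossings] at each of these. *)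
Definition path_bound (k : nat) : nat :=
  object_bound k * 6 + (k + k * (ladder_bound k * 2)).

(** A minimal theta avoiding [Y] is swept by the interval between its extreme vertices on [P], so
    this interval contains a cut position [z]. Being connected, the theta would have to get across
    [z], but [Y] contains the vertex at [z] and an end of every link across it. *)
Lemma path_erdos_posa (P : seq T) (F : {set T}) (k : nat) :
  sorted e P -> uniq P -> [disjoint F & [set x in P]] -> ~~ theta e F ->
  theta_packing e ([set x in P] :|: F) k \/
  exists2 Y : {set T}, #|Y| <= path_bound k &
    ~~ theta e (([set x in P] :|: F) :\: Y).
Proof.
move=> sP uP dFP nthF; have [tp|ntp] := EM (theta_packing e ([set x in P] :|: F) k).
  by left.
right; have [//|[W Wc hW]] := few_feet e_sym k sP uP dFP nthF.
pose P1 := [set x in P] :\: W; pose F1 := F :\: W.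
have dF1W (H : {set T}) : H \subset F1 -> [disjoint H & W].
  by move=> HF; rewrite disjoints_subset; apply: subset_trans HF _; rewrite /F1 setDE subsetIr.
have F1F : F1 \subset F by apply: subsetDl.
have noQ H q : conn e H -> H \subset F1 -> q \in P1 -> ~~ theta e (q |: H).
  by move=> cH HF qP; have [h _] := hW H cH (subset_trans HF F1F) (dF1W _ HF); apply: h.
have feet2 H : conn e H -> H \subset F1 -> #|feet e P1 H| <= 2.
  by move=> cH HF; have [_ h] := hW H cH (subset_trans HF F1F) (dF1W _ HF).
(* Components without feet are left out, as [segment_sweep] needs nonempty attachments; they contain
   no theta anyway. *)
pose M := [set (component e F1 x, feet e P1 (component e F1 x)) | x in
   [set x in F1 | feet e P1 (component e F1 x) != set0]].
have [||//|[Z Zk hZ]] := @segment_sweep _ e P P1 F M k dFP.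
- move=> _ /imsetP[x + ->]; rewrite inE /= => /andP[_ ->]; rewrite andbT.
  exact: subset_trans (comp_sub _ _ _) F1F.
- move=> _ _ /imsetP[x _ ->] /imsetP[y _ ->] xy; apply: comp_disj => //.
  by apply: contraNneq xy => ->.
have [Wz hWz] : exists Wz : 'I_(size P) -> {set T}, forall z : 'I_(size P), #|Wz z| <= ladder_bound k * 2 /\
    forall p q, p \in P1 -> q \in P1 -> index p P < z < index q P ->
      e p q \/ (exists2 x, x \in F1 &
                  p \in feet e P1 (component e F1 x) /\ q \in feet e P1 (component e F1 x)) ->
      (p \in Wz z) || (q \in Wz z).
  apply: (@fin_all_exists _ (fun=> {set T}) (fun (z : 'I_(size P)) Wz => #|Wz| <= ladder_bound k * 2 /\
    forall p q, p \in P1 -> q \in P1 -> index p P < z < index q P ->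
      e p q \/ (exists2 x, x \in F1 &
                  p \in feet e P1 (component e F1 x) /\ q \in feet e P1 (component e F1 x)) ->
      (p \in Wz) || (q \in Wz))) => z.
  have [//|[Wz c h]] := few_crossings z k sP uP dFP (subsetDl _ _) F1F feet2.
  by exists Wz.
pose ZP := [set x in P | [exists z in Z, index x P == z]].
pose Y := W :|: (ZP :|: \bigcup_(z in Z) Wz z).
exists Y.
  apply: leq_trans (leq_card_setU _ _) (leq_add Wc _).
  apply: leq_trans (leq_card_setU _ _) (leq_add _ _).
    apply: leq_trans Zk.
    have [P0|/card_gt0P[x0 _]] := posnP #|T|.
      suff -> : ZP = set0 by rewrite cards0.
      by apply/setP => x; have := fintype0 x P0.
    apply: leq_trans (leq_imset_card (fun z : 'I_(size P) => nth x0 P z) Z).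
    apply: subset_leq_card; apply/subsetP => x; rewrite inE => /andP[xP /exists_inP[z zZ /eqP xz]].
    by apply/imsetP; exists z => //; rewrite -xz nth_index.
  apply: leq_trans (_ : #|Z| * (ladder_bound k * 2) <= _); last by rewrite leq_mul2r Zk orbT.
  rewrite -sum_nat_const.
  elim/big_ind2: _ => [|s A t B sA tB|j jK]; first by rewrite cards0.
    exact: leq_trans (leq_card_setU _ _) (leq_add _ _).
  by have [] := hWz j.
apply/negP => thV.
have [S /minsetP[thS minS] SV] := minset_exists thV.
have SE x : x \in S -> (x \in P1) || (x \in F1).
  by move=> /(subsetP SV); rewrite !inE; case: (x \in W) => //= /andP[_].
have SY x : x \in S -> x \notin Y by move=> /(subsetP SV); rewrite inE => /andP[].
have cS : conn e S.
  have /thetaP[A [B [ABS m]]] := thS.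
  have <- : A :|: B = S.
    by apply: minS => //; apply/thetaP; exists A, B.
  have [cA cB _ eAB] := and4P m.
  have /card_gt0P[[x y]] : 0 < #|between e A B| by apply: leq_trans eAB.
  by rewrite inE /= => /and3P[xA yB xy]; apply: conn_linkU xy.
have PF x : x \in F -> x \in P = false.
  by move=> xF; have := disjointFr dFP xF; rewrite inE.
have P1F x : x \in P1 -> x \notin F1.
  by rewrite !inE => /andP[_ xP]; apply/negP => /andP[_ /PF]; rewrite xP.
(* A component met by [S] cannot hang off the rest of [S] at a cut vertex. *)
have feetS x : x \in S -> x \in F1 -> feet e P1 (component e F1 x) \subset S /\
    exists p, p \in feet e P1 (component e F1 x).
  move=> xS xF; set C := component e F1 x.
  have cC : conn e C := comp_conn e_sym xF.
  have CF : C \subset F1 := comp_sub _ _ _.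
  have xC : x \in C := comp_in e xF.
  have out y y' : y \in C -> y' \in S -> y' \notin C -> e y y' -> y' \in feet e P1 C :&: S.
    move=> yC y'S y'C yy'; have /orP[yP|yF] := SE _ y'S; last first.
      by case/negP: y'C; apply: comp_closed yC yF yy'.
    by rewrite in_setI y'S andbT in_set yP /=; apply/exists_inP; exists y; rewrite // e_sym.
  (* By [feet2], two feet in [S] are all the feet. With fewer, [S] lies inside the component or is
     separated by a single foot. *)
  suff two : 1 < #|feet e P1 C :&: S|.
    have fE : feet e P1 C :&: S = feet e P1 C.
      apply/eqP; rewrite eqEcard subsetIl /=; apply: leq_trans two; exact: feet2.
    split; first by rewrite -fE subsetIr.
    by apply/set0Pn; rewrite -card_gt0 -fE; apply: ltn_trans two.
  rewrite ltnNge; apply/negP => /card_le1_eqP one.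
  have [f0|/set0Pn[q qf]] := eqVneq (feet e P1 C :&: S) set0.
    have SC : S \subset C.
      apply: conn_closed cS xS xC _ => y y' yS yC y'S yy'.
      by apply: contraT => y'C; have := out _ _ yC y'S y'C yy'; rewrite f0 inE.
    by case/negP: nthF; apply: theta_mono thS; apply: subset_trans SC (subset_trans CF F1F).
  have /setIP[qf' qS] := qf; have qP : q \in P1 by move: qf'; rewrite inE => /andP[].
  have qC : q \notin C by apply: contra (P1F _ qP); apply: (subsetP CF).
  have [||||||th|th] := @theta_cut_vertex _ e e_sym S C (S :\: C :\ q) q.
  - by apply/subsetP => y yS; rewrite !inE yS andbT; case: (y == q); case: (y \in C).
  - by [].
  - by rewrite !inE eqxx.
  - by rewrite disjoint_sym disjoints_subset; apply/subsetP => y; rewrite !inE => /and3P[_ ->].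
  - move=> y y' yC; rewrite !inE => /and3P[y'q y'C y'S]; apply/negP => yy'.
    by case/negP: y'q; apply/eqP/one => //; apply: out yy'.
  - exact: thS.
  - by case/negP: (noQ _ _ cC CF qP); apply: theta_mono th; apply: subsetIr.
  have := minS _ th (subsetIl _ _) => /setP/(_ x); rewrite !inE xS xC !andbF orbF /=.
  by move=> /eqP xq; rewrite -xq xC in qC.
have nocross z p q : z \in Z -> p \in S -> q \in S -> p \in P1 -> q \in P1 ->
    index p P < z -> e p q \/ (exists2 x, x \in F1 &
                  p \in feet e P1 (component e F1 x) /\ q \in feet e P1 (component e F1 x)) ->
    index q P < z.
  move=> zZ pS qS pP qP pz h.
  rewrite ltn_neqAle leqNgt; apply/andP; split.
    apply: contra (SY _ qS) => /eqP qz; rewrite !inE; apply/orP; right; apply/orP; left.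
    move: qP; rewrite !inE => /andP[_ ->]; apply/exists_inP; exists z => //; exact/eqP.
  apply/negP => zq; have [_ /(_ p q pP qP)] := hWz z; rewrite pz zq => /(_ isT h).
  case/orP=> w; [case/negP: (SY _ pS)|case/negP: (SY _ qS)]; rewrite !inE;
  by apply/orP; right; apply/orP; right; apply/bigcupP; exists z.
have [p0 p0S] : exists p, p \in S :&: P1.
  apply/set0Pn; apply: contraTneq thS => S0; apply: contra nthF; apply: theta_mono.
  apply/subsetP => x xS; apply: (subsetP F1F); have /orP[xP|//] := SE _ xS.
  by have := in_set0 x; rewrite -S0 inE xS xP.
case: (arg_minnP (fun p => index p P) p0S) => a aS mina.
case: (arg_maxnP (fun p => index p P) p0S) => b bS maxb.
have [aS' aP] := setIP aS; have [bS' bP] := setIP bS.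
have P1P x : x \in P1 -> x \in P by rewrite !inE => /andP[].
have [i iE] := in_position (P1P _ aP); have [j jE] := in_position (P1P _ bP).
have ij : i <= j by rewrite iE jE; apply: mina.
have seg p : p \in S -> p \in P1 -> p \in segment P i j.
  move=> pS pP; have pSP : p \in S :&: P1 by rewrite in_setI pS.
  by rewrite inE P1P // iE jE mina //; apply: maxb.
have [|z zZ /andP[iz zj]] := hZ i j ij.
  apply: theta_mono thS; apply/subsetP => x xS; have /orP[xP|xF] := SE _ xS.
    by apply/setUP; left; rewrite in_setI seg.
  apply/setUP; right; have [fS [p pf]] := feetS _ xS xF.
  apply/bigcupP; exists (component e F1 x, feet e P1 (component e F1 x)); last exact: comp_in.
  apply/andP; split.
    apply/imsetP; exists x => //.
    by rewrite inE xF; apply/set0Pn; exists p.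
  apply/subsetP => q qf /=; apply: seg; first exact: (subsetP fS).
  by move: qf; rewrite inE => /andP[].
have nz x : x \in S -> x \in P1 -> index x P != z.
  move=> xS xP; apply: contra (SY _ xS) => /eqP xz; rewrite !inE.
  apply/orP; right; apply/orP; left; rewrite P1P //=; apply/exists_inP.
  by exists z => //; apply/eqP.
have iz' : index a P < z by rewrite -iE ltn_neqAle iz iE nz.
have zj' : z < index b P by rewrite -jE ltn_neqAle zj eq_sym jE nz.
(* The part left of [z], where a component counts as left when all its feet are; no edge inside [S]
   leads out of it. *)
pose U := [set x | (x \in P1) && (index x P < z) ||
  (x \in F1) && [forall p in feet e P1 (component e F1 x), index p P < z]].
suff /subsetP/(_ b bS') : S \subset U.
  by rewrite inE bP (negPf (P1F _ bP)) /= orbF ltnNge ltnW.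
apply: conn_closed cS aS' _ _; first by rewrite inE aP iz'.
have fP1 x p : p \in feet e P1 (component e F1 x) -> p \in P1 by rewrite inE => /andP[].
move=> x y xS xU yS xy; rewrite inE.
have /orP[yP|yF] := SE _ yS.
  rewrite yP /=; apply/orP; left.
  have /orP[xP|xF] := SE _ xS.
    move: xU; rewrite inE xP (negPf (P1F _ xP)) /= orbF => xz.
    by apply: (nocross z x y) => //; left.
  have nxP : x \notin P1 by apply/negP => /P1F; rewrite xF.
  move: xU; rewrite inE xF (negPf nxP) /= => /forall_inP; apply.
  by rewrite inE yP; apply/exists_inP; exists x; rewrite ?comp_in // e_sym.
rewrite yF /=; apply/orP; right; apply/forall_inP => q qf.
have /orP[xP|xF] := SE _ xS; last first.
  have nxP : x \notin P1 by apply/negP => /P1F; rewrite xF.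
  move: xU; rewrite inE xF (negPf nxP) /= => /forall_inP; apply.
  have yC : y \in component e F1 x by apply: comp_closed xy; rewrite ?comp_in.
  by rewrite -(comp_eq e_sym yC).
move: xU; rewrite inE xP (negPf (P1F _ xP)) /= orbF => xz.
have [fS _] := feetS _ yS yF.
apply: (nocross z x q) => //; [exact: (subsetP fS)|exact: fP1 qf|right].
exists y => //; split=> //; rewrite inE xP; apply/exists_inP; exists y => //.
exact: comp_in.
Qed.

Fixpoint theta_bound (k : nat) : nat :=
  if k is k'.+1 then theta_bound k' + path_bound k else 0.

(** Induction on [k] with a path [P] that spans a theta. If the rest packs [k] thetas, [P] is one
    more; otherwise a set [X] makes the rest theta-free, and [path_erdos_posa] treats [P] together
    with it. The two hitting sets add up, whence the recursion of [theta_bound]. *)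
Theorem theta_erdos_posa (k : nat) (S : {set T}) :
  theta_packing e S k \/
  exists2 X : {set T}, #|X| <= theta_bound k & ~~ theta e (S :\: X).
Proof.
elim: k S => [|k IH] S.
  by left; exists set0; split=> // U; rewrite inE.
have [thS|nth] := boolP (theta e S); last first.
  by right; exists set0; rewrite ?cards0 // setD0.
have [P [sP uP PS thP]] := theta_hamiltonian e_sym thS.
have PS' : [set x in P] \subset S by apply/subsetP => x; rewrite inE => /PS.
have [[M [kM hM dM]]|[X Xc nthX]] := IH (S :\: [set x in P]).
  have PM : [set x in P] \notin M.
    apply/negP => /hM /andP[/theta_neq0/set0Pn[x xP]] /subsetP/(_ x xP).
    by rewrite inE xP.
  have dP U : U \in M -> [disjoint [set x in P] & U].
    move=> /hM /andP[_ US]; rewrite disjoint_sym disjoints_subset.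
    by apply: subset_trans US _; rewrite setDE subsetIr.
  left; exists ([set x in P] |: M); split.
  - by rewrite cardsU1 PM add1n ltnS.
  - move=> U; rewrite !inE => /orP[/eqP->|/hM /andP[-> US]]; first by rewrite thP PS'.
    by apply: subset_trans US _; apply: subsetDl.
  move=> U V; rewrite !inE => /orP[/eqP->|UM] /orP[/eqP->|VM] UV.
  - by rewrite eqxx in UV.
  - exact: dP.
  - by rewrite disjoint_sym dP.
  exact: dM.
have dFP : [disjoint S :\: [set x in P] :\: X & [set x in P]].
  by rewrite disjoints_subset; apply/subsetP => x; rewrite !inE => /and3P[].
have [tp|[Y Yc nthY]] := path_erdos_posa k.+1 sP uP dFP nthX.
  left; apply: theta_packing_mono tp => //.
  by rewrite subUset PS'; apply/subsetP => x; rewrite !inE => /and3P[].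
right; exists (X :|: Y).
  by apply: leq_trans (leq_card_setU _ _) _; rewrite /= leq_add.
apply: contra nthY; apply: theta_mono; apply/subsetP => x; rewrite !inE negb_or.
by move=> /andP[/andP[-> ->] ->]; rewrite andbT orbN.
Qed.

End ErdosPosa.

(** * Thetas through an independent set *)

Section Cuts.
Variables (T : finType) (e : rel T).
Hypothesis e_sym : symmetric e.

(* A connected [C] lying in one of the two sides, closed in that side, whose
   removal keeps [H] connected: a leaf of the tree-like structure formed by
   the components of the two sides. *)
Lemma noncut_component (H A B : {set T}) :
  conn e H -> A :|: B = H -> [disjoint A & B] -> A != set0 -> B != set0 ->
  ~~ (conn e A && conn e B) ->
  exists C, [/\ conn e C, conn e (H :\: C) &
    (C \proper A /\ forall x y, x \in C -> y \in A :\: C -> ~~ e x y) \/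
    (C \proper B /\ forall x y, x \in C -> y \in B :\: C -> ~~ e x y)].
Proof.
move=> cH HE dAB A0 B0 nAB.
have AH x : x \in A -> x \in H by rewrite -HE inE => ->.
have BH x : x \in B -> x \in H by rewrite -HE inE orbC => ->.
have BE x : x \in H -> (x \in B) = (x \notin A).
  rewrite -HE inE; case: (boolP (x \in A)) => /= [xA _|//].
  by rewrite (disjointFr dAB).
(* Connected proper subsets whose outgoing edges all change sides, hence unions of whole components
   of [A] and [B]. Adding a neighbouring component to a maximal one must give all of [H], so the
   complement is a single component. *)
pose K0 (K : {set T}) := [&& conn e K, K \subset H, K != H &
  [forall x in K, forall y in H :\: K, e x y ==> ((x \in A) != (y \in A))]].
have [a aA] := set0Pn _ A0; have [b bB] := set0Pn _ B0.
have [K /maxsetP[/and4P[cK KH KnH /forall_inP clK] maxK]] : {K | maxset K0 K}.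
  apply/sigW; have [|K mK _] := @maxset_exists _ K0 (component e A a); last by exists K.
  apply/and4P; split; first exact: comp_conn.
  - by apply: subset_trans (comp_sub _ _ _) _; apply/subsetP.
  - apply: contraTneq bB => CH; have /subsetP/(_ b) := comp_sub e A a.
    rewrite CH; case: (boolP (b \in H)) => [bH /(_ isT) bA|bH _].
      by rewrite (disjointFr dAB).
    by apply: contra bH; apply: BH.
  apply/forall_inP => x xC; apply/forall_inP => y; rewrite inE => /andP[yC yH].
  apply/implyP => xy; rewrite (subsetP (comp_sub _ _ _) _ xC) eq_sym eqb_id.
  by apply: contra yC => yA; apply: comp_closed xC yA xy.
have {}clK x y : x \in K -> y \in H -> y \notin K -> e x y -> (x \in A) != (y \in A).
  move=> xK yH yK xy; have /forall_inP/(_ y) := clK x xK.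
  by rewrite inE yK yH => /(_ isT)/implyP/(_ xy).
have {}maxK (L : {set T}) : conn e L -> L \subset H -> L != H ->
    (forall x y, x \in L -> y \in H -> y \notin L -> e x y -> (x \in A) != (y \in A)) ->
    K \subset L -> L = K.
  move=> cL LH LnH clL KL; apply: maxK => //; apply/and4P; split=> //.
  apply/forall_inP => u uL; apply/forall_inP => v /setDP[vH vL]; apply/implyP.
  exact: clL.
clear K0 a aA b bB; have [k0 k0K] := conn_ex cK.
have [y0 y0H y0K] : exists2 y, y \in H & y \notin K.
  by apply/subsetPn; apply: contra KnH => HK; rewrite eqEsubset KH.
have [x [y [xH xK yH yK xy]]] := conn_cross cH (subsetP KH _ k0K) k0K y0H y0K.
wlog yA : A B A0 B0 nAB HE dAB AH BH BE clK maxK / y \in A.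
  move=> W; have [yA|yA] := boolP (y \in A); first exact: (W A B).
  have BE' z : z \in H -> (z \in A) = (z \notin B) by move=> zH; rewrite BE ?negbK.
  have [||||||C [cC cHC h]] := W B A B0 A0 _ _ _ BH AH BE'.
  - by rewrite andbC.
  - by rewrite setUC.
  - by rewrite disjoint_sym.
  - move=> u v uK vH vK uv; rewrite !BE //; last exact: (subsetP KH).
    by rewrite (inj_eq negb_inj) clK.
  - move=> L cL LH LnH clL KL; apply: maxK => // u v uL vH vL uv.
    by have := clL u v uL vH vL uv; rewrite !BE ?(inj_eq negb_inj) // (subsetP LH).
  - by rewrite BE.
  by exists C; split=> //; apply/or_comm.
pose C := component e A y.
have cC : conn e C by apply: comp_conn.
have CA : C \subset A by apply: comp_sub.
have yC : y \in C by apply: comp_in.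
have dKC z : z \in C -> z \notin K.
  move=> zC; apply: contra yK => zK; apply: (subsetP _ _ yC).
  apply: conn_closed cC zC zK _ => u v uC uK vC uv; apply: contraT => vK.
  by have := clK _ _ uK (AH _ (subsetP CA _ vC)) vK uv; rewrite !(subsetP CA).
have KC : K :|: C = H.
  apply/eqP; apply: contraT => KCH.
  suff KCK : K :|: C = K by rewrite -KCK inE yC orbT in yK.
  apply: maxK; last exact: subsetUl.
  - exact: conn_linkU xy.
  - by rewrite subUset KH; apply/subsetP => z /(subsetP CA)/AH.
  - by [].
  move=> u v; rewrite !inE negb_or => uKC vH /andP[vK vC] uv.
  case/orP: uKC => [uK|uC]; first exact: clK.
  rewrite (subsetP CA) // eq_sym eqb_id; apply: contra vC => vA.
  exact: comp_closed uC vA uv.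
have HC : H :\: C = K.
  apply/setP => z; rewrite -KC !inE; case: (boolP (z \in C)) => /= [zC|]; last by rewrite orbF.
  by rewrite (negPf (dKC _ zC)).
exists C; split=> //; first by rewrite HC.
left; split; last first.
  move=> u v uC /setDP[vA vC]; apply: contra vC => uv; exact: comp_closed uC vA uv.
(* If [C] were all of [A], then [B] would be [K] and both sides would be connected. *)
rewrite properEneq CA andbT; apply: contra nAB => /eqP CA'.
rewrite -CA' cC /=; have -> : B = K; last by [].
rewrite -HC; apply/setP => z; rewrite inE CA'; case: (boolP (z \in H)) => zH.
  by rewrite BE ?andbT.
by rewrite andbF; apply: contraNF zH; apply: BH.
Qed.

Variables (H X : {set T}).
Hypothesis (cH : conn e H) (dHX : [disjoint H & X]).

(** Edges inside [X] are left out because each of them becomes a part by itself in the edge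
    partition. *)
Definition off_rel : rel T := fun x y => e x y && ~~ ((x \in X) && (y \in X)).

Lemma off_sym : symmetric off_rel.
Proof. by move=> x y; rewrite /off_rel e_sym andbC [(y \in X) && _]andbC andbC. Qed.

Definition adjacent_to (A : {set T}) t : bool := [exists x in A, e t x].

(** An edge between the two sets and the detours through [t1] and [t2] make a theta in which [t1]
    and [t2] can be the degree-2 vertices of a diamond. *)
Definition rooted (L : {set T}) t1 t2 : Prop :=
  exists A B, [/\ A :|: B \subset L, conn e A, conn e B, [disjoint A & B] &
    [/\ [exists x in A, adjacent_to B x], adjacent_to A t1 && adjacent_to B t1 &
        adjacent_to A t2 && adjacent_to B t2]].

Hypothesis (nthH : ~~ theta e H)
  (nth1 : forall t, t \in X -> ~~ theta e (t |: H))
  (nroot : forall t1 t2, t1 \in X -> t2 \in X -> t1 != t2 -> ~ rooted H t1 t2).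

Let HX x : x \in H -> x \in X = false.
Proof. by move=> xH; rewrite (disjointFr dHX). Qed.

Let XH x : x \in X -> x \in H = false.
Proof. by move=> xX; rewrite (disjointFl dHX). Qed.

Let two_nbrs t x y z : t \in X -> x \in H -> y \in H -> z \in H ->
  e t x -> e t y -> e t z -> x != y -> x != z -> y = z.
Proof.
move=> tX xH yH zH tx ty tz xy xz; apply/eqP; apply: contraT => yz.
case/negP: (nth1 tX); apply/thetaP; exists [set t], H; split=> //.
by apply: (@theta_star _ _ t H x y z) => //; rewrite XH.
Qed.

(** The connectivity of [H] supplies an edge between the sides, so two such vertices would be the
    roots of a rooted pair. *)
Let sep_unique A B t t' : A :|: B = H -> [disjoint A & B] -> conn e A -> conn e B ->
  t \in X -> t' \in X -> adjacent_to A t -> adjacent_to B t ->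
  adjacent_to A t' -> adjacent_to B t' -> t = t'.
Proof.
move=> HE dAB cA cB tX t'X tA tB t'A t'B; apply/eqP; apply: contraT => tt'.
case: (nroot tX t'X tt'); exists A, B; split=> //; rewrite ?HE //.
split; rewrite ?tA ?tB ?t'A //.
have [a aA] := conn_ex cA; have [b bB] := conn_ex cB.
have aH : a \in H by rewrite -HE inE aA.
have bH : b \in H by rewrite -HE inE bB orbT.
have bA : b \notin A by rewrite (disjointFl dAB).
have [x [y [_ xA + yA xy]]] := conn_cross cH aH aA bH bA.
rewrite -HE inE (negPf yA) /= => yB; apply/exists_inP; exists x => //.
by apply/exists_inP; exists y.
Qed.

(** With [t] added to the side [A] there is an edge from [t] to [B]; two edges between [A] and [B]
    would complete a theta. *)
Let sep_edge A B t x y x' y' : A :|: B = H -> [disjoint A & B] -> conn e A -> conn e B ->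
  t \in X -> adjacent_to A t -> adjacent_to B t ->
  x \in A -> y \in B -> e x y -> x' \in A -> y' \in B -> e x' y' -> (x, y) = (x', y').
Proof.
move=> HE dAB cA cB tX /exists_inP[a aA ta] /exists_inP[b bB tb] xA yB xy x'A y'B x'y'.
apply/eqP; apply: contraT => ne; case/negP: (nth1 tX).
have AH z : z \in A -> z \in H by rewrite -HE inE => ->.
have BH z : z \in B -> z \in H by rewrite -HE inE orbC => ->.
have tz z : z \in H -> t != z by move=> zH; apply: contraTneq tX => ->; rewrite HX.
apply/thetaP; exists (t |: A), B; split; first by rewrite -setUA HE.
apply/and4P; split=> //.
- by apply: (conn_add e_sym cA aA); rewrite e_sym.
- rewrite disjoint_setUl dAB andbT disjoints1; apply: contraTN tX => /BH tH.
  by rewrite HX.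
apply: (between3 (a1 := t) (a2 := x) (a3 := x') (b1 := b) (b2 := y) (b3 := y')) => //.
  by rewrite !inE eqxx xA x'A !orbT.
by split=> //; rewrite xpair_eqE negb_and ?(tz _ (AH _ xA)) ?(tz _ (AH _ x'A)).
Qed.

(** A side inside [X] would be a single vertex, because [off_rel] has no edges there; its three
    crossing edges would end in [H] and give a theta. *)
Let part_neq0 A B : theta_model off_rel A B -> A :|: B \subset H :|: X ->
  A :&: H != set0.
Proof.
case/and4P=> cA cB dAB eAB ABHX; apply/negP => /eqP AH.
have AX x : x \in A -> x \in X.
  move=> xA; have /subsetP/(_ x) := ABHX; rewrite !inE xA => /(_ isT) /orP[xH|//].
  by have := in_set0 x; rewrite -AH inE xA xH.
have [t tA] := conn_ex cA.
have A1 x : x \in A -> x = t.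
  move=> xA; apply/set1P; apply: (subsetP _ _ xA).
  apply: conn_closed cA tA (set11 t) _ => y z /AX yX _ /AX zX.
  by rewrite /off_rel yX zX andbF.
have tX := AX _ tA.
have [[a1 b1] [[a2 b2] [[a3 b3] []]]] := card_gt2_subset3 eAB.
rewrite !inE /= => -[/and3P[/A1-> b1B e1] /and3P[/A1-> b2B e2] /and3P[/A1-> b3B e3]].
rewrite !xpair_eqE !eqxx /= => -[n12 n13 n23].
have bH b : b \in B -> off_rel t b -> (b \in H) && e t b.
  move=> bB /andP[-> ]; rewrite tX /= andbT => bX.
  by have /subsetP/(_ b) := ABHX; rewrite !inE bB orbT (negPf bX) orbF; apply.
have /andP[b1H e1'] := bH _ b1B e1; have /andP[b2H e2'] := bH _ b2B e2.
have /andP[b3H e3'] := bH _ b3B e3.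
by case/eqP: n23; apply: (two_nbrs tX b1H).
Qed.

Let part_nbr A t : conn off_rel A -> A \subset H :|: X -> A :&: H != set0 ->
  t \in A -> t \in X -> adjacent_to (A :&: H) t.
Proof.
move=> cA AHX /set0Pn[a /setIP[aA aH]] tA tX.
have aT : a \notin [set t] by rewrite inE; apply: contraTneq aH => ->; rewrite XH.
have [x [y [_ /set1P-> yA _ /andP[ty]]]] := conn_cross cA tA (set11 t) aA aT.
rewrite tX /= => yX; apply/exists_inP; exists y => //; rewrite inE yA /=.
by have := subsetP AHX _ yA; rewrite inE (negPf yX) orbF.
Qed.

(** Only one vertex [t] of [X] can see both sides, and having at most two neighbours in [H] it
    accounts for at most one crossing edge. Inside [H] there is then at most one more, so there are
    never three. Without such a [t], the crossing edges form a theta inside [H]. *)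
Let connected_sides A B : theta_model off_rel A B -> A :|: B \subset H :|: X ->
  H \subset A :|: B -> conn e (A :&: H) -> conn e (B :&: H) -> False.
Proof.
move=> m ABHX HAB cAH cBH; have [cA cB dAB eAB] := and4P m.
have HE : (A :&: H) :|: (B :&: H) = H by rewrite -setIUl; apply/setIidPr.
have dAB' : [disjoint A :&: H & B :&: H].
  by apply: disjointWl (subsetIl _ _) _; apply: disjointWr (subsetIl _ _) _.
have A0 := part_neq0 m ABHX.
have B0 : B :&: H != set0.
  by apply: (@part_neq0 B A); rewrite 1?setUC // (theta_model_sym off_sym).
have [AHX BHX] : A \subset H :|: X /\ B \subset H :|: X by move: ABHX; rewrite subUset => /andP.
have inHX (Z : {set T}) z : Z \subset H :|: X -> z \in Z -> z \notin X -> z \in Z :&: H.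
  by move=> ZHX zZ zX; have := subsetP ZHX _ zZ; rewrite !inE zZ (negPf zX) orbF.
have sepA t y : t \in A -> t \in X -> y \in B -> off_rel t y ->
    [/\ adjacent_to (A :&: H) t, adjacent_to (B :&: H) t, y \in B :&: H & e t y].
  move=> tA tX yB /andP[ty]; rewrite tX /= => yX; have yBH := inHX _ _ BHX yB yX.
  by split=> //; [exact: part_nbr|apply/exists_inP; exists y].
have sepB t x : t \in B -> t \in X -> x \in A -> off_rel x t ->
    [/\ adjacent_to (A :&: H) t, adjacent_to (B :&: H) t, x \in A :&: H & e t x].
  move=> tB tX xA /andP[xt]; rewrite tX andbT => xX; have xAH := inHX _ _ AHX xA xX.
  rewrite e_sym in xt.
  by split=> //; [apply/exists_inP; exists x|exact: part_nbr].
have [/existsP[t /and3P[tX tA tB]]|nosep] := boolP [exists t, [&& t \in X,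
    adjacent_to (A :&: H) t & adjacent_to (B :&: H) t]]; last first.
  case/negP: nthH; apply/thetaP; exists (A :&: H), (B :&: H); split; first by rewrite HE.
  apply/and4P; split=> //; apply: leq_trans eAB _; apply: subset_leq_card.
  apply/subsetP => -[x y] xyin; move: xyin; rewrite inE /= => /and3P[xA yB xy].
  have xX : x \notin X.
    apply: contra nosep => xX; have [h1 h2 _ _] := sepA _ _ xA xX yB xy.
    by apply/existsP; exists x; rewrite xX h1.
  have yX : y \notin X.
    apply: contra nosep => yX; have [h1 h2 _ _] := sepB _ _ yB yX xA xy.
    by apply/existsP; exists y; rewrite yX h1.
  by rewrite inE /= !inHX //; case/andP: xy.
(* Crossing edges are told apart by whether they avoid [X], so there are at most two. *)
suff inj : {in between off_rel A B &, injective (fun u => (u.1 \notin X) && (u.2 \notin X))}.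
  by move: eAB; rewrite -(card_in_imset inj) ltnNge -card_bool max_card.
have uniqt s : s \in X -> adjacent_to (A :&: H) s -> adjacent_to (B :&: H) s -> s = t.
  by move=> sX sA sB; apply: (sep_unique HE).
have nbrA : exists2 x, x \in A :&: H & e t x by apply/exists_inP.
have nbrB : exists2 x, x \in B :&: H & e t x by apply/exists_inP.
have AneB x y : x \in A :&: H -> y \in B :&: H -> x != y.
  by move=> xA yB; apply: contraTneq yB => <-; rewrite (disjointFr dAB').
have inH (Z : {set T}) x : x \in Z :&: H -> x \in H by case/setIP.
move=> [x y] [x' y'] /= uin u'in; move: uin u'in; rewrite !inE /=.
move=> /and3P[xA yB xy] /and3P[x'A y'B x'y'].
have [xX|xX] /= := boolP (x \in X).
  have [h1 h2 yBH ty] := sepA _ _ xA xX yB xy.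
  have xt := uniqt _ xX h1 h2; subst x; move=> /esym/nandP; rewrite !negbK => -[x'X|y'X].
    have [h1' h2' y'BH ty'] := sepA _ _ x'A x'X y'B x'y'.
    have xt' := uniqt _ x'X h1' h2'; subst x'; congr pair.
    have [z zA tz] := nbrA.
    by apply: (two_nbrs tX (inH _ _ zA) (inH _ _ yBH) (inH _ _ y'BH)) => //; apply: AneB.
  have [h1' h2' _ _] := sepB _ _ y'B y'X x'A x'y'.
  have yt' := uniqt _ y'X h1' h2'; subst y'.
  by rewrite (disjointFr dAB xA) in y'B.
have [yX|yX] /= := boolP (y \in X).
  have [h1 h2 xAH tx] := sepB _ _ yB yX xA xy.
  have yt := uniqt _ yX h1 h2; subst y; move=> /esym/nandP; rewrite !negbK => -[x'X|y'X].
    have [h1' h2' y'BH ty'] := sepA _ _ x'A x'X y'B x'y'.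
    have xt' := uniqt _ x'X h1' h2'; subst x'.
    by rewrite (disjointFr dAB x'A) in yB.
  have [h1' h2' x'AH tx'] := sepB _ _ y'B y'X x'A x'y'.
  have yt' := uniqt _ y'X h1' h2'; subst y'; congr pair.
  have [z zB tz] := nbrB.
  by apply: (two_nbrs tX (inH _ _ zB) (inH _ _ xAH) (inH _ _ x'AH)) => //; rewrite eq_sym; apply: AneB.
move=> /esym/andP[x'X y'X].
apply: (sep_edge HE dAB' cAH cBH tX tA tB); rewrite ?inHX //.
- by case/andP: xy.
by case/andP: x'y'.
Qed.

(* Moving [C] to the other side trades the edge between [C] and [B] for the
   edge joining [C] to a vertex of [X]. *)
Let move_component A B C : theta_model off_rel A B -> A :|: B \subset H :|: X ->
  H \subset A :|: B -> conn e C -> conn e (H :\: C) -> C \proper A :&: H ->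
  (forall x y, x \in C -> y \in (A :&: H) :\: C -> ~~ e x y) ->
  exists A' B', [/\ theta_model off_rel A' B', A' :|: B' \subset H :|: X,
    H \subset A' :|: B' &
    #|between e (A' :&: H) (B' :&: H)| < #|between e (A :&: H) (B :&: H)|].
Proof.
move=> m ABHX HAB cC cHC /properP[CA [a0 a0AH a0C]] nCA; have [cA cB dAB eAB] := and4P m.
have CAH x : x \in C -> (x \in A) && (x \in H) by move/(subsetP CA); rewrite inE.
have CH : C \subset H by apply/subsetP => x /CAH/andP[].
have HE : C :|: (H :\: C) = H.
  apply/setP => x; rewrite !inE; case: (boolP (x \in C)) => //= xC.
  by rewrite (subsetP CH).
have dC : [disjoint C & H :\: C].
  by rewrite disjoint_sym disjoints_subset setDE subsetIr.
have [AHX BHX] : A \subset H :|: X /\ B \subset H :|: X by move: ABHX; rewrite subUset => /andP.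
have A0 := part_neq0 m ABHX.
have B0 : B :&: H != set0.
  by apply: (@part_neq0 B A); rewrite 1?setUC // (theta_model_sym off_sym).
have nCA' x y : x \in C -> y \in A -> y \in H -> y \notin C -> e x y -> False.
  by move=> xC yA yH yC; apply/negP/nCA; rewrite // !inE yC yA.
have [c1 c1C] := conn_ex cC; have /andP[c1A c1H] := CAH _ c1C.
have /setIP[a0A a0H] := a0AH.
pose NC := [set t in X | adjacent_to C t].
(* [A] is connected for [off_rel], but within [A :&: H] no edge leaves [C]; so some vertex of [X] in
   [A] links [C] to the rest. *)
have [t0 [t0A t0X t0C [b0 [b0A b0H b0C t0b0]]]] : exists t0,
    [/\ t0 \in A, t0 \in X, adjacent_to C t0 & exists b, [/\ b \in A, b \in H, b \notin C & e t0 b]].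
  have c1U : c1 \in C :|: NC by rewrite inE c1C.
  have a0U : a0 \notin C :|: NC by rewrite !inE (negPf a0C) HX.
  have [x [y [xA + yA + /andP[xy]]]] := conn_cross cA c1A c1U a0A a0U.
  have yHX := subsetP AHX _ yA; move: yHX; rewrite !inE => yHX.
  case/orP=> [xC|/andP[xX xC]] /norP[yC].
    rewrite negb_and => /orP[yX _|/negP[]].
      have yH : y \in H by case/orP: yHX => // yX'; rewrite yX' in yX.
      by case: (nCA' x y).
    by apply/exists_inP; exists x => //; rewrite e_sym.
  rewrite xX /= => _ yX; exists x; split=> //; exists y; split=> //.
  by case/orP: yHX => // yX'; rewrite yX' in yX.
have t0H : t0 \in H = false by rewrite XH.
have t0HC : adjacent_to (H :\: C) t0 by apply/exists_inP; exists b0; rewrite ?inE ?b0C.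
have uniqt t : t \in X -> adjacent_to C t -> adjacent_to (H :\: C) t -> t = t0.
  by move=> tX tC tHC; apply: (sep_unique HE).
have inHC x : x \in H -> x \notin C -> x \in H :\: C by move=> xH xC; rewrite inE xH xC.
have [c [b [cCin bB bH cb]]] : exists c b, [/\ c \in C, b \in B, b \in H & e c b].
  have [x [y [_ xC yH yC xy]]] := conn_cross cH c1H c1C a0H a0C.
  exists x, y; split=> //; have := subsetP HAB _ yH; rewrite inE => /orP[yA|//].
  by case: (nCA' x y).
have BC x : x \in B -> x \notin C.
  by move=> xB; apply/negP => /CAH/andP[xA _]; rewrite (disjointFr dAB xA) in xB.
have uniqe x y : x \in C -> y \in H -> y \notin C -> e x y -> (x, y) = (c, b).
  move=> xC yH yC xy.
  exact: (sep_edge HE dC cC cHC t0X t0C t0HC xC (inHC _ yH yC) xy cCin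
    (inHC _ bH (BC _ bB)) cb).
(* By the uniqueness of [t0], these vertices have all their neighbours in [H] inside [C], so they
   move along with [C]. *)
pose Tc := [set t in A | [&& t \in X, t != t0 & adjacent_to C t]].
have TcC t y : t \in Tc -> y \in H -> e t y -> y \in C.
  rewrite inE => /and4P[tA tX tt0 tC] yH ty; apply: contraNT tt0 => yC.
  by apply/eqP/uniqt => //; apply/exists_inP; exists y => //; apply: inHC.
pose A' := A :\: (C :|: Tc); pose B' := B :|: (C :|: Tc).
have link y z : y \in A' -> z \in C :|: Tc -> off_rel y z -> y = t0.
  rewrite !inE negb_or => /andP[/andP[yC yT] yA] zin /andP[yz nX].
  have := subsetP AHX _ yA; rewrite inE => /orP[yH|yX].
    case/orP: zin => [zC|zT].
      by case: (nCA' z y); rewrite // e_sym.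
    by case/negP: yC; apply: (TcC z) => //; rewrite ?inE // e_sym.
  move: nX; rewrite yX /= => zX; case/orP: zin => [zC|/and4P[_ zX']]; last by rewrite zX' in zX.
  apply/eqP; apply: contraNT yT => yt0; rewrite yA yX yt0 /=.
  by apply/exists_inP; exists z.
have t0A' : t0 \in A'.
  by rewrite !inE t0A eqxx /= !andbF orbF andbT; apply/negP => /(subsetP CH); rewrite t0H.
have CTA : C :|: Tc \subset A.
  by apply/subsetP => x; rewrite !inE => /orP[/CAH/andP[]|/andP[]].
have cA' : conn off_rel A'.
  apply/connP; split; first by apply/set0Pn; exists t0.
  move=> U x xA' xU cU; have xA : x \in A by case/setDP: xA'.
  pose U' := (U :&: A') :|: (if t0 \in U then C :|: Tc else set0).
  have inA' z : z \in A -> (z \in A') = (z \notin C :|: Tc) by move=> zA; rewrite inE zA andbT.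
  have /subsetP AU' : A \subset U'.
    apply: conn_closed cA xA _ _; first by rewrite in_setU in_setI xU xA'.
    move=> y z yA yU' zA yz; have [zA'|] := boolP (z \in A').
      case/setUP: yU' => [/setIP[yU yA']|].
        by rewrite in_setU in_setI (cU y z) ?zA'.
      case: ifP => [t0U yC|]; last by rewrite inE.
      by rewrite off_sym in yz; rewrite in_setU in_setI zA' (link _ _ zA' yC yz) t0U.
    rewrite inA' // negbK => zC; case/setUP: yU' => [/setIP[yU yA']|].
      by rewrite /U' in_setU -(link _ _ yA' zC yz) yU zC orbT.
    case: ifP => [t0U _|_]; last by rewrite inE.
    by rewrite /U' in_setU t0U zC orbT.
  apply/subsetP => y yA'; have yA : y \in A by case/setDP: yA'.
  have := AU' _ yA; rewrite in_setU in_setI yA' andbT => /orP[//|].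
  case: ifP => [_ yC|]; last by rewrite inE.
  by rewrite inA' // yC in yA'.
have offH x y : x \in H -> e x y -> off_rel x y.
  by move=> xH xy; rewrite /off_rel xy HX.
have cB' : conn off_rel B'.
  apply: (conn_root off_sym (x := b)); first by rewrite inE bB.
  move=> U bU cU.
  have BU : B \subset U.
    apply: conn_closed cB bB bU _ => x y xB xU yB xy.
    by apply: (cU x) => //; rewrite !in_setU ?xB ?yB.
  have cU0 : c \in U.
    by apply: (cU b); rewrite ?in_setU ?bB ?cCin ?orbT //; apply: offH => //; rewrite e_sym.
  have /subsetP CU : C \subset U.
    apply: conn_closed cC cCin cU0 _ => x y xC xU yC xy.
    apply: (cU x); rewrite ?in_setU ?xC ?yC ?orbT //; apply: offH => //.
    exact: (subsetP CH).
  rewrite /B' !subUset BU /=; apply/andP; split; first exact/subsetP.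
  apply/subsetP => t tT; move: (tT); rewrite inE => /and4P[tA tX tt0 /exists_inP[x xC tx]].
  apply: (cU x); rewrite ?in_setU ?xC ?tT ?orbT ?CU //; apply: offH; last by rewrite e_sym.
  exact: (subsetP CH).
have dAB' : [disjoint A' & B'].
  rewrite disjoint_setUr; apply/andP; split.
    by apply: disjointWl dAB; apply: subsetDl.
  by rewrite disjoints_subset /A' setDE subsetIr.
have UE : A' :|: B' = A :|: B.
  apply/setP => x; have /implyP := subsetP CTA x; rewrite !in_setU in_setD !in_setU.
  by case: (x \in C); case: (x \in Tc); case: (x \in A); case: (x \in B).
have AH' x : x \in A' -> x \in H -> x \in (A :&: H) :\: C.
  by rewrite !inE negb_or => /andP[/andP[-> _] ->] ->.
exists A', B'; split; rewrite ?UE //.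
- apply/and4P; split=> //.
  (* The pair [(t0, c0)] replaces [(c, b)], the only crossing edge that the move destroys. *)
  have [c0 c0C t0c0] : exists2 c0, c0 \in C & e t0 c0 by apply/exists_inP.
  have cbin : (c, b) \in between off_rel A B.
    have /andP[cinA cinH] := CAH _ cCin.
    by rewrite inE /= cinA bB offH.
  have new : (t0, c0) \notin between off_rel A B :\ (c, b).
    by apply/negP; rewrite !inE => /and4P[_ _ c0B _]; have := BC _ c0B; rewrite c0C.
  apply: leq_trans (_ : #|(t0, c0) |: (between off_rel A B :\ (c, b))| <= _).
    by rewrite cardsU1 new; move: eAB; rewrite (cardsD1 (c, b) (between off_rel A B)) cbin.
  apply: subset_leq_card; apply/subsetP => -[x y] xyin.
  rewrite inE /=; move: xyin; rewrite in_setU1 in_setD1 => /orP[/eqP[-> ->]|].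
    rewrite t0A' !in_setU c0C orbT /= off_sym; apply: offH; last by rewrite e_sym.
    exact: (subsetP CH).
  rewrite [(x, y) \in between _ _ _]inE => /andP[ne /and3P[/= xA yB xy]].
  have /andP[exy nX] := xy.
  rewrite xy (in_setU y B) yB /= andbT in_setD xA andbT in_setU negb_or.
  have yHX : (y \in H) || (y \in X) by have := subsetP BHX _ yB; rewrite inE.
  apply/andP; split; apply/negP; [move=> xC|move=> xT].
    case/orP: yHX => [yH|yX].
      by case/eqP: ne; apply: uniqe; rewrite ?BC.
    have yBH := part_nbr cB BHX B0 yB yX.
    have : y = t0.
      apply: uniqt => //; first by apply/exists_inP; exists x; rewrite // e_sym.
      case/exists_inP: yBH => z /setIP[zB zH] yz; apply/exists_inP; exists z => //.
      by apply: inHC; rewrite ?BC.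
    by move=> yt0; rewrite yt0 (disjointFr dAB) in yB.
  have yH : y \in H.
    case/orP: yHX => // yX; move: xT; rewrite inE => /and3P[_ xX _].
    by rewrite xX yX in nX.
  by have := BC _ yB; rewrite (TcC x).
have cbin : (c, b) \in between e (A :&: H) (B :&: H).
  by have /andP[cinA cinH] := CAH _ cCin; rewrite inE /= !in_setI cinA cinH bB bH.
rewrite [X in _ < X](cardsD1 (c, b)) cbin add1n ltnS.
apply: subset_leq_card; apply/subsetP => -[x y] xyin; move: xyin.
rewrite inE /= => /and3P[/setIP[xA' xH] /setIP[yB' yH] xy].
have xAC := AH' _ xA' xH.
have xC : x \notin C by case/setDP: xAC.
have xAH : x \in A :&: H by case/setDP: xAC.
have yB : y \in B.
  move: yB'; rewrite !in_setU => /orP[//|/orP[yC|yT]].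
    by case/negP: (nCA y x yC xAC); rewrite e_sym.
  by move: yT; rewrite inE => /and3P[_ yX _]; rewrite HX in yX.
rewrite in_setD1 inE /= xAH inE yB yH xy !andbT.
by apply: contraNneq xC => -[-> _].
Qed.

(** Induction on the number of crossing edges inside [H]: while a side is disconnected within [H],
    moving a component that does not cut [H] lowers this number. *)
Let no_covering_model A B : theta_model off_rel A B -> A :|: B \subset H :|: X ->
  H \subset A :|: B -> False.
Proof.
move: {2}_.+1 (ltnSn #|between e (A :&: H) (B :&: H)|) => n.
elim: n A B => // n IH A B; rewrite ltnS => lt m ABHX HAB.
have msym A1 B1 : theta_model off_rel A1 B1 -> theta_model off_rel B1 A1.
  by rewrite (theta_model_sym off_sym).
have A0 := part_neq0 m ABHX.
have B0 : B :&: H != set0 by apply: (@part_neq0 B A); rewrite 1?setUC // msym.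
have HE : (A :&: H) :|: (B :&: H) = H by rewrite -setIUl; apply/setIidPr.
have [cA cB dAB eAB] := and4P m.
have dAB' : [disjoint A :&: H & B :&: H].
  by apply: disjointWl (subsetIl _ _) _; apply: disjointWr (subsetIl _ _) _.
have [/andP[cAH cBH]|nc] := boolP (conn e (A :&: H) && conn e (B :&: H)).
  exact: connected_sides m ABHX HAB cAH cBH.
have [C [cC cHC [[CA nCA]|[CB nCB]]]] := noncut_component cH HE dAB' A0 B0 nc.
  have [A' [B' [m' sub' cov' lt']]] := move_component m ABHX HAB cC cHC CA nCA.
  by apply: IH m' sub' cov'; apply: leq_trans lt.
have [||A' [B' [m' sub' cov' lt']]] := move_component (msym _ _ m) _ _ cC cHC CB nCB.
- by rewrite setUC.
- by rewrite setUC.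
apply: IH m' sub' cov'; apply: leq_trans lt' _.
by rewrite (between_sym e_sym).
Qed.

(** As [H] is connected, a model can absorb the vertices of [H] that it misses, one at a time; a
    model covering [H] is excluded by [no_covering_model]. *)
Lemma off_theta_free : ~~ theta off_rel (H :|: X).
Proof.
apply/negP => /thetaP[A [B [ABHX m]]].
move: {2}_.+1 (ltnSn #|H :\: (A :|: B)|) => n.
elim: n A B ABHX m => // n IH A B ABHX m; rewrite ltnS => lt.
have [HAB|/subsetPn[y yH yAB]] := boolP (H \subset A :|: B).
  exact: no_covering_model m ABHX HAB.
have /set0Pn[x /setIP[xA xH]] := part_neq0 m ABHX.
have xAB : x \in A :|: B by rewrite inE xA.
have [u [v [uH uAB vH vAB uv]]] := conn_cross cH xH xAB yH yAB.
have off_uv : off_rel u v by rewrite /off_rel uv HX.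
have [cA cB dAB eAB] := and4P m.
have dec (Z : {set T}) : A :|: B \subset Z -> v \in Z -> #|H :\: Z| < n.
  move=> ABZ vZ; apply: leq_trans lt; apply: proper_card; apply/properP; split.
    exact: setDS.
  by exists v; rewrite inE ?vZ // vAB.
move: (vAB); rewrite inE negb_or => /andP[vA vB].
have vHX : [set v] \subset H :|: X by rewrite sub1set inE vH.
case/setUP: uAB => [uA|uB].
- apply: (IH (v |: A) B).
  + by rewrite -setUA subUset vHX.
  + apply/and4P; split=> //; first exact: (conn_add off_sym cA uA).
      by rewrite disjoint_setUl disjoints1 vB.
    apply: leq_trans eAB _; apply: subset_leq_card; apply/subsetP => w.
    by rewrite !inE => /and3P[-> -> ->]; rewrite orbT.
  by apply: dec; rewrite ?inE ?eqxx // -setUA subsetUr.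
apply: (IH A (v |: B)).
+ by rewrite setUCA subUset vHX.
+ apply/and4P; split=> //; first exact: (conn_add off_sym cB uB).
    by rewrite disjoint_setUr dAB disjoint_sym disjoints1 vA.
  apply: leq_trans eAB _; apply: subset_leq_card; apply/subsetP => w.
  by rewrite !inE => /and3P[-> -> ->]; rewrite orbT.
by apply: dec; rewrite ?inE ?eqxx ?orbT // setUCA subsetUr.
Qed.

End Cuts.

(** * Topological embeddings *)

(** [subdivision_via] without the clauses that confine the host graph to the subdivision; here the
    walks need only be paths of [G]. *)
Record topological_embedding (H G : sgraph) (f : H -> G) (P : H -> H -> seq G) :
    Prop := TopologicalEmbedding {
  emb_inj : injective f;
  emb_rev : forall x y, x -- y -> P y x = rev (P x y);
  emb_uniq : forall x y, x -- y -> uniq (P x y);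
  emb_avoid : forall x y z, x -- y -> f z \notin P x y;
  emb_disj : forall x y x' y' v, x -- y -> x' -- y' ->
    v \in P x y -> v \in P x' y' -> [set x; y] = [set x'; y'];
  emb_path : forall x y, x -- y -> path adj (f x) (rcons (P x y) (f y)) }.

Section EmbeddingMinor.
Variables (H G : sgraph) (f : H -> G) (P : H -> H -> seq G).
Hypothesis emb : topological_embedding f P.

Let used (v : G) : bool := [exists x, v == f x] || [exists x, exists y, (x -- y) && (v \in P x y)].

Let K : finType := {v : G | used v}.

Let used_f x : used (f x).
Proof. by apply/orP; left; apply/existsP; exists x. Qed.

Let used_P x y v : x -- y -> v \in P x y -> used v.
Proof.
by move=> xy vP; apply/orP; right; apply/existsP; exists x; apply/existsP; exists y; rewrite xy.
Qed.

Let fK x : K := Sub (f x) (used_f x).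
Let PK x y : seq K := pmap insub (P x y).

Let map_PK x y : x -- y -> map val (PK x y) = P x y.
Proof.
move=> xy; rewrite /PK (pmap_filter (@insubK _ _ _)); apply/all_filterP/allP => v vP /=.
by rewrite insubT ?(used_P xy).
Qed.

Let in_PK x y v : x -- y -> (v \in PK x y) = (val v \in P x y).
Proof. by move=> xy; rewrite -(map_PK xy) mem_map //; apply: val_inj. Qed.

Let Kadj : rel K := fun u v => [exists x, exists y, (x -- y) &&
  infix [:: u; v] (fK x :: rcons (PK x y) (fK y))].

Let walk_uniq x y : x -- y -> uniq (f x :: rcons (P x y) (f y)).
Proof.
move=> xy; rewrite /= mem_rcons inE negb_or rcons_uniq !(emb_avoid emb) // (emb_uniq emb) //.
by rewrite !andbT; apply: contraTneq xy => /(emb_inj emb)->; rewrite adj_irrefl.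
Qed.

Let map_walk x y : x -- y ->
  map val (fK x :: rcons (PK x y) (fK y)) = f x :: rcons (P x y) (f y).
Proof. by move=> xy; rewrite /= map_rcons map_PK. Qed.

Let PK_rev x y : x -- y -> PK y x = rev (PK x y).
Proof.
move=> xy; have yx : y -- x by rewrite adj_sym.
by apply: (inj_map val_inj); rewrite map_rev (map_PK xy) (map_PK yx) (emb_rev emb).
Qed.

Let Kadj_sym : symmetric Kadj.
Proof.
suff imp u v : Kadj u v -> Kadj v u by move=> u v; apply/idP/idP; apply: imp.
case/existsP=> x /existsP[y /andP[xy uv]]; apply/existsP; exists y; apply/existsP; exists x.
have wE : rev (fK y :: rcons (PK y x) (fK x)) = fK x :: rcons (PK x y) (fK y).
  by rewrite rev_cons rev_rcons (PK_rev xy) revK rcons_cons.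
by rewrite adj_sym xy -infix_rev wE.
Qed.

Let Kadj_irrefl : irreflexive Kadj.
Proof.
move=> u; apply/negbTE/negP => /existsP[x /existsP[y /andP[xy /infixP[s1 [s2 sE]]]]].
have := walk_uniq xy; rewrite -map_walk // map_inj_uniq; last exact: val_inj.
by rewrite sE !cat_uniq /= inE eqxx /= !andbF.
Qed.

Lemma embedding_top_minor : top_minor H G.
Proof.
exists (SGraph Kadj_sym Kadj_irrefl); split.
  exists fK, PK; split=> /=.
  - by move=> x y /(congr1 val) /(emb_inj emb).
  - exact: PK_rev.
  - by move=> x y xy; rewrite -(map_inj_uniq val_inj) map_PK // (emb_uniq emb).
  - by move=> x y z xy; rewrite in_PK // (emb_avoid emb).
  - by move=> x y x' y' v xy xy'; rewrite !in_PK //; apply: (emb_disj emb).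
  - move=> v; case/orP: (valP v) => [/existsP[x /eqP vx]|/existsP[x /existsP[y /andP[xy vP]]]].
      by left; exists x; apply: val_inj.
    by right; exists x, y; rewrite in_PK.
  move=> u v; split.
    by case/existsP=> x /existsP[y /andP[xy uv]]; exists x, y.
  by case=> x [y [xy uv]]; apply/existsP; exists x; apply/existsP; exists y; rewrite xy.
exists val; split; first exact: val_inj.
move=> u v /= /existsP[x /existsP[y /andP[xy /infixP[s1 [s2 sE]]]]].
have := emb_path emb xy; have := map_walk xy; rewrite sE !map_cat /= => pE.
have : sorted adj (f x :: rcons (P x y) (f y)) -> val u -- val v.
  rewrite -pE; case: (map val s1) => [|z s] /=; first by case/andP.
  by rewrite cat_path /= => /and4P[].
by apply.
Qed.

End EmbeddingMinor.

Lemma isubgraph_top_minor (H G : sgraph) : isubgraph H G -> top_minor H G.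
Proof.
case=> f [f_inj f_hom]; apply: (@embedding_top_minor _ _ f (fun _ _ => [::])).
by split=> //= x y xy; rewrite f_hom.
Qed.

Lemma top_minor_refl (G : sgraph) : top_minor G G.
Proof. by apply: isubgraph_top_minor; exists id; split=> // x y. Qed.

Section FanEmbedding.
Variables (D G : sgraph) (S : {set D}) (k : nat) (g : D -> G) (Z : 'I_k -> {set G}).
Variables (f : 'I_k -> D -> G) (P : 'I_k -> D -> D -> seq G).
Hypothesis S_indep : forall u v, u \in S -> v \in S -> ~~ (u -- v).
Hypothesis g_inj : {in S &, injective g}.
Hypothesis gZ : forall i v, v \in S -> g v \notin Z i.
Hypothesis dZ : forall i j, i != j -> [disjoint Z i & Z j].
Hypothesis embf : forall i, topological_embedding (f i) (P i).
Hypothesis fS : forall i v, v \in S -> f i v = g v.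
Hypothesis fZ : forall i v, v \notin S -> f i v \in Z i.
Hypothesis PZ : forall i x y v, x -- y -> v \in P i x y -> v \in Z i.

Let F := Fan S k.
Let pr (a : F) : D := match a with inl u => val u | inr (u, _) => val u end.
Let copy (a b : F) : option 'I_k :=
  match a, b with inr (_, i), _ => Some i | _, inr (_, j) => Some j | _, _ => None end.
Let fF (a : F) : G := match a with inl u => g (val u) | inr (u, i) => f i (val u) end.
Let PF (a b : F) : seq G := if copy a b is Some i then P i (pr a) (pr b) else [::].

Let disjZ i j v : v \in Z i -> v \in Z j -> i = j.
Proof.
by move=> vi vj; apply/eqP; apply: contraT => /dZ/disjointFr/(_ vi); rewrite vj.
Qed.

Let F_edge (a b : F) : a -- b ->
  exists i, [/\ copy a b = Some i, copy b a = Some i, pr a -- pr b,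
    fF a = f i (pr a) & fF b = f i (pr b)].
Proof.
case: a b => [u|[u i]] [v|[v j]] /=.
- by move=> uv; have := S_indep (valP u) (valP v); rewrite uv.
- by move=> uv; exists j; split=> //=; rewrite fS //; apply: valP.
- by move=> uv; exists i; split=> //=; rewrite fS //; apply: valP.
by case/andP=> /eqP <- uv; exists i.
Qed.

Let fF_copy (a : F) i : fF a \in Z i -> exists u, a = inr (u, i).
Proof.
case: a => [u|[u j]] /=; first by move=> gz; have := gZ i (valP u); rewrite gz.
by move=> fz; exists u; rewrite (disjZ (fZ j (valP u)) fz).
Qed.

(** As [S] is independent, every edge of the fan has an end outside [S] and so belongs to exactly
    one copy; the disjoint sets [Z i] keep the copies apart. *)
Lemma fan_embedding : topological_embedding fF PF.
Proof.
split.
- move=> [u|[u i]] [v|[v j]] /= E.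
  + by congr inl; apply: val_inj; apply: g_inj E; apply: valP.
  + by have := gZ j (valP u); rewrite E (fZ j (valP v)).
  + by have := gZ i (valP v); rewrite -E (fZ i (valP u)).
  have ij : i = j by apply: (disjZ (fZ i (valP u))); rewrite E; apply: (fZ j (valP v)).
  by subst j; congr (inr (_, _)); apply: val_inj; apply: emb_inj (embf i) _ _ E.
- by move=> a b /F_edge[i [c1 c2 ab _ _]]; rewrite /PF c1 c2; apply: emb_rev (embf i) _ _ ab.
- by move=> a b /F_edge[i [c1 c2 ab _ _]]; rewrite /PF c1; apply: emb_uniq (embf i) _ _ ab.
- move=> a b c /F_edge[i [c1 c2 ab _ _]]; rewrite /PF c1; apply/negP => cP.
  have [u cE] := fF_copy (PZ ab cP).
  by move: cP; rewrite cE /=; apply/negP/(emb_avoid (embf i)).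
- move=> a b a' b' v ea ea'.
  have [i [c1 c2 ab ia ib]] := F_edge ea; have [j [c1' c2' ab' ja jb]] := F_edge ea'.
  rewrite /PF c1 c1' => vP vP'.
  have ij := disjZ (PZ ab vP) (PZ ab' vP'); subst j.
  have E := emb_disj (embf i) ab ab' vP vP'.
  have inj x y z t : copy x y = Some i -> copy z t = Some i -> fF x = f i (pr x) ->
     fF z = f i (pr z) -> pr x = pr z -> x = z.
    move=> {}c1 {}c1' fx fz xz.
    have : fF x = fF z by rewrite fx fz xz.
    move: xz; case: (x) (z) => [u|[u i1]] [w|[w j1]] /= uw E2.
    + by congr inl; apply: val_inj.
    + by have /= := valP w; rewrite -uw; have /= -> := valP u.
    + by have /= := valP u; rewrite uw; have /= -> := valP w.
    have -> : u = w by apply: val_inj.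
    by rewrite (disjZ (fZ i1 (valP u)) (_ : _ \in Z j1)) // E2; apply: (fZ j1 (valP w)).
  have /setP E2 := E; apply/setP => x; rewrite !inE.
  have h (y z : F) (t w : F) : y -- z -> t -- w -> copy y z = Some i -> copy t w = Some i ->
      pr y = pr t -> y = t.
    move=> yz tw h1 h2; have [i1 [+ _ _ f1 _]] := F_edge yz; have [i2 [+ _ _ f2 _]] := F_edge tw.
    rewrite h1 h2 => -[e2] [e1]; rewrite -e1 in f1; rewrite -e2 in f2.
    exact: (inj y z t w).
  have sa : b -- a by rewrite adj_sym.
  have sa' : b' -- a' by rewrite adj_sym.
  have ha := h _ _ _ _ ea ea' c1 c1'; have hab := h _ _ _ _ ea sa' c1 c2'.
  have hba := h _ _ _ _ sa ea' c2 c1'; have hbb := h _ _ _ _ sa sa' c2 c2'.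
  have nab : pr a != pr b by apply: contraTneq ab => ->; rewrite adj_irrefl.
  have := E2 (pr a); rewrite !inE eqxx /= => /esym/orP[/eqP/ha aa'|/eqP/hab ab1].
    have := E2 (pr b); rewrite !inE eqxx orbT /= => /esym/orP[/eqP|/eqP/hbb bb'].
      by rewrite -aa' => /esym/eqP; rewrite (negPf nab).
    by rewrite aa' bb'.
  have := E2 (pr b); rewrite !inE eqxx orbT /= => /esym/orP[/eqP/hba ba1|/eqP].
    by rewrite ab1 ba1 orbC.
  by rewrite -ab1 => /esym/eqP; rewrite (negPf nab).
by move=> a b /F_edge[i [c1 c2 ab -> ->]]; rewrite /PF c1; apply: emb_path (embf i) _ _ ab.
Qed.

End FanEmbedding.

Lemma diamondE (x y : diamond) : (x -- y) = (x != y) && ~~ ((x < 2) && (y < 2)).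
Proof.
rewrite /adj /= /diamond_adj; case: eqVneq => //= xy; congr (~~ _).
have v0 : (inord 0 : 'I_4) = 0 :> nat by rewrite inordK.
have v1 : (inord 1 : 'I_4) = 1 :> nat by rewrite inordK.
apply/eqP/andP => [E|[x2 y2]].
  have hx : x \in [set inord 0; inord 1] by rewrite -E !inE eqxx.
  have hy : y \in [set inord 0; inord 1] by rewrite -E !inE eqxx orbT.
  rewrite !inE in hx hy.
  by case/orP: hx => /eqP->; case/orP: hy => /eqP->; rewrite ?v0 ?v1.
have mem (z : 'I_4) : z < 2 -> (z == inord 0) || (z == inord 1).
  move=> z2; rewrite -!val_eqE /= v0 v1.
  by case: z z2 => [[|[|]]].
apply/setP => z; rewrite !inE.
move: xy; case/orP: (mem x x2) => /eqP->; case/orP: (mem y y2) => /eqP->; rewrite ?eqxx //.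
by rewrite orbC.
Qed.

Section DiamondEmbedding.
Variables (G : sgraph) (c d x0 x1 : G) (p l0 r0 l1 r1 : seq G).
Hypothesis tp : theta_paths adj c d p (l0 ++ x0 :: r0) (l1 ++ x1 :: r1).

(** The degree-3 vertices 2 and 3 go to the ends of the theta. The images [x0], [x1] of 0 and 1 can
    be any inner vertices of the second and third path, so that a prescribed vertex can be made a
    branch vertex. *)
Definition diamond_branch (x : diamond) : G := nth c [:: x0; x1; c; d] x.

Definition diamond_route (x y : diamond) : seq G :=
  match (x : nat), (y : nat) with
  | 2, 3 => p | 3, 2 => rev p
  | 2, 0 => l0 | 0, 2 => rev l0
  | 0, 3 => r0 | 3, 0 => rev r0
  | 2, 1 => l1 | 1, 2 => rev l1
  | 1, 3 => r1 | 3, 1 => rev r1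
  | _, _ => [::]
  end.

(** A code for the five edges that ignores orientation. [loc] reads it off a vertex of a route,
    which shows the routes to be disjoint. *)
Let key (n m : nat) : nat :=
  match n, m with
  | 2, 3 | 3, 2 => 4
  | 2, 0 | 0, 2 => 0
  | 0, 3 | 3, 0 => 1
  | 2, 1 | 1, 2 => 2
  | 1, 3 | 3, 1 => 3
  | _, _ => 5
  end.

Let all_uniq : uniq ([:: x0; x1; c; d] ++ l0 ++ r0 ++ l1 ++ r1 ++ p).
Proof.
case: tp => _ _ _; congr (_ : bool); apply: perm_uniq; apply/permP => h.
by rewrite /= !count_cat /=; clear; lia.
Qed.

Let loc v := if v \in l0 then 0 else if v \in r0 then 1 else if v \in l1 then 2
  else if v \in r1 then 3 else 4.

Let routeE (x y : diamond) v : x -- y -> v \in diamond_route x y ->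
  loc v = key x y /\ v \notin [:: x0; x1; c; d].
Proof.
move: all_uniq; rewrite cat_uniq => /and3P[_ /hasPn nb u] xy vP.
have vin : v \in l0 ++ r0 ++ l1 ++ r1 ++ p.
  move: vP; rewrite /diamond_route !mem_cat.
  by case: (x : nat) => [|[|[|[|n]]]]; case: (y : nat) => [|[|[|[|m]]]] //;
    rewrite ?mem_rev => ->; rewrite ?orbT.
split; last exact: nb.
move: u; rewrite cat_uniq => /and3P[_ /hasPn n0]; rewrite cat_uniq => /and3P[_ /hasPn n1].
rewrite cat_uniq => /and3P[_ /hasPn n2]; rewrite cat_uniq => /and3P[_ /hasPn n3 _].
have m1 : v \in r0 -> v \notin l0 by move=> h; apply: n0; rewrite mem_cat h.
have m2 : v \in l1 -> (v \notin l0) && (v \notin r0).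
  by move=> h; rewrite n0 ?n1 // !mem_cat h ?orbT.
have m3 : v \in r1 -> [&& v \notin l0, v \notin r0 & v \notin l1].
  by move=> h; rewrite n0 ?n1 ?n2 // !mem_cat h ?orbT.
have m4 : v \in p -> [&& v \notin l0, v \notin r0, v \notin l1 & v \notin r1].
  by move=> h; rewrite n0 ?n1 ?n2 ?n3 // !mem_cat h ?orbT.
move: xy vP; rewrite diamondE /diamond_route /loc -val_eqE.
case: x => [[|[|[|[|n]]]] hx] //; case: y => [[|[|[|[|m]]]] hy] //= _;
  rewrite ?mem_rev => h; rewrite ?h //.
all: by [rewrite (negPf (m1 h))|case/andP: (m2 h) => /negPf-> /negPf->
  |case/and3P: (m3 h) => /negPf-> /negPf-> /negPf->
  |case/and4P: (m4 h) => /negPf-> /negPf-> /negPf-> /negPf->].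
Qed.

Lemma diamond_embedding : topological_embedding diamond_branch diamond_route.
Proof.
have [h0 h1 h2 u] := tp; have := all_uniq; rewrite cat_uniq => /and3P[ub _ ul].
have rev_path (a b : G) q : path adj a (rcons q b) -> path adj b (rcons (rev q) a).
  by rewrite (path_rev_sym (@adj_sym G)).
have split_path a (b : G) q l r : path adj a (rcons (l ++ b :: r) q) ->
    path adj a (rcons l b) && path adj b (rcons r q).
  by rewrite rcons_cat rcons_cons -cat_rcons cat_path last_rcons.
have /andP[q1 q2] := split_path _ _ _ _ _ h1; have /andP[q3 q4] := split_path _ _ _ _ _ h2.
split.
- move=> x y; rewrite /diamond_branch => /eqP; rewrite nth_uniq // => /eqP.
  exact: val_inj.
- move=> x y; rewrite diamondE /diamond_route -val_eqE.
  by case: x => [[|[|[|[|n]]]] hx] //; case: y => [[|[|[|[|m]]]] hy] //= _; rewrite ?revK.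
- move=> x y xy; move: ul; rewrite !cat_uniq => /and3P[u1 _ /and3P[u2 _ /and3P[u3 _ /and3P[u4 _ u5]]]].
  rewrite /diamond_route.
  by case: x xy => [[|[|[|[|n]]]] hx] //; case: y => [[|[|[|[|m]]]] hy] //= _; rewrite ?rev_uniq.
- move=> x y z xy; apply/negP => /(routeE xy)[_]; apply/negP; rewrite negbK.
  exact: mem_nth.
- move=> x y x' y' v xy xy' /(routeE xy)[k1 _] /(routeE xy')[k2 _].
  have k12 : key x y = key x' y' by rewrite -k1.
  have [[e1 e2]|[e1 e2]] : (x = x' :> nat /\ y = y' :> nat) \/ (x = y' :> nat /\ y = x' :> nat).
  + move: xy xy' k12; rewrite !diamondE -!val_eqE; clear.
    case: x => [[|[|[|[|n]]]] hx] //; case: y => [[|[|[|[|m]]]] hy] //= _;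
    case: x' => [[|[|[|[|n']]]] hx'] //; case: y' => [[|[|[|[|m']]]] hy'] //= _ _;
    by [left|right].
  + by rewrite (val_inj e1) (val_inj e2).
  by rewrite (val_inj e1) (val_inj e2) setUC.
move=> x y; rewrite diamondE /diamond_route /diamond_branch -val_eqE.
by case: x => [[|[|[|[|n]]]] hx] //; case: y => [[|[|[|[|m]]]] hy] //= _;
  rewrite ?h0 // rev_path.
Qed.

Lemma diamond_route_in x y v : x -- y -> v \in diamond_route x y ->
  v \in l0 ++ r0 ++ l1 ++ r1 ++ p.
Proof.
move=> _; rewrite /diamond_route !mem_cat.
by case: (x : nat) => [|[|[|[|n]]]]; case: (y : nat) => [|[|[|[|m]]]] //;
  rewrite ?mem_rev => ->; rewrite ?orbT.
Qed.

End DiamondEmbedding.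

(** * Fans from many disjoint pieces *)

Section Copies.
Variable G : sgraph.

(** One copy within a fan: [S] is pinned by [g], and all the rest is private to [Z]. *)
Definition copyable (D : sgraph) (S : {set D}) (g : D -> G) (Z : {set G}) : Prop :=
  exists f P, [/\ @topological_embedding D G f P, forall v, v \in S -> f v = g v,
    forall v, v \notin S -> f v \in Z &
    forall x y v, x -- y -> v \in P x y -> v \in Z].

Lemma copies_fan (D : sgraph) (S : {set D}) (g : D -> G) (M : {set {set G}}) k :
  (forall u v, u \in S -> v \in S -> ~~ (u -- v)) -> {in S &, injective g} ->
  (forall Z v, Z \in M -> v \in S -> g v \notin Z) ->
  (forall Z Z', Z \in M -> Z' \in M -> Z != Z' -> [disjoint Z & Z']) ->
  (forall Z, Z \in M -> copyable S g Z) -> k <= #|M| -> top_minor (Fan S k) G.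
Proof.
move=> Si gI gM dM cM kM.
pose z (i : 'I_k) : {set G} := enum_val (widen_ord kM i).
have zM i : z i \in M by apply: enum_valP.
have [fP hfP] := choice (fun i : 'I_k =>
  let: ex_intro f (ex_intro P h) := cM _ (zM i) in
  ex_intro (fun u : (D -> G) * (D -> D -> seq G) =>
    [/\ @topological_embedding D G u.1 u.2, forall v, v \in S -> u.1 v = g v,
    forall v, v \notin S -> u.1 v \in z i &
    forall x y v, x -- y -> v \in u.2 x y -> v \in z i]) (f, P) h).
apply: (embedding_top_minor (fan_embedding Si gI _ _ (Z := z)
  (f := fun i => (fP i).1) (P := fun i => (fP i).2) _ _ _ _)).
- by move=> i v; apply: gM.
- move=> i j ij; apply: dM => //; apply: contra ij => /eqP/enum_val_inj E.
  by apply/eqP/val_inj; have := congr1 val E.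
- by move=> i; have [] := hfP i.
- by move=> i; have [] := hfP i.
- by move=> i; have [] := hfP i.
by move=> i; have [] := hfP i.
Qed.

Lemma copyableI c d x0 x1 (p l0 r0 l1 r1 : seq G) (S : {set diamond}) g (Z : {set G}) :
  theta_paths adj c d p (l0 ++ x0 :: r0) (l1 ++ x1 :: r1) ->
  (forall v, v \in S -> diamond_branch c d x0 x1 v = g v) ->
  (forall y, y \in c :: d :: p ++ (l0 ++ x0 :: r0) ++ (l1 ++ x1 :: r1) -> y \notin Z ->
     exists2 v, v \in S & y = diamond_branch c d x0 x1 v) ->
  copyable S g Z.
Proof.
move=> tp Sg out; have emb := diamond_embedding tp.
have branch_in v : diamond_branch c d x0 x1 v \in
    c :: d :: p ++ (l0 ++ x0 :: r0) ++ (l1 ++ x1 :: r1).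
  rewrite /diamond_branch; case: v => [[|[|[|[|n]]]] hn] //=;
  by rewrite !(inE, mem_cat) eqxx ?orbT.
exists (diamond_branch c d x0 x1), (diamond_route p l0 r0 l1 r1); split=> //.
- move=> v vS; apply: contraT => vZ; have [w wS E] := out _ (branch_in v) vZ.
  by move: vS; rewrite (emb_inj emb E) wS.
move=> x y v xy vP; apply: contraT => vZ.
have vin : v \in c :: d :: p ++ (l0 ++ x0 :: r0) ++ (l1 ++ x1 :: r1).
  have := diamond_route_in xy vP; rewrite !(inE, mem_cat).
  by case/or4P=> [|||/orP[]] ->; rewrite ?orbT.
have [w _ vE] := out _ vin vZ.
by have := emb_avoid emb w xy; rewrite -vE vP.
Qed.

Lemma theta_paths_sym (c d : G) p1 p2 p3 : theta_paths adj c d p1 p2 p3 ->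
  theta_paths adj d c (rev p1) (rev p2) (rev p3).
Proof.
case=> h1 h2 h3 u; split; try by rewrite -(path_rev_sym (@adj_sym G)).
move: u; congr (_ : bool); apply: perm_uniq; apply/permP => h.
by rewrite /= !count_cat !count_rev; clear; lia.
Qed.

Lemma theta_paths_perm12 (c d : G) p1 p2 p3 : theta_paths adj c d p1 p2 p3 ->
  theta_paths adj c d p2 p1 p3.
Proof.
case=> h1 h2 h3 u; split=> //.
move: u; congr (_ : bool); apply: perm_uniq; apply/permP => h.
by rewrite /= !count_cat; clear; lia.
Qed.

Lemma theta_paths_perm23 (c d : G) p1 p2 p3 : theta_paths adj c d p1 p2 p3 ->
  theta_paths adj c d p1 p3 p2.
Proof.
case=> h1 h2 h3 u; split=> //.
move: u; congr (_ : bool); apply: perm_uniq; apply/permP => h.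
by rewrite /= !count_cat; clear; lia.
Qed.

Let v0 : diamond := inord 0.
Let v1 : diamond := inord 1.
Let v2 : diamond := inord 2.

Let v0E : v0 = 0 :> nat. Proof. by rewrite /v0 inordK. Qed.
Let v1E : v1 = 1 :> nat. Proof. by rewrite /v1 inordK. Qed.
Let v2E : v2 = 2 :> nat. Proof. by rewrite /v2 inordK. Qed.

Lemma theta_copy0 g (Z : {set G}) : theta adj Z -> copyable (set0 : {set diamond}) g Z.
Proof.
case/thetaP=> A [B [ABZ /(theta_model_paths (@adj_sym G))]].
case=> c [d [p1 [[|x0 r0] [[|x1 r1] [tp sub //]]]]] _ _.
apply: (@copyableI c d x0 x1 p1 [::] r0 [::] r1) => //= [v|y /sub/(subsetP ABZ)->] //.
by rewrite inE.
Qed.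

(** The cases are the places of [t] in the theta: absent, an end of the three paths (degree 3, as
    [v2]), or inside a path (degree 2, as [v0]). Reordering the paths brings [t] into the second
    one. *)
Lemma theta_copy1 t (Z : {set G}) : theta adj (t |: Z) ->
  [\/ copyable (set0 : {set diamond}) (fun=> t) Z,
      copyable [set v2] (fun=> t) Z | copyable [set v0] (fun=> t) Z].
Proof.
case/thetaP=> A [B [ABZ /(theta_model_paths (@adj_sym G))]].
case=> c [d [p1 [p2 [p3 [tp sub n2 n3]]]]].
have {}sub : {subset c :: d :: p1 ++ p2 ++ p3 <= t |: Z}.
  by move=> y /sub/(subsetP ABZ).
have out y : y \in c :: d :: p1 ++ p2 ++ p3 -> y \notin Z -> y = t.
  by move=> /sub; rewrite !inE => /orP[/eqP//|->].
have branch2 c' d' q1 q2 q3 : theta_paths adj c' d' q1 q2 q3 -> q2 <> [::] -> q3 <> [::] ->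
    (forall y, y \in c' :: d' :: q1 ++ q2 ++ q3 -> y \notin Z -> y = t) -> c' = t ->
    copyable [set v2] (fun=> t) Z.
  case: q2 => // x0 r0; case: q3 => // x1 r1 tp' _ _ out' ct.
  apply: (@copyableI c' d' x0 x1 q1 [::] r0 [::] r1) => //= [v|y yin yZ].
    by rewrite inE => /eqP->; rewrite /diamond_branch v2E.
  by exists v2; rewrite ?inE // (out' _ yin yZ) /diamond_branch v2E.
have branch0 q1 q2 q3 : theta_paths adj c d q1 q2 q3 -> t \in q2 -> q3 <> [::] ->
    (forall y, y \in c :: d :: q1 ++ q2 ++ q3 -> y \notin Z -> y = t) ->
    copyable [set v0] (fun=> t) Z.
  move=> tp' tq; case/splitPr: tq tp' => l0 r0; case: q3 => // x1 r1 tp' _ out'.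
  apply: (@copyableI c d t x1 q1 l0 r0 [::] r1) => //= [v|y yin yZ].
    by rewrite inE => /eqP->; rewrite /diamond_branch v0E.
  by exists v0; rewrite ?inE // (out' _ yin yZ) /diamond_branch v0E.
have [ct|ct] := eqVneq c t; first by apply: Or32; apply: branch2 tp n2 n3 out ct.
have [dt|dt] := eqVneq d t.
  apply: Or32; apply: branch2 (theta_paths_sym tp) _ _ _ dt.
  - by move/(congr1 rev); rewrite revK.
  - by move/(congr1 rev); rewrite revK.
  move=> y yin; apply: out; move: yin; rewrite !(inE, mem_cat, mem_rev).
  by case: (y == c); case: (y == d); case: (y \in p1); case: (y \in p2); case: (y \in p3).
have [t2|t2] := boolP (t \in p2); first by apply: Or33; apply: branch0 tp t2 n3 out.
have [t3|t3] := boolP (t \in p3).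
  apply: Or33; apply: branch0 (theta_paths_perm23 tp) t3 n2 _.
  move=> y yin; apply: out; move: yin; rewrite !(inE, mem_cat).
  by case: (y == c); case: (y == d); case: (y \in p1); case: (y \in p2); case: (y \in p3).
have [t1|t1] := boolP (t \in p1).
  apply: Or33; apply: branch0 (theta_paths_perm12 tp) t1 n3 _.
  move=> y yin; apply: out; move: yin; rewrite !(inE, mem_cat).
  by case: (y == c); case: (y == d); case: (y \in p1); case: (y \in p2); case: (y \in p3).
apply: Or31; apply: theta_copy0.
apply: theta_mono (theta_paths_theta (@adj_sym G) tp n2 n3).
apply/subsetP => y; rewrite inE => yin; apply: contraT => yZ.
have := yin; rewrite (out _ yin yZ) !(inE, mem_cat) (negPf t1) (negPf t2) (negPf t3).
by rewrite ![t == _]eq_sym (negPf ct) (negPf dt).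
Qed.

(** The first path of the theta runs over an edge between [A] and [B], the other two through [t1]
    and [t2]. *)
Lemma rooted_copy t1 t2 (Z : {set G}) : t1 != t2 -> t1 \notin Z -> t2 \notin Z ->
  rooted adj Z t1 t2 ->
  copyable [set v0; v1] (fun v => if v == v0 then t1 else t2) Z.
Proof.
move=> t12 t1Z t2Z [A [B [ABZ cA cB dAB [/exists_inP[a aA /exists_inP[b bB ab]]]]]].
case/andP=> /exists_inP[a1 a1A ta1] /exists_inP[b1 b1B tb1].
case/andP=> /exists_inP[a2 a2A ta2] /exists_inP[b2 b2B tb2].
have [|||||||c [d [p1 [p2 [p3 [tp sub cd [_ s2 s3] _]]]]]] :=
  @two_tripods _ adj (@adj_sym G) A B a a1 a2 b b1 b2 [::] [:: t1] [:: t2] cA cB dAB.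
- by [].
- by [].
- by rewrite /= ab.
- by rewrite /= adj_sym ta1 tb1.
- by rewrite /= adj_sym ta2 tb2.
- by rewrite /= inE t12.
- by move=> x; rewrite mem_seq2 => /orP[]/eqP->; [apply: contra t1Z|apply: contra t2Z]; apply: (subsetP ABZ).
have t1p : t1 \in p2 by apply: s2; rewrite inE.
have t2p : t2 \in p3 by apply: s3; rewrite inE.
case/splitPr: t1p tp sub => l0 r0 tp sub; case/splitPr: t2p tp sub => l1 r1 tp sub.
have v10 : (v1 == v0) = false by rewrite -val_eqE /= v0E v1E.
apply: (copyableI tp) => [v|y /sub].
  rewrite !inE => /orP[]/eqP->; rewrite ?eqxx ?v10 /diamond_branch ?v0E ?v1E //.
rewrite inE /= !inE => /orP[/orP[yA|yB]|/orP[]/eqP->] yZ.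
- by case/negP: yZ; apply: (subsetP ABZ); rewrite inE yA.
- by case/negP: yZ; apply: (subsetP ABZ); rewrite inE yB orbT.
- by exists v0; rewrite ?inE ?eqxx // /diamond_branch v0E.
by exists v1; rewrite ?inE ?eqxx ?orbT // /diamond_branch v1E.
Qed.

Lemma diamond_deg2 : [set v : diamond | deg v == 2] = [set v0; v1].
Proof.
apply/setP => v; rewrite !inE -!val_eqE /= v0E v1E /deg.
have [v2l|v2l] := ltnP v 2.
  have -> : [set u | v -- u] = [set (inord 2 : 'I_4); inord 3].
    apply/setP => u; rewrite !inE diamondE v2l -!val_eqE /= !inordK //.
    by case: u v v2l => [[|[|[|[|u]]]] hu] // [[|[|v]] hv].
  by rewrite cards2 -val_eqE /= !inordK //; case: v v2l => [[|[|v]] hv].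
have -> : [set u | v -- u] = [set~ v].
  by apply/setP => u; rewrite !inE diamondE eq_sym ltnNge v2l andbT.
by rewrite cardsC1 card_ord; case: v v2l => [[|[|v]] hv].
Qed.

Definition fan_set (S : {set diamond}) : Prop :=
  #|S| <= 1 \/ S = [set v : diamond | deg v == 2].

Lemma fan_set_indep (S : {set diamond}) u v : fan_set S -> u \in S -> v \in S -> ~~ (u -- v).
Proof.
case=> [/card_le1_eqP S1 uS vS|->]; first by rewrite (S1 _ _ uS vS) adj_irrefl.
rewrite diamond_deg2 diamondE !inE -!val_eqE /= v0E v1E.
by move=> /orP[]/eqP-> /orP[]/eqP->; rewrite andbF.
Qed.

Lemma theta_packing_fan k : 0 < k -> theta_packing adj [set: G] k ->
  top_minor (Fan (set0 : {set diamond}) k) G.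
Proof.
move=> k0 [M [kM hM dM]].
have /card_gt0P[Z0 Z0M] : 0 < #|M| by apply: leq_trans kM.
(* Any [g] will do for the empty [S], but a vertex of [G] is needed to have one. *)
have /andP[/theta_neq0/set0Pn[x0 _] _] := hM _ Z0M.
apply: (@copies_fan diamond set0 (fun=> x0) M) => //.
- by move=> u v; rewrite inE.
- by move=> u v; rewrite inE.
- by move=> Z v _; rewrite inE.
by move=> Z /hM/andP[thZ _]; apply: theta_copy0.
Qed.

(** The two configurations with [X] whose absence [off_theta_free] assumes; each provides a copy for
    a fan. *)
Definition piece (X Z : {set G}) : Prop :=
  (exists2 t, t \in X & theta adj (t |: Z)) \/
  (exists t1 t2, [/\ t1 \in X, t2 \in X, t1 != t2 & rooted adj Z t1 t2]).

(** Pigeonhole over the vertex [t] and the three cases of [theta_copy1], or over the ordered pairs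
    [(t1, t2)]. *)
Lemma pieces_fan (X : {set G}) (M : {set {set G}}) k : 
  (forall Z, Z \in M -> [disjoint Z & X]) ->
  (forall Z Z', Z \in M -> Z' \in M -> Z != Z' -> [disjoint Z & Z']) ->
  (forall Z, Z \in M -> piece X Z) ->
  #|X| * (3 * k) + #|X| * #|X| * k < #|M| ->
  exists2 S : {set diamond}, fan_set S & top_minor (Fan S k) G.
Proof.
move=> MX dM hM big.
have notZ Z t : Z \in M -> t \in X -> t \notin Z.
  by move=> ZM tX; rewrite (disjointFl (MX _ ZM)).
have fan S g (N : {set {set G}}) : fan_set S -> {in S &, injective g} ->
    N \subset M -> (forall v, v \in S -> g v \in X) ->
    (forall Z, Z \in N -> copyable S g Z) -> k < #|N| ->
    exists2 S : {set diamond}, fan_set S & top_minor (Fan S k) G.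
  move=> fS gI /subsetP NM gX cN kN; exists S => //.
  apply: (@copies_fan diamond S g N) => //; last exact: ltnW.
  - by move=> u v; apply: fan_set_indep.
  - by move=> Z v /NM ZM /gX; apply: notZ.
  by move=> Z Z' /NM ZM /NM Z'M; apply: dM.
pose M1 := [set Z in M | [exists t in X, theta adj (t |: Z)]].
have [big1|small1] := ltnP (#|X| * (3 * k)) #|M1|.
  have [|//|t tX tM1] := @pigeonhole _ _ M1 X (fun Z t => theta adj (t |: Z)) (3 * k).
    by move=> Z; rewrite inE => /andP[_ /exists_inP].
  pose S3 (j : 'I_3) : {set diamond} := nth set0 [:: set0; [set v2]; [set v0]] j.
  have [||j _ jM] := @pigeonhole _ _ [set Z in M1 | theta adj (t |: Z)] [set: 'I_3]
    (fun Z j => `[< copyable (S3 j) (fun=> t) Z >]) k.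
  - move=> Z; rewrite inE => /andP[_ /theta_copy1[h|h|h]].
    + by exists (@Ordinal 3 0 isT) => //; apply/asboolP.
    + by exists (@Ordinal 3 1 isT) => //; apply/asboolP.
    by exists (@Ordinal 3 2 isT) => //; apply/asboolP.
  - by rewrite cardsT card_ord.
  have S1 : #|S3 j| <= 1.
    by rewrite /S3; case: (j) => [[|[|[|n]]] hn] //=; rewrite ?cards0 ?cards1.
  apply: (fan (S3 j) (fun=> t) _ _ _ _ _ _ jM).
  - by left; exact: S1.
  - by move=> u v uS vS _; move/card_le1_eqP: S1; apply.
  - by apply/subsetP => Z; rewrite !inE => /andP[/andP[/andP[]]].
  - by [].
  by move=> Z; rewrite !inE => /andP[_ /asboolP].
have [Z||[t1 t2] tX tM] := @pigeonhole _ _ (M :\: M1) (setX X X)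
  (fun Z t => `[< t.1 != t.2 /\ rooted adj Z t.1 t.2 >]) k.
- rewrite !inE => /andP[+ ZM]; rewrite ZM /= => Z1; case: (hM _ ZM) => [[t tX th]|].
    by case/negP: Z1; apply/exists_inP; exists t.
  case=> t1 [t2 [t1X t2X t12 r]]; exists (t1, t2); first by rewrite inE /= t1X.
  by apply/asboolP.
- rewrite cardsX; have := cardsID M1 M; have -> : M :&: M1 = M1.
    by apply/setIidPr/subsetP => o; rewrite inE => /andP[].
  by move: big small1; clear; lia.
move: tX; rewrite inE /= => /andP[t1X t2X].
have t12 : t1 != t2.
  have /card_gt0P[Z] : 0 < #|[set Z in M :\: M1 | `[< t1 != t2 /\ rooted adj Z t1 t2 >]]|.
    exact: leq_ltn_trans tM.
  by rewrite inE => /andP[_ /asboolP[]].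
have v10 : (v1 == v0) = false by rewrite -val_eqE /= v0E v1E.
apply: (fan [set v0; v1] (fun v => if v == v0 then t1 else t2) _ _ _ _ _ _ tM).
- by right; rewrite diamond_deg2; reflexivity.
- move=> u v; rewrite !inE => /orP[]/eqP-> /orP[]/eqP->; rewrite ?eqxx ?v10 // => E;
  by rewrite E eqxx in t12.
- by apply/subsetP => Z; rewrite !inE => /andP[/andP[_ ->]].
- by move=> v; case: ifP.
move=> Z; rewrite !inE => /andP[/andP[_ ZM] /asboolP[_ r]].
by apply: rooted_copy => //; apply: notZ ZM _.
Qed.

End Copies.

(** * Edge partitions of fans *)

Lemma path_infix (T : eqType) (r : rel T) x s :
  (forall u v, infix [:: u; v] (x :: s) -> r u v) -> path r x s.
Proof.
elim: s x => // y s IH x h /=; apply/andP; split.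
  by apply: h; apply: (prefix_infix [:: x; y] s).
by apply: IH => u v uv; apply: h; apply: (@infix_catl _ [:: u; v] (y :: s) [:: x]).
Qed.

Lemma subdivision_embedding (H K : sgraph) (f : H -> K) (P : H -> H -> seq K) :
  subdivision_via f P -> topological_embedding f P.
Proof.
case=> f_inj Prev Puniq Pav Pdisj _ Pedge; split=> // x y xy.
by apply: path_infix => u v uv; apply/Pedge; exists x, y.
Qed.

Lemma theta_image (T T' : finType) (e : rel T) (e' : rel T') (h : T -> T') (S : {set T}) :
  injective h -> {homo h : x y / e x y >-> e' x y} -> theta e S -> theta e' (h @: S).
Proof.
move=> h_inj h_hom /thetaP[A [B [ABS /and4P[cA cB dAB eAB]]]].
have conn_h U : conn e U -> conn e' (h @: U).
  move=> cU; apply/connP; split.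
    by have [x xU] := conn_ex cU; apply/set0Pn; exists (h x); apply: imset_f.
  move=> V _ /imsetP[x xU ->] hxV cV.
  have /subsetP sub : U \subset h @^-1: V.
    apply: conn_closed cU xU _ _; first by rewrite inE.
    move=> y z yU; rewrite !inE => yV zU yz.
    by apply: (cV (h y)) => //; [apply: imset_f|apply: imset_f|apply: h_hom].
  by apply/subsetP => _ /imsetP[y /sub + ->]; rewrite inE.
apply/thetaP; exists (h @: A), (h @: B); split; first by rewrite -imsetU imsetS.
apply/and4P; split; [exact: conn_h|exact: conn_h| |].
  rewrite disjoints_subset; apply/subsetP => _ /imsetP[x xA ->]; rewrite inE mem_imset //.
  by rewrite (disjointFr dAB).
pose hh (u : T * T) := (h u.1, h u.2).
have hh_inj : injective hh by move=> [a b] [c d] [/h_inj-> /h_inj->].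
rewrite -(card_imset _ hh_inj) in eAB; apply: leq_trans eAB _; apply: subset_leq_card.
apply/subsetP => _ /imsetP[[a b] /[!inE]/= /and3P[aA bB ab] ->].
by rewrite /= !mem_imset // aA bB h_hom.
Qed.

Lemma diamond_minor_theta (G : sgraph) : top_minor diamond G -> theta adj [set: G].
Proof.
case=> K [[f [P /subdivision_embedding emb]] [h [h_inj h_hom]]].
suff thK : theta adj [set: K].
  by apply: theta_mono (theta_image h_inj h_hom thK); apply: subsetT.
have [v0E v1E] : (inord 0 : 'I_4) = 0 :> nat /\ (inord 1 : 'I_4) = 1 :> nat by rewrite !inordK.
have [v2E v3E] : (inord 2 : 'I_4) = 2 :> nat /\ (inord 3 : 'I_4) = 3 :> nat by rewrite !inordK.
pose v0 : diamond := inord 0; pose v1 : diamond := inord 1.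
pose v2 : diamond := inord 2; pose v3 : diamond := inord 3.
have e23 : v2 -- v3 by rewrite diamondE -val_eqE /= v2E v3E.
have e20 : v2 -- v0 by rewrite diamondE -val_eqE /= v2E v0E.
have e03 : v0 -- v3 by rewrite diamondE -val_eqE /= v3E v0E.
have e21 : v2 -- v1 by rewrite diamondE -val_eqE /= v2E v1E.
have e13 : v1 -- v3 by rewrite diamondE -val_eqE /= v3E v1E.
have dis (x y x' y' : diamond) : x -- y -> x' -- y' ->
    ~~ [&& (x == x') || (x == y'), (y == x') || (y == y'), (x' == x) || (x' == y) & (y' == x) || (y' == y)] ->
    has (mem (P x y)) (P x' y') = false.
  move=> xy xy' ne; apply/negbTE; apply: contra ne => /hasP[v /= vP' vP].
  have /setP E := emb_disj emb xy xy' vP vP'.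
  move: (E x) (E y) (E x') (E y'); rewrite !inE !eqxx !orbT /= => <- <- -> ->.
  by [].
have nin x (v : K) (y y' : diamond) : y -- y' -> v = f x -> (v \in P y y') = false.
  by move=> yy' ->; apply/negbTE/(emb_avoid emb).
have fI (x y : diamond) : (f x == f y) = (x == y) := inj_eq (emb_inj emb) x y.
have tp : theta_paths adj (f v2) (f v3) (P v2 v3) (P v2 v0 ++ f v0 :: P v0 v3)
    (P v2 v1 ++ f v1 :: P v1 v3).
  have join a b c : a -- b -> b -- c -> path adj (f a) (rcons (P a b ++ f b :: P b c) (f c)).
    move=> ab bc; rewrite rcons_cat rcons_cons -cat_rcons cat_path last_rcons.
    by rewrite !(emb_path emb).
  split; [exact: emb_path emb _ _ e23|exact: join|exact: join|].
  have -> : uniq [:: f v2, f v3 & P v2 v3 ++ (P v2 v0 ++ f v0 :: P v0 v3) ++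
      P v2 v1 ++ f v1 :: P v1 v3] =
    uniq ([:: f v0; f v1; f v2; f v3] ++ P v2 v3 ++ P v2 v0 ++ P v0 v3 ++ P v2 v1 ++ P v1 v3).
    by apply: perm_uniq; apply/permP => g; rewrite /= !count_cat /=; clear; lia.
  rewrite cat_uniq; apply/and3P; split.
  - by rewrite /= !inE !fI -!val_eqE /= v0E v1E v2E v3E.
  - apply/hasPn => v vin; apply/negP; rewrite !inE.
    move=> /or4P[]/eqP vE; move: vin; rewrite !mem_cat;
    by rewrite !(nin _ _ _ _ e23 vE) !(nin _ _ _ _ e20 vE) !(nin _ _ _ _ e03 vE)
      !(nin _ _ _ _ e21 vE) !(nin _ _ _ _ e13 vE).
  rewrite !cat_uniq !has_cat !(emb_uniq emb) //.
  by rewrite !dis //= -!val_eqE /= ?v0E ?v1E ?v2E ?v3E.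
apply: theta_mono (theta_paths_theta (@adj_sym K) tp _ _); first exact: subsetT.
- by case: (P v2 v0).
- by case: (P v2 v1).
Qed.

Lemma einduced_diamond_theta (G : sgraph) (E : {set {set G}}) :
  top_minor diamond (einduced E) ->
  theta [rel u v : G | (u -- v) && ([set u; v] \in E)] (cover E).
Proof.
move/diamond_minor_theta => th; apply: theta_mono (theta_image val_inj _ th) => //.
by apply/subsetP => _ /imsetP[u _ ->]; apply: (valP u).
Qed.

Lemma edgesP (G : sgraph) (E : {set G}) :
  reflect (exists u v, u -- v /\ E = [set u; v]) (E \in edges G).
Proof.
apply: (iffP imsetP) => [[[u v] /[!inE]/= uv ->]|[u [v [uv ->]]]]; first by exists u, v.
by exists (u, v); rewrite ?inE.
Qed.

Lemma single_edge_diamond_free (G : sgraph) (E : {set G}) :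
  E \in edges G -> top_minor_free diamond (einduced [set E]).
Proof.
move=> /edgesP[u [v [uv ->]]] [K [[f [P /branch_inj f_inj]] [h [h_inj _]]]].
have := leq_card (h \o f) (inj_comp h_inj f_inj).
rewrite card_ord card_sig; apply/negP; rewrite -ltnNge.
apply: (@leq_ltn_trans #|[set u; v]|); last by rewrite cards2; case: (_ == _).
by apply: subset_leq_card; apply/subsetP => x; rewrite inE /cover big_set1.
Qed.

Lemma labelling_brittle (C : graph_class) (G : sgraph) (L : finType)
    (lab : {set G} -> L) (W : {set G}) :
  (forall E0, E0 \in edges G ->
     C (einduced [set E in edges G | lab E == lab E0])) ->
  (forall v E E', v \notin W -> E \in edges G -> E' \in edges G ->
     v \in E -> v \in E' -> lab E = lab E') ->
  exists2 l, l <= #|W| & brittle_with C G l.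
Proof.
move=> hC hW; pose P := preim_partition lab (edges G).
have PE A : A \in P -> exists2 E0, E0 \in edges G & A = [set E in edges G | lab E == lab E0].
  case/imsetP=> E0 E0G ->; exists E0 => //; apply/setP => E; rewrite !inE.
  by rewrite eq_sym.
exists #|shared_vertices P|; last first.
  exists P; split=> //; first exact: preim_partitionP.
  by move=> A /PE[E0 E0G ->]; apply: hC.
apply: subset_leq_card; apply/subsetP => v; rewrite inE.
case/exists_inP=> A AP /exists_inP[B BP /and3P[AB /bigcupP[E EA vE] /bigcupP[E' E'B vE']]].
apply: contraT => vW; have [E0 E0G AE] := PE _ AP; have [E1 E1G BE] := PE _ BP.
move: EA E'B; rewrite AE BE !inE => /andP[EG /eqP lE] /andP[E'G /eqP lE'].
case/eqP: AB; rewrite AE BE; apply/setP => E2; rewrite !inE -lE -lE'.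
by rewrite (hW v E E').
Qed.

(** Once some value is attained, [xget] returns a true minimum and not its default 0. *)
Lemma kappa_spec (C : graph_class) (G : sgraph) l : brittle_with C G l ->
  brittle_with C G (kappa C G) /\ kappa C G <= l.
Proof.
move=> bl; pose Q l := `[< brittle_with C G l >].
have exQ : exists l, Q l by exists l; apply/asboolP.
case: (ex_minnP exQ) => m /asboolP bm minm.
have : exists l, brittle_with C G l /\ forall m, brittle_with C G m -> l <= m.
  by exists m; split=> // m' bm'; apply: minm; apply/asboolP.
move=> /(classical_sets.xgetPex 0)[bk mink]; split=> //; exact: mink.
Qed.

(** [S] cannot contain both degree-3 vertices, which are adjacent; the one left out sees all other
    vertices. *)
Lemma fan_set_hub (S : {set diamond}) : fan_set S ->
  exists h : diamond, h \notin S /\ forall v, v != h -> h -- v.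
Proof.
have v2E : (inord 2 : 'I_4) = 2 :> nat by rewrite inordK.
have v3E : (inord 3 : 'I_4) = 3 :> nat by rewrite inordK.
have hub (h : diamond) : 2 <= h -> forall v, v != h -> h -- v.
  by move=> h2 v vh; rewrite diamondE eq_sym vh ltnNge h2.
move=> fS; have [v2S|v2S] := boolP ((inord 2 : diamond) \in S); last first.
  by exists (inord 2); split=> //; apply: hub; rewrite v2E.
exists (inord 3); split; last by apply: hub; rewrite v3E.
apply/negP => v3S; have := fan_set_indep fS v2S v3S.
by rewrite diamondE -val_eqE /= v2E v3E.
Qed.

Lemma fan_brittle (S : {set diamond}) k l : fan_set S ->
  brittle_with (top_minor_free diamond) (Fan S k) l -> k <= l.
Proof.
move=> fS [P [partP freeP <-]]; rewrite leqNgt; apply/negP => small.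
pose F := Fan S k.
pose pr (a : F) : diamond := match a with inl u => val u | inr (u, _) => val u end.
pose on_copy (i : 'I_k) (a : F) := if a is inr (_, j) then j == i else true.
have [phi phiP] : exists phi : 'I_k -> diamond -> F,
    forall i v, pr (phi i v) = v /\ on_copy i (phi i v).
  apply: (@fin_all_exists _ (fun=> diamond -> F)
    (fun i ph => forall v, pr (ph v) = v /\ on_copy i (ph v))) => i.
  apply: (@fin_all_exists diamond (fun=> F) (fun v a => pr a = v /\ on_copy i a)) => v.
  have [vS|vS] := boolP (v \in S); first by exists (inl (exist _ v vS)).
  by exists (inr (exist _ v vS, i)); split=> //=; rewrite eqxx.
have phiK i : cancel (phi i) pr by move=> v; have [] := phiP i v.
have phi_adj i u v : u -- v -> phi i u -- phi i v.
  have [eu cu] := phiP i u; have [ev cv] := phiP i v.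
  move: cu cv eu ev; case: (phi i u) (phi i v) => [a|[a j]] [b|[b j']] /= => cu cv <- <- //.
  by move=> ->; rewrite (eqP cu) (eqP cv) eqxx.
have phi_copy i j u v : u \notin S -> phi i u = phi j v -> i = j.
  move=> uS E; have [eu cu] := phiP i u; have [_ cv] := phiP j v.
  move: eu cu cv; rewrite -E; case: (phi i u) => [a|[a j']] /= eu.
    by have /= := valP a; rewrite eu (negPf uS).
  by move=> /eqP<- /eqP<-.
(* Otherwise each copy has a shared vertex outside [S], and these are distinct, which makes [k]
   shared vertices. *)
have [i noshare] : exists i : 'I_k, forall v, v \notin S -> phi i v \notin shared_vertices P.
  have [/existsP[i /forall_inP h]|no] := boolP [exists i : 'I_k,
    [forall v in ~: S, phi i v \notin shared_vertices P]].
    by exists i => v vS; apply: h; rewrite inE.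
  exfalso.
  have ex i : exists v, (v \notin S) && (phi i v \in shared_vertices P).
    move: no; rewrite negb_exists => /forallP/(_ i); rewrite negb_forall_in => /exists_inP[v].
    by rewrite inE negbK => vS vsh; exists v; rewrite vS.
  have [g hg] := fin_all_exists ex.
  have g_inj : injective (fun i => phi i (g i)).
    by move=> a b /phi_copy; apply; case/andP: (hg a).
  move: small; rewrite ltnNge -[k in k <= _]card_ord => /negP[].
  rewrite -(card_codom g_inj); apply: subset_leq_card; apply/subsetP => _ /codomP[a ->].
  by case/andP: (hg a).
have [h [hS hub]] := fan_set_hub fS.
have coverP : cover P = edges F by case/and3P: partP => /eqP.
have edge u v : u -- v -> [set phi i u; phi i v] \in edges F.
  by move=> uv; apply/edgesP; exists (phi i u), (phi i v); split=> //; apply: phi_adj.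
have same v E E' A B : v \notin S -> A \in P -> B \in P -> E \in A -> E' \in B ->
    phi i v \in E -> phi i v \in E' -> A = B.
  move=> vS AP BP EA E'B vE vE'; apply/eqP; apply: contraNT (noshare _ vS) => AB.
  rewrite inE; apply/exists_inP; exists A => //; apply/exists_inP; exists B => //.
  by apply/and3P; split=> //; apply/bigcupP; [exists E|exists E'].
have [w hw] : exists w, h -- w.
  have [w wh|all_h] := pickP (fun w : diamond => w != h).
    by exists w; apply: hub.
  have := card_ord 4; rewrite (@eq_card1 _ h) // => x.
  by have := all_h x; rewrite inE => /negbFE.
have [B BP wB] : exists2 B, B \in P & [set phi i h; phi i w] \in B.
  by have := edge _ _ hw; rewrite -coverP => /bigcupP[B]; exists B.
have in2l u v : phi i u \in [set phi i u; phi i v] by rewrite !inE eqxx.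
have in2r u v : phi i v \in [set phi i u; phi i v] by rewrite !inE eqxx orbT.
(* All edges at the unshared hub lie in [B]; an edge at another unshared vertex [u] lies in the same
   part as the edge from the hub to [u]. *)
have inB0 u v : u -- v -> u \notin S -> [set phi i u; phi i v] \in B.
  move=> uv uS; have [uh|uh] := eqVneq u h.
    have := edge _ _ uv; rewrite -coverP => /bigcupP[A AP EA].
    by rewrite (same h _ _ B A hS BP AP wB EA) // ?in2l // -uh in2l.
  have := edge _ _ (hub _ uh); rewrite -coverP => /bigcupP[A AP EA].
  have := edge _ _ uv; rewrite -coverP => /bigcupP[A' AP' EA'].
  rewrite (same h _ _ B A hS BP AP wB EA (in2l _ _) (in2l _ _)).
  by rewrite (same u _ _ A A' uS AP AP' EA EA' (in2r _ _) (in2l _ _)).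
have inB u v : u -- v -> [set phi i u; phi i v] \in B.
  move=> uv; have [uS|uS] := boolP (u \in S); last exact: inB0.
  have [vS|vS] := boolP (v \in S); first by have := fan_set_indep fS uS vS; rewrite uv.
  by rewrite setUC; apply: inB0; rewrite // adj_sym.
have inc v : phi i v \in cover B.
  apply/bigcupP; have [->|vh] := eqVneq v h; first by exists [set phi i h; phi i w].
  by exists [set phi i h; phi i v]; [apply: inB; apply: hub|].
apply: (freeP _ BP); apply: isubgraph_top_minor.
exists (fun v => exist _ (phi i v) (inc v) : einduced B); split.
  by move=> u v /(congr1 val) /= /(can_inj (phiK i)).
by move=> u v uv; apply/andP; split; [exact: phi_adj|exact: inB].
Qed.

Lemma fan_unbounded (S : {set diamond}) k : fan_set S ->
  k <= kappa (top_minor_free diamond) (Fan S k).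
Proof.
move=> fS.
(* The partition into single edges shows that [kappa] is not the default value. *)
have [E0 E0G||l _ bl] := @labelling_brittle (top_minor_free diamond) (Fan S k) _ id [set: Fan S k].
- have -> : [set E in edges (Fan S k) | id E == id E0] = [set E0].
    apply/setP => E; rewrite !inE; case: eqVneq => [->|_]; by rewrite ?E0G ?andbT ?andbF.
  exact: single_edge_diamond_free.
- by move=> v E E'; rewrite inE.
have [bk _] := kappa_spec bl; exact: fan_brittle bk.
Qed.

(** * Edge partitions of graphs without fans *)

Definition piece_bound (x k : nat) : nat := x * (3 * k) + x * x * k.

Lemma piece_bound_mono x y k : x <= y -> piece_bound x k <= piece_bound y k.
Proof. by move=> xy; rewrite leq_add ?leq_mul. Qed.

(** One piece more than a graph without fans allows, times [3 + q] of [packing_connected] with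
    [q = 0]. *)
Definition separator_bound (k : nat) : nat := (piece_bound (theta_bound k) k).+1 * 3.

Definition hub_bound (k : nat) : nat := theta_bound k + separator_bound k.

(** Shared vertices lie in [X] or [Y], or are among the at most two neighbours that a vertex of [Y]
    outside [X] has in a bad component. *)
Definition kappa_bound (k : nat) : nat :=
  hub_bound k + piece_bound (hub_bound k) k * (separator_bound k * 2).

Lemma card_bigcup_le (I T : finType) (A : {set I}) (F : I -> {set T}) n :
  (forall i, i \in A -> #|F i| <= n) -> #|\bigcup_(i in A) F i| <= #|A| * n.
Proof.
move=> hF; rewrite -sum_nat_const.
elim/big_ind2: _ => [|s B t D sB tD|i iA]; first by rewrite cards0.
  exact: leq_trans (leq_card_setU _ _) (leq_add _ _).
exact: hF.
Qed.

Section Brittle.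
Variables (G : sgraph) (k : nat).
Hypothesis k_gt0 : 0 < k.
Hypothesis no_fan : forall S : {set diamond}, fan_set S -> ~ top_minor (Fan S k) G.

Let e : rel G := adj.
Let e_sym : symmetric e := @adj_sym G.

Lemma few_pieces (X : {set G}) (M : {set {set G}}) :
  (forall Z, Z \in M -> [disjoint Z & X]) ->
  (forall Z Z', Z \in M -> Z' \in M -> Z != Z' -> [disjoint Z & Z']) ->
  (forall Z, Z \in M -> piece X Z) -> #|M| <= piece_bound #|X| k.
Proof.
move=> MX dM hM; rewrite leqNgt; apply/negP => big.
by have [S fS] := pieces_fan MX dM hM big; apply: no_fan.
Qed.

Lemma piece_free_theta_free (X H : {set G}) : conn e H -> [disjoint H & X] ->
  ~~ theta e H -> ~ piece X H -> ~~ theta (off_rel e X) (H :|: X).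
Proof.
move=> cH dHX nth np; apply: off_theta_free => //.
  by move=> t tX; apply/negP => th; apply: np; left; exists t.
by move=> t1 t2 t1X t2X t12 r; apply: np; right; exists t1, t2.
Qed.

Lemma theta_hitting_set :
  exists2 X : {set G}, #|X| <= theta_bound k & ~~ theta e (~: X).
Proof.
have [tp|[X Xc nth]] := theta_erdos_posa e_sym k [set: G]; last by exists X; rewrite -?setTD.
by case: (@no_fan set0); [left; rewrite cards0|apply: theta_packing_fan].
Qed.

Lemma piece_hitting_set (X : {set G}) : #|X| <= theta_bound k -> ~~ theta e (~: X) ->
  exists2 Y : {set G}, #|Y| <= separator_bound k &
    forall Z, conn e Z -> Z \subset ~: X -> [disjoint Z & Y] -> ~ piece X Z.
Proof.
move=> Xc nth.
pose O := [set o : {set G} * {set G} | [&& conn e o.1, o.1 \subset ~: X, o.2 == set0 &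
  `[< piece X o.1 >]]].
have [|[M [/subsetP MO MN dM]]|[Y Yc hY]] :=
  @packing_connected _ e (~: X) O 0 e_sym nth _ (piece_bound (theta_bound k) k).+1.
- by move=> o; rewrite inE => /and4P[-> -> /eqP-> _]; rewrite cards0.
- exfalso; have inj : {in M &, injective (fun o : {set G} * {set G} => o.1)}.
    move=> o o' oM o'M oo'; apply/eqP; apply: contraT => ne.
    have [d _] := dM _ _ oM o'M ne; move: (MO _ o'M); rewrite inE => /and4P[/conn_ex[x xo] _ _ _].
    by move: (xo); rewrite -(disjointFr d (x := x)) ?oo' // xo.
  have : #|[set o.1 | o in M]| <= piece_bound #|X| k.
    apply: few_pieces.
    + move=> _ /imsetP[o /MO + ->]; rewrite inE => /and4P[_ oX _ _].
      by rewrite disjoints_subset.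
    + move=> _ _ /imsetP[o oM ->] /imsetP[o' o'M ->] ne.
      have oo' : o != o' by apply: contraNneq ne => ->.
      by have [] := dM o o' oM o'M oo'.
    by move=> _ /imsetP[o /MO + ->]; rewrite inE => /and4P[_ _ _ /asboolP].
  rewrite card_in_imset // MN leqNgt ltnS => /negP[].
  exact: piece_bound_mono.
exists Y => // Z cZ ZX dZY pZ.
have /hY : (Z, set0) \in O by rewrite inE /= cZ ZX eqxx; apply/asboolP.
by rewrite /= dZY -setI_eq0 set0I eqxx.
Qed.

Lemma kappa_le_bound : kappa (top_minor_free diamond) G <= kappa_bound k.
Proof.
have [X Xc nthX] := theta_hitting_set.
have [Y Yc hY] := piece_hitting_set Xc nthX.
pose V := X :|: Y.
have Vc : #|V| <= hub_bound k by apply: leq_trans (leq_card_setU _ _) (leq_add Xc Yc).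
pose R := ~: V; pose cp x := component e R x.
have RX : R \subset ~: X by rewrite setCS subsetUl.
pose bad := [set cp x | x in [set x in R | `[< piece V (cp x) >]]].
have badc : #|bad| <= piece_bound (hub_bound k) k.
  apply: leq_trans (piece_bound_mono k Vc); apply: few_pieces.
  - move=> _ /imsetP[x _ ->]; rewrite disjoints_subset; exact: comp_sub.
  - by move=> _ _ /imsetP[x _ ->] /imsetP[y _ ->]; apply: comp_disj.
  by move=> _ /imsetP[x + ->]; rewrite inE => /andP[_ /asboolP].
pose W := V :|: \bigcup_(C in bad) \bigcup_(y in Y :\: X) [set b in C | e y b].
have Wc : #|W| <= kappa_bound k.
  apply: leq_trans (leq_card_setU _ _) (leq_add Vc _).
  apply: (@leq_trans (#|bad| * (separator_bound k * 2))); last by rewrite leq_mul2r badc orbT.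
  apply: card_bigcup_le => _ /imsetP[x + ->]; rewrite inE => /andP[xR _].
  apply: (@leq_trans (#|Y :\: X| * 2)); last first.
    rewrite leq_mul2r /=; apply: leq_trans Yc; apply: subset_leq_card; exact: subsetDl.
  apply: card_bigcup_le => y /setDP[yY yX]; rewrite leqNgt; apply/negP.
  (* Three neighbours of [y] in one component would make a theta that avoids [X]. *)
  move=> /card_gt2_subset3[a [b [c []]]]; rewrite !inE => -[/andP[aC ya] /andP[bC yb] /andP[cC yc]].
  move=> abc; case/negP: nthX; apply/thetaP; exists [set y], (cp x); split.
    rewrite subUset sub1set inE yX; apply: subset_trans RX; exact: comp_sub.
  apply: (@theta_star _ _ y (cp x) a b c) => //; first exact: comp_conn.
  by apply/negP => /(subsetP (comp_sub _ _ _)); rewrite !inE yY orbT.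
(* An edge meets at most one component of [R], so [ce E] is that component, or empty when [E] lies
   in [V]. *)
pose ce (E : {set G}) := \bigcup_(x in E :&: R) cp x.
pose single (E : {set G}) := (E \subset V) || (ce E \in bad) && (E :&: (Y :\: X) != set0).
(* Left labels make an edge a part by itself; right labels collect the edges at one component. *)
pose lab (E : {set G}) : {set G} + {set G} := if single E then inl E else inr (ce E).
have ceE E x : E \in edges G -> x \in E -> x \in R -> ce E = cp x.
  move=> /edgesP[u [v [uv EE]]] xE xR; apply/eqP; rewrite eqEsubset; apply/andP; split.
    apply/bigcupsP => y /setIP[yE yR]; suff -> : cp y = cp x by [].
    have [<-//|xy] := eqVneq x y.
    apply: comp_eq => //; apply: comp_closed (comp_in e xR) yR _ => //.
    move: xE yE xy; rewrite EE !inE => /orP[]/eqP-> /orP[]/eqP->; rewrite ?eqxx // => _.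
    by rewrite e_sym.
  by apply: bigcup_sup; rewrite inE xE.
have RV x : (x \in R) = (x \notin V) by rewrite inE.
have part_free E0 : E0 \in edges G ->
    top_minor_free diamond (einduced [set E in edges G | lab E == lab E0]).
  move=> E0G; have [sE0|sE0] := boolP (single E0).
    suff -> : [set E in edges G | lab E == lab E0] = [set E0] by apply: single_edge_diamond_free.
    apply/setP => E; rewrite !inE /lab sE0; case: ifP => sE.
      rewrite (inj_eq (@inl_inj _ _)) andbC; case: eqP => [->|] //=.
    by rewrite andbF; apply/esym/eqP => E1; rewrite E1 sE0 in sE.
  have [/subsetP inV|/subsetPn[x xE0 xV]] := boolP (E0 \subset V).
    by case/negP: sE0; apply/orP; left; apply/subsetP.
  have xR : x \in R by rewrite RV.
  have cE0 := ceE _ _ E0G xE0 xR.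
  have inA E : E \in [set E in edges G | lab E == lab E0] ->
      [/\ E \in edges G, ~~ single E & ce E = cp x].
    rewrite inE /lab (negPf sE0) cE0 => /andP[EG]; case: ifP => // sE.
    by rewrite (inj_eq (@inr_inj _ _)) => /eqP; split.
  move=> /einduced_diamond_theta th.
  have cC : conn e (cp x) by apply: comp_conn.
  have CR : cp x \subset R by apply: comp_sub.
  have nthC : ~~ theta e (cp x).
    by apply: contra nthX; apply: theta_mono; apply: subset_trans RX.
  have inC E y : E \in edges G -> ~~ single E -> ce E = cp x -> y \in E -> y \in R -> y \in cp x.
    by move=> EG _ cE yE yR; rewrite -cE (ceE _ _ EG yE yR) comp_in.
  (* The vertices of [V] that this part can use. For a bad component the edges to [Y :\: X] have
     been split off, which leaves [X], and there [hY] excludes a piece; a good component forms none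
     with [V] itself. *)
  pose Q := if cp x \in bad then X else V.
  have QV : Q \subset V by rewrite /Q; case: ifP => _; rewrite ?subsetUl.
  have dCQ : [disjoint cp x & Q].
    by rewrite disjoints_subset; apply: subset_trans CR _; rewrite setCS.
  have npQ : ~ piece Q (cp x).
    rewrite /Q; case: ifP => [_|/negP nbad].
      apply: hY => //; first exact: subset_trans RX.
      by rewrite disjoints_subset; apply: subset_trans CR _; rewrite setCS subsetUr.
    move=> pV; apply: nbad; apply/imsetP; exists x => //.
    by rewrite inE xR; apply/asboolP.
  have inQ E y : E \in [set E in edges G | lab E == lab E0] -> y \in E -> y \notin cp x -> y \in Q.
    move=> /inA[EG sE cE] yE yC.
    have yV : y \in V by apply: contraNT yC; rewrite -RV; apply: inC EG sE cE yE.
    rewrite /Q; case: ifP => // Cbad.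
    move: sE; rewrite negb_or cE Cbad /= negbK => /andP[_ /eqP E0'].
    move: yV; rewrite inE => /orP[//|yY]; apply: contraT => yX.
    by have := in_set0 y; rewrite -E0' !inE yE yY yX.
  case/negP: (piece_free_theta_free cC dCQ nthC npQ).
  case/thetaP: th => A [B [AB /and4P[cA cB dAB eAB]]].
  (* Edges inside [V] are parts by themselves, so [off_rel] loses no edge of this part. *)
  have rel_off u v : [rel u v : G | (u -- v) && ([set u; v] \in
      [set E in edges G | lab E == lab E0])] u v -> off_rel e Q u v.
    move=> /andP[uv /inA[EG sE _]]; rewrite /off_rel /e uv /=.
    apply: contra sE => /andP[uQ vQ]; apply/orP; left.
    by apply/subsetP => y; rewrite !inE => /orP[]/eqP->; have := subsetP QV; rewrite /V => h;
      have := h _ uQ; have := h _ vQ; rewrite !inE.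
  apply/thetaP; exists A, B; split.
    apply: subset_trans AB _; apply/subsetP => y /bigcupP[E EA yE].
    by rewrite inE; case: (boolP (y \in cp x)) => //= yC; apply: inQ EA yE yC.
  apply/and4P; split=> //; [by apply: conn_sub cA => u v _ _; apply: rel_off|
    by apply: conn_sub cB => u v _ _; apply: rel_off|].
  apply: leq_trans eAB _; apply: subset_leq_card; apply/subsetP => -[u v].
  move=> uvin; move: uvin; rewrite inE => /and3P[uA vB uv].
  by rewrite inE /= uA vB; apply: rel_off.
have [v E E' vW EG E'G vE vE'|l lW bl] := labelling_brittle part_free (W := W); last first.
  by have [_ kl] := kappa_spec bl; apply: leq_trans kl (leq_trans lW Wc).
have vR : v \in R by rewrite RV; apply: contra vW => vV; rewrite inE vV.
suff labE E1 : E1 \in edges G -> v \in E1 -> lab E1 = inr (cp v) by rewrite !labE.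
move=> E1G vE1; have cE := ceE _ _ E1G vE1 vR; rewrite /lab /single cE ifN //.
rewrite negb_or; apply/andP; split.
  by apply/subsetPn; exists v => //; rewrite -RV.
apply/negP => /andP[Cbad /set0Pn[y /setIP[yE1 yY]]]; case/negP: vW.
rewrite inE; apply/orP; right; apply/bigcupP; exists (cp v) => //.
apply/bigcupP; exists y => //; rewrite inE comp_in //=.
have vy : v != y.
  by apply: contraTneq vR => ->; rewrite RV negbK inE; case/setDP: yY => ->; rewrite orbT.
move: E1G => /edgesP[a [b [ab EE]]]; move: vE1 yE1 vy; rewrite EE !inE.
by move=> /orP[]/eqP-> /orP[]/eqP->; rewrite ?eqxx // /e => _; rewrite // adj_sym.
Qed.

End Brittle.

Lemma fan_mono (S : {set diamond}) k k' : k <= k' -> top_minor (Fan S k) (Fan S k').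
Proof.
move=> kk'; apply: isubgraph_top_minor.
exists (fun a : Fan S k => match a with
  | inl u => inl u | inr (u, i) => inr (u, widen_ord kk' i) end : Fan S k'); split.
  move=> [u|[u i]] [v|[v j]] //= [->] // ij.
  by congr (inr (_, _)); apply: val_inj.
move=> [u|[u i]] [v|[v j]] //=.
Qed.

Theorem theorem1p5 (GG : graph_class) (hGG : ideal GG) :
  bounded_on (kappa (top_minor_free diamond)) GG <->
  (forall S : {set diamond},
     #|S| <= 1 \/ S = [set v : diamond | deg v == 2] ->
     ~ subclass (FAN S) GG).
Proof.
have [_ minor_closed] := hGG; split=> [[b hb] S fS sub|hS].
  have : kappa (top_minor_free diamond) (Fan S b.+1) <= b.
    by apply/hb/sub; exists b.+1 => //; apply: top_minor_refl.
  by apply/negP; rewrite -ltnNge; apply: fan_unbounded.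
(* As [GG] is closed under topological minors, if it does not contain [FAN S] then it leaves out
   some [Fan S n]. For sets [S] that are not listed the value is arbitrary. *)
have [kS hkS] : exists kS : {set diamond} -> nat,
    forall S, fan_set S -> ~ GG (Fan S (kS S)).
  apply: (@fin_all_exists _ (fun=> nat) (fun S n => fan_set S -> ~ GG (Fan S n))) => S.
  apply: contrapT => no; have fS : fan_set S.
    by apply: contrapT => nfS; apply: no; exists 0 => /nfS.
  apply: (hS S fS) => H [n n0 nH]; apply: contrapT => nGH; apply: no; exists n => _ GF.
  exact: nGH (minor_closed _ _ nH GF).
(* One order for all [S] at once, by monotonicity of fans; the successor makes it positive. *)
pose k := (\max_S kS S).+1.
exists (kappa_bound k) => G GGG; apply: kappa_le_bound => // S fS SG.
apply: (hkS S fS); apply: minor_closed (minor_closed _ _ SG GGG).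
by apply: fan_mono; apply: leqW; apply: (leq_bigmax S).
Qed.
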